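(* Let $\phi\in\mathcal S_d$ satisfy all hypotheses of the main local limit theorem stated in the context, with $\Omega_i(\phi)\ne\emptyset$ and common drift $\alpha$ of the points of $\Omega_i(\phi)$. Then for each compact $K\subseteq\mathbb{R}^d$ there exist $C'>0$ and a nested increasing sequence of compact sets $K_n$, each containing $K$, with $\bigcup_nK_n=\mathbb{R}^d$, such that $|\phi^{(n)}(x)|\le C'n^{-\mu_\phi}$ for all $n\in\mathbb{N}_+$ and $x\in(n\alpha+K_n)\cap\mathbb{Z}^d$. Moreover, there is $C>0$ such that $Cn^{-\mu_\phi}\le\sup_{x\in\mathbb{Z}^d}|\phi^{(n)}(x)|$ for all $n\in\mathbb{N}_+$.
   Context: Hypotheses (of the main local limit theorem): $\sup_\xi|\widehat\phi(\xi)|=1$; every point of $\Omega(\phi)$ is of positive or imaginary homogeneous type for $\widehat\phi$; with $\Omega_i(\phi)$ the points of imaginary homogeneous type and $\mu_\phi=\min_{\xi\in\Omega(\phi)}\mu_\xi$: (i) $\mu_\xi<1$ for all $\xi\in\Omega_i(\phi)$; (ii) $\mu_\xi=\mu_\phi$ for some $\xi\in\Omega_i(\phi)$; (iii) all $\xi\in\Omega_i(\phi)$ share the same drift $\alpha_\xi=\alpha$. Definitions: $t^E:=\exp(\log(t)E)$. $P$ homogeneous w.r.t. $E$: $P(t^E\xi)=tP(\xi)$; $\mathrm{Exp}(P)$ = set of such $E$. Positive homogeneous: real, continuous, positive definite ($\ge0$, zero only at $0$), $\mathrm{Exp}(P)\ne\emptyset$, $\{P=1\}$ compact; homogeneous order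 $\mu_P=\mathrm{tr}E$, $E\in\mathrm{Exp}(P)$. Subhomogeneous w.r.t. $E$ (with $\|t^E\|\to0$ as $t\to0$): for each $\epsilon>0$, compact $K$ there is $\tau>0$ with $|\widetilde P(t^E\xi)|\le\epsilon t$, $0<t<\tau$, $\xi\in K$; strongly subhomogeneous of order $l$: $C^l$ near $0$, $|t^k\partial_t^k\widetilde P(t^E\xi)|\le\epsilon t$ for $k\le l$. $\mathcal S_d$ = $\phi:\mathbb{Z}^d\to\mathbb{C}$ with all $\sum_x|x^\beta\phi(x)|<\infty$; $\widehat\phi(\xi)=\sum_x\phi(x)e^{ix\cdot\xi}$; $\phi^{(n)}$ the $n$-fold convolution power; $\Omega(\phi)=\{\xi\in(-\pi,\pi]^d:|\widehat\phi(\xi)|=1\}$. For $\xi_0\in\Omega(\phi)$, $\Gamma_{\xi_0}(\xi)=\log(\widehat\phi(\xi+\xi_0)/\widehat\phi(\xi_0))$ near $0$ written $i\alpha\cdot\xi-i(Q+\widetilde Q)-(R+\widetilde R)$ ($\alpha\in\mathbb{R}^d$; $Q,R$ real polynomials vanishing at $0$ without linear terms; $\widetilde Q,\widetilde R$ real smooth vanishing at $0$). Positive homogeneous type: $R$ positive homogeneous, some $E\in\mathrm{Exp}(R)$ with $Q$ homogeneous w.r.t. $E$ and $\widetilde Q,\widetilde R$ subhomogeneous w.r.t. $E$; $\mu_{\xi_0}=\mu_R$. Imaginary homogeneous type: $|Q|,R$ positive homogeneous, some $E\in\mathrm{Exp}(|Q|)$, $k>1$ with $R$ homogeneous w.r.t.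 $E/k$, $\widetilde Q$ strongly subhomogeneous w.r.t. $E$ of order 2, $\widetilde R$ strongly subhomogeneous w.r.t. $E/k$ of order 1; $\mu_{\xi_0}=\mu_{|Q|}$. Drift $\alpha_{\xi_0}=\alpha$. *)

(* Defs.v *)
From HB Require Import structures.
From mathcomp Require Import all_boot all_order all_algebra.
From mathcomp Require Import all_classical all_reals all_analysis.
From mathcomp Require Import complex.
Import Order.TTheory GRing.Theory Num.Theory.
Import numFieldNormedType.Exports.

Set Implicit Arguments.
Unset Strict Implicit.
Unset Printing Implicit Defensive.

Local Open Scope ring_scope.
Local Open Scope classical_set_scope.

Section Defs.
Variables (R : realType) (d : nat).

Notation Zd := 'rV[int]_d.
Notation Rd := 'rV[R]_d.

Definition cabs (z : R[i]) : R := ComplexField.Normc.normc z.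

Definition expi (theta : R) : R[i] := (cos theta +i* sin theta)%C.

Definition zR (x : Zd) : Rd := map_mx (fun z : int => z%:~R) x.

Definition dotZR (x : Zd) (xi : Rd) : R := \sum_(i < d) (x 0 i)%:~R * xi 0 i.
Definition dotR (a xi : Rd) : R := \sum_(i < d) a 0 i * xi 0 i.

Definition box_pt (N : nat) (j : 'rV['I_(N.*2.+1)]_d) : Zd :=
  \row_i ((j 0 i : nat)%:Z - N%:Z).
Definition boxsum (N : nat) (f : Zd -> R[i]) : R[i] :=
  \sum_(j : 'rV['I_(N.*2.+1)]_d) f (box_pt j).

(* sum over Z^d (as the limit of sums over the cubes [-N,N]^d; for the
   absolutely summable families occurring below this is the usual sum) *)
Definition zsum (f : Zd -> R[i]) : R[i] :=
  lim ((fun N : nat => (boxsum N f : (R[i])^o)) @ \oo).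

Definition in_Sd (phi : Zd -> R[i]) : Prop :=
  forall beta : 'I_d -> nat,
    (\esum_(x in [set: Zd])
        ((\prod_(i < d) (`|x 0 i|%:~R : R) ^+ beta i) * cabs (phi x))%:E
      < +oo)%E.

Definition fourier (phi : Zd -> R[i]) (xi : Rd) : R[i] :=
  zsum (fun x => phi x * expi (dotZR x xi)).

(* convolution and convolution powers: convpow phi n = phi^{(n)}, n >= 1 *)
Definition conv (f g : Zd -> R[i]) (x : Zd) : R[i] :=
  zsum (fun y => f (x - y) * g y).
Definition convpow (phi : Zd -> R[i]) (n : nat) : Zd -> R[i] :=
  iter n.-1 (fun f => conv f phi) phi.

Definition Omega (phi : Zd -> R[i]) : set Rd :=
  [set xi : Rd | (forall i, - pi < xi 0 i <= pi) /\ cabs (fourier phi xi) = 1].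

Definition mexp (A : 'M[R]_d) : 'M[R]_d :=
  lim (series (fun k : nat => (k`!%:R)^-1 *: A ^+ k) @ \oo).
Definition tpow (t : R) (E : 'M[R]_d) : 'M[R]_d := mexp (ln t *: E).
Definition act (t : R) (E : 'M[R]_d) (xi : Rd) : Rd := xi *m (tpow t E)^T.

Definition homogeneous (P : Rd -> R) (E : 'M[R]_d) : Prop :=
  forall t xi, 0 < t -> P (act t E xi) = t * P xi.

Definition pos_homogeneous (P : Rd -> R) : Prop :=
  [/\ continuous P,
      (forall xi, 0 <= P xi),
      (forall xi, P xi = 0 -> xi = 0),
      (exists E, homogeneous P E)
    & compact [set xi : Rd | P xi = 1]].

Definition contracting (E : 'M[R]_d) : Prop :=
  tpow t E @[t --> 0^'+] --> (0 : 'M[R]_d).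

Definition subhomogeneous (P : Rd -> R) (E : 'M[R]_d) : Prop :=
  contracting E /\
  forall eps, 0 < eps -> forall K : set Rd, compact K ->
    exists2 tau, 0 < tau &
      forall t xi, 0 < t < tau -> K xi -> `|P (act t E xi)| <= eps * t.

(* strongly subhomogeneous with respect to E of order l
   (the C^l regularity near 0 is omitted) *)
Definition strongly_subhomogeneous (P : Rd -> R) (E : 'M[R]_d) (l : nat) : Prop :=
  contracting E /\
  forall eps, 0 < eps -> forall K : set Rd, compact K ->
    exists2 tau, 0 < tau &
      forall (k : nat) t xi, (k <= l)%N -> 0 < t < tau -> K xi ->
        `|t ^+ k * derive1n k (fun s : R => P (act s E xi)) t| <= eps * t.

Definition poly_nolin (P : Rd -> R) : Prop :=
  exists s : seq ({ffun 'I_d -> nat} * R),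
    (forall m, m \in s -> (2 <= \sum_(i < d) m.1 i)%N) /\
    forall xi, P xi = \sum_(m <- s) m.2 * \prod_(i < d) xi 0 i ^+ m.1 i.

(* Gamma_{xi0}(xi) = log(hat phi(xi + xi0)/hat phi(xi0))
                   = i a.xi - i(Q + Qt)(xi) - (Rr + Rt)(xi)  near 0 *)
Definition gamma_decomp (phi : Zd -> R[i]) (xi0 a : Rd)
    (Q Qt Rr Rt : Rd -> R) : Prop :=
  Qt 0 = 0 /\ Rt 0 = 0 /\
  exists2 U : set Rd, nbhs (0 : Rd) U &
    [/\ {in U, continuous Qt}, {in U, continuous Rt}
      & forall xi, U xi ->
          fourier phi (xi + xi0) =
          fourier phi xi0 * ((expR (- (Rr xi + Rt xi)))%:C%C
                             * expi (dotR a xi - (Q xi + Qt xi)))].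

Definition pos_type (phi : Zd -> R[i]) (xi0 : Rd) (m : R) (a : Rd) : Prop :=
  exists (Q Qt Rr Rt : Rd -> R) (E : 'M[R]_d),
    [/\ gamma_decomp phi xi0 a Q Qt Rr Rt, poly_nolin Q, poly_nolin Rr,
        pos_homogeneous Rr &
      [/\ homogeneous Rr E, homogeneous Q E, subhomogeneous Qt E,
           subhomogeneous Rt E & m = \tr E]].

Definition imag_type (phi : Zd -> R[i]) (xi0 : Rd) (m : R) (a : Rd) : Prop :=
  exists (Q Qt Rr Rt : Rd -> R) (E : 'M[R]_d) (k : R),
    [/\ gamma_decomp phi xi0 a Q Qt Rr Rt, poly_nolin Q, poly_nolin Rr,
        pos_homogeneous (fun xi => `|Q xi|) &
      [/\ pos_homogeneous Rr, homogeneous (fun xi => `|Q xi|) E, 1 < k,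
          homogeneous Rr (k^-1 *: E) &
        [/\ strongly_subhomogeneous Qt E 2,
             strongly_subhomogeneous Rt (k^-1 *: E) 1
           & m = \tr E]]].

Definition is_pos_type phi xi0 := exists m a, pos_type phi xi0 m a.
Definition is_imag_type phi xi0 := exists m a, imag_type phi xi0 m a.

Definition Omega_i (phi : Zd -> R[i]) : set Rd :=
  Omega phi `&` [set xi | is_imag_type phi xi].

(* mu_xi and the drift alpha_xi (well defined by the paper's results) *)
Definition mu_xi (phi : Zd -> R[i]) (xi : Rd) : R :=
  if `[< is_imag_type phi xi >]
  then xget 0 [set m | exists a, imag_type phi xi m a]
  else xget 0 [set m | exists a, pos_type phi xi m a].

Definition drift (phi : Zd -> R[i]) (xi : Rd) : Rd :=
  xget 0 [set a | exists m, imag_type phi xi m a].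

End Defs.

(* Main.v *)
(** The convolution power [phi^{(n)}(x)] is the Fourier coefficient of [(hat phi)^n]; it is computed with a
positive functional [mean] (a limit of Riemann sums) and a partition of unity [theta] of the torus, so that the
estimate can be localised near each point of the torus.  Away from [Omega(phi)] the contribution decays
geometrically.  At a point of positive type [|hat phi|^n <= exp(- n R / 2)], whose mean is of order [n^(- tr E)].

At a point of imaginary type the phase of the integrand is [- n (Q + m) - y.xi] with [y = x - n alpha] and [m] a
small error.  Let [V = t d/dt] along the orbits of [t^E] and let [w] be the [V]-derivative of this phase.
Integrating the divergence of [H chi / (1 + i w) V], where [H] is the integrand, shows that the contribution
is at most a constant times the mean of [1 / (1 + n |Q|)], which is of order [n^(- tr E)] because [tr E < 1].  The
drift term [y.xi] is dominated by [1 + n |Q|] once [n] exceeds a threshold depending only on [|y|], which is how the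
sets [K_n] arise.

The means of functions of [s^2 P], with [P] homogeneous of degree 2 under [V], satisfy a linear differential equation
in [s], again by the divergence theorem; this gives their exact order [s^(- tr E)].

For the lower bound, the form [(f, g) -> <(hat phi)^n * f, g>] is diagonal in the characters with entries
[phi^{(n)}(x)].  Testing it on the modulated indicator of [|Q| <= b / n], on which [(hat phi)^n] is
coherent, bounds [sup |phi^{(n)}|] below by the volume of that set. *)

Require Import Defs.
From HB Require Import structures.
From mathcomp Require Import all_boot all_order all_algebra.
From mathcomp Require Import all_classical all_reals all_analysis.
From mathcomp Require Import complex.
From mathcomp Require Import zify ring lra.
Import Order.TTheory GRing.Theory Num.Theory.
Import numFieldNormedType.Exports.
Local Open Scope ring_scope.
Local Open Scope classical_set_scope.

Set Implicit Arguments.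
Unset Strict Implicit.
Unset Printing Implicit Defensive.

(** * Modulus, real and imaginary parts, and the function [expi] *)

Section ComplexPreliminaries.
Variable R : realType.
Implicit Types (z w : R[i]) (a b u t x y : R).

(** The remainders [Qt] and [Rt] are controlled only along the orbits of [act], and only |Q|, not Q,
    is known to be homogeneous. This rules out stationary-phase arguments in fixed directions and
    explains why the linear field V is the only derivation applied to the phase. The object that is
    differentiated is the normalised Fourier transform F, smooth because phi decays rapidly;
    derivatives of the remainders along V are read off from L = V F / F. The homogeneity of |Q| is
    used through Q ^ 2, a polynomial of weight 2 under V.

    The role of tr E < 1 is seen on the dyadic shells n |Q| ~ 2^j: their volume is of order (2^j /
    n)^(tr E) and the integrand 1 / (1 + n |Q|) is about 2^(-j), so the sum over j is dominated by j
    = 0 exactly when tr E < 1. At points of positive type the decay is exponential and no such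
    restriction arises.

    About integration only positivity, linearity and the vanishing of the mean of a compactly
    supported partial derivative are used; this is why differentiability is required with remainders
    uniform in the base point. *)

Lemma cabs0 : cabs (0 : R[i]) = 0. Proof. exact: ComplexField.Normc.normc0. Qed.
Lemma cabs1 : cabs (1 : R[i]) = 1. Proof. exact: ComplexField.Normc.normc1. Qed.
Lemma cabsM z w : cabs (z * w) = cabs z * cabs w.
Proof. exact: ComplexField.Normc.normcM. Qed.
Lemma cabsV z : cabs z^-1 = (cabs z)^-1.
Proof. exact: ComplexField.Normc.normcV. Qed.
Lemma cabsN z : cabs (- z) = cabs z. Proof. exact: normcN. Qed.
Lemma cabsD z w : cabs (z + w) <= cabs z + cabs w. Proof. exact: le_normcD. Qed.
Lemma cabsB z w : cabs (z - w) <= cabs z + cabs w.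
Proof. by rewrite -[cabs w]cabsN cabsD. Qed.
Lemma cabs_ge0 z : 0 <= cabs z. Proof. by case: z => a b; exact: sqrtr_ge0. Qed.
Lemma cabs_eq0 z : cabs z = 0 -> z = 0. Proof. exact: ComplexField.Normc.eq0_normc. Qed.
Lemma cabs_gt0 z : z != 0 -> 0 < cabs z.
Proof. by move=> z0; rewrite lt0r cabs_ge0 andbT; apply: contra z0 => /eqP/cabs_eq0->. Qed.
Lemma cabsX z n : cabs (z ^+ n) = cabs z ^+ n.
Proof. by elim: n => [|n IH]; rewrite ?expr0 ?cabs1// !exprS cabsM IH. Qed.
Lemma cabs_real x : cabs x%:C%C = `|x|.
Proof. by rewrite /cabs /= expr0n addr0 sqrtr_sqr. Qed.
Lemma cabs_sqr z : cabs z ^+ 2 = complex.Re z ^+ 2 + complex.Im z ^+ 2.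
Proof. by case: z => a b; rewrite /= sqr_sqrtr// addr_ge0 ?sqr_ge0. Qed.
Lemma Re_le_cabs z : `|complex.Re z| <= cabs z.
Proof.
rewrite -(@ler_pXn2r _ 2)// ?nnegrE ?cabs_ge0// real_normK ?num_real//.
by rewrite cabs_sqr lerDl sqr_ge0.
Qed.
Lemma Im_le_cabs z : `|complex.Im z| <= cabs z.
Proof.
rewrite -(@ler_pXn2r _ 2)// ?nnegrE ?cabs_ge0// real_normK ?num_real//.
by rewrite cabs_sqr lerDr sqr_ge0.
Qed.
Lemma cabs_le_ReIm z : cabs z <= `|complex.Re z| + `|complex.Im z|.
Proof.
rewrite -(@ler_pXn2r _ 2)// ?nnegrE ?cabs_ge0// ?addr_ge0//.
by rewrite cabs_sqr sqrrD !real_normK ?num_real// lerD2r lerDl mulrn_wge0 ?mulr_ge0.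
Qed.
Lemma cabs_sum (I : Type) (r : seq I) (P : pred I) (f : I -> R[i]) :
  cabs (\sum_(i <- r | P i) f i) <= \sum_(i <- r | P i) cabs (f i).
Proof.
elim/big_rec2: _ => [|i y1 y2 _ IH]; first by rewrite cabs0.
by rewrite (le_trans (cabsD _ _))// lerD2l.
Qed.
Lemma cabs_conj z : cabs z^*%C = cabs z.
Proof. by case: z => a b; rewrite /cabs /= sqrrN. Qed.
Lemma mul_conj z : z * z^*%C = (cabs z ^+ 2)%:C%C.
Proof. by rewrite cabs_sqr; case: z => a b; simpc; congr (_ +i* _)%C; ring. Qed.

Lemma conjcM z w : (z * w)^*%C = z^*%C * w^*%C. Proof. exact: rmorphM. Qed.
Lemma conjcB z w : (z - w)^*%C = z^*%C - w^*%C. Proof. exact: rmorphB. Qed.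
Lemma conjc_sum (I : Type) (r : seq I) (P : pred I) (f : I -> R[i]) :
  (\sum_(i <- r | P i) f i)^*%C = \sum_(i <- r | P i) (f i)^*%C.
Proof. exact: rmorph_sum. Qed.
Lemma ReD z w : complex.Re (z + w) = complex.Re z + complex.Re w.
Proof. by case: z; case: w. Qed.
Lemma ImD z w : complex.Im (z + w) = complex.Im z + complex.Im w.
Proof. by case: z; case: w. Qed.
Lemma ReN z : complex.Re (- z) = - complex.Re z. Proof. by case: z. Qed.
Lemma ImN z : complex.Im (- z) = - complex.Im z. Proof. by case: z. Qed.
Lemma ReM z w : complex.Re (z * w) =
  complex.Re z * complex.Re w - complex.Im z * complex.Im w.
Proof. by case: z; case: w. Qed.
Lemma ImM z w : complex.Im (z * w) =
  complex.Re z * complex.Im w + complex.Im z * complex.Re w.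
Proof. by case: z => a b; case: w => c d /=; ring. Qed.
Lemma Re_realM x z : complex.Re (x%:C%C * z) = x * complex.Re z.
Proof. by rewrite ReM /= mul0r subr0. Qed.
Lemma Im_realM x z : complex.Im (x%:C%C * z) = x * complex.Im z.
Proof. by rewrite ImM /= mul0r addr0. Qed.
Lemma Re_sum (I : Type) (r : seq I) (P : pred I) (f : I -> R[i]) :
  complex.Re (\sum_(i <- r | P i) f i) = \sum_(i <- r | P i) complex.Re (f i).
Proof. by elim/big_rec2: _ => //= i y1 y2 _ <-; rewrite ReD. Qed.
Lemma Im_sum (I : Type) (r : seq I) (P : pred I) (f : I -> R[i]) :
  complex.Im (\sum_(i <- r | P i) f i) = \sum_(i <- r | P i) complex.Im (f i).
Proof. by elim/big_rec2: _ => //= i y1 y2 _ <-; rewrite ImD. Qed.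
Lemma complexRI z w : complex.Re z = complex.Re w -> complex.Im z = complex.Im w -> z = w.
Proof. by case: z => a b; case: w => c d /= -> ->. Qed.

Lemma real_complexD x y : (x + y)%:C%C = x%:C%C + y%:C%C :> R[i].
Proof. exact: rmorphD. Qed.
Lemma real_complexM x y : (x * y)%:C%C = x%:C%C * y%:C%C :> R[i].
Proof. exact: rmorphM. Qed.
Lemma real_complexN x : (- x)%:C%C = - x%:C%C :> R[i].
Proof. exact: rmorphN. Qed.
Lemma real_complex_sum (I : Type) (r : seq I) (P : pred I) (f : I -> R) :
  (\sum_(i <- r | P i) f i)%:C%C = \sum_(i <- r | P i) (f i)%:C%C :> R[i].
Proof. exact: rmorph_sum. Qed.
Lemma cabsi : cabs ('i%C : R[i]) = 1.
Proof. by rewrite /cabs /= expr0n expr1n add0r sqrtr1. Qed.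

Lemma MVT_lipschitz (f df : R -> R) (K : R) x y :
  (forall t, is_derive t 1 f (df t)) ->
  (forall t, Num.min x y <= t <= Num.max x y -> `|df t| <= K) ->
  `|f y - f x| <= K * `|y - x|.
Proof.
move=> fd; wlog xy : x y / x <= y.
  move=> H Hb; have [xy|yx] := leP x y; first exact: H.
  by rewrite distrC (distrC y); apply: H; [exact: ltW|rewrite minC maxC].
rewrite min_l// max_r// => Hb.
have cf : {within `[x, y], continuous f}.
  apply: continuous_subspaceT => t.
  by apply/differentiable_continuous/derivable1_diffP; exact: ex_derive.
have [c cxy ->] := MVT_segment xy (fun t _ => fd t) cf.
by rewrite normrM ler_wpM2r// Hb; move: cxy; rewrite in_itv.
Qed.

Lemma expi0 : expi 0 = 1 :> R[i].
Proof. by rewrite /expi cos0 sin0. Qed.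
Lemma expiD a b : expi (a + b) = expi a * expi b.
Proof. by rewrite /expi cosD sinD; simpc; congr (_ +i* _)%C; ring. Qed.
Lemma cabs_expi a : cabs (expi a) = 1.
Proof. by rewrite /cabs /= cos2Dsin2 sqrtr1. Qed.
Lemma expiN a : expi (- a) = (expi a)^*%C.
Proof. by rewrite /expi cosN sinN. Qed.
Lemma expiNM a : expi (- a) * expi a = 1.
Proof. by rewrite -expiD addNr expi0. Qed.
Lemma expiX a n : expi a ^+ n = expi (n%:R * a).
Proof.
elim: n => [|n IH]; first by rewrite expr0 mul0r expi0.
by rewrite exprS IH -expiD -natr1; congr expi; ring.
Qed.
Lemma expi_sum (I : Type) (r : seq I) (P : pred I) (f : I -> R) :
  expi (\sum_(i <- r | P i) f i) = \prod_(i <- r | P i) expi (f i).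
Proof. by apply: (big_morph (@expi R)); [exact: expiD|exact: expi0]. Qed.

Lemma sin_le x : `|sin x| <= `|x|.
Proof.
have := @MVT_lipschitz sin cos 1 0 x (fun t => is_derive_sin t).
by rewrite sin0 !subr0 mul1r; apply=> t _; rewrite cos_max.
Qed.
Lemma cosB1_le x : `|cos x - 1| <= `|x|.
Proof.
have := @MVT_lipschitz cos (fun t => - sin t) 1 0 x (fun t => is_derive_cos t).
by rewrite cos0 subr0 mul1r; apply=> t _; rewrite normrN sin_max.
Qed.
Lemma between_abs t x : Num.min 0 x <= t <= Num.max 0 x -> `|t| <= `|x|.
Proof.
have [x0|x0] := leP 0 x => /andP[]; first by move=> a b; rewrite !ger0_norm//.
by move=> a b; rewrite !ler0_norm ?lerN2// ltW.
Qed.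
Lemma cosB1_le2 x : `|cos x - 1| <= x ^+ 2.
Proof.
have := @MVT_lipschitz cos (fun t => - sin t) `|x| 0 x (fun t => is_derive_cos t).
rewrite cos0 subr0 -normrM -expr2 ger0_norm ?sqr_ge0//; apply=> t /between_abs tx.
by rewrite normrN (le_trans (sin_le _)).
Qed.
Lemma sinBid_le2 x : `|sin x - x| <= x ^+ 2.
Proof.
have := @MVT_lipschitz (sin \- id) (fun t => cos t - 1) `|x| 0 x.
rewrite /= sin0 !subr0 -normrM -expr2 ger0_norm ?sqr_ge0// => H; apply: H => t.
by move=> /between_abs tx; rewrite (le_trans (cosB1_le _)).
Qed.
Lemma expi_taylor2 x : cabs (expi x - 1 - 'i%C * x%:C%C) <= 2 * x ^+ 2.
Proof.
rewrite (le_trans (cabs_le_ReIm _))//= mulr2n mulrDl mul1r.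
rewrite !(mul0r, mulr0, mul1r, subr0, addr0, add0r, oppr0).
exact: lerD (cosB1_le2 x) (sinBid_le2 x).
Qed.

Lemma cvg_real_complex (u : nat -> R[i]) (z : R[i]) :
  (forall e : R, 0 < e -> \forall n \near \oo, cabs (u n - z) <= e) ->
  ((u : nat -> (R[i])^o) @ \oo --> (z : (R[i])^o)).
Proof.
(* A positive element of [R[i]] has zero imaginary part, so the complex tolerance is a real one. *)
move=> H; apply/cvgrPdist_le => -[e e']; rewrite ltcE /= => /andP[/eqP -> e0].
have := H _ e0; apply: filterS => n Hn.
by rewrite distrC normc_def lecR; case: (u n - z) Hn.
Qed.

End ComplexPreliminaries.

(** * Differentiability with a uniform quadratic remainder *)

Section UniformDifferentiability.
Variables (R : realType) (d : nat).
Notation Rd := 'rV[R]_d.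
Notation C := R[i].
Implicit Types (B : set Rd).

Lemma normr_coord (h : Rd) i : `|h 0 i| <= `|h|.
Proof.
rewrite [X in _ <= X]mx_normrE.
exact: (le_bigmax _ (fun j : 'I_1 * 'I_d => `|h j.1 j.2|) (0, i)).
Qed.
Lemma normr_rV_le (h : Rd) (e : R) : 0 <= e -> (forall i, `|h 0 i| <= e) -> `|h| <= e.
Proof.
move=> e0 H; rewrite [X in X <= _]mx_normE -[e]/((NngNum e0)%:num) num_le.
apply/bigmax_leP; split => [|[i j] _]; first by rewrite -num_le.
by rewrite -num_le /= ord1 H.
Qed.

(** Directional derivative along the real vector [v] of a function whose complex gradient is [g]. *)
Definition dir (v : Rd) (g : 'I_d -> C) : C := \sum_i (v 0 i)%:C%C * g i.

Lemma dir_eq v (g1 g2 : 'I_d -> C) : g1 =1 g2 -> dir v g1 = dir v g2.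
Proof. by move=> H; apply: eq_bigr => i _; rewrite H. Qed.
Lemma dirDr v (g1 g2 : 'I_d -> C) : dir v (fun i => g1 i + g2 i) = dir v g1 + dir v g2.
Proof. by rewrite -big_split; apply: eq_bigr => i _ /=; rewrite mulrDr. Qed.
Lemma dirNr v (g1 : 'I_d -> C) : dir v (fun i => - g1 i) = - dir v g1.
Proof. by rewrite -sumrN; apply: eq_bigr => i _ /=; rewrite mulrN. Qed.
Lemma dirMr v a (g1 : 'I_d -> C) : dir v (fun i => a * g1 i) = a * dir v g1.
Proof. by rewrite mulr_sumr; apply: eq_bigr => i _ /=; ring. Qed.
Lemma dirMl v a (g1 : 'I_d -> C) : dir v (fun i => g1 i * a) = dir v g1 * a.
Proof. by rewrite mulr_suml; apply: eq_bigr => i _ /=; ring. Qed.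
Lemma dirDl v w (g1 : 'I_d -> C) : dir (v + w) g1 = dir v g1 + dir w g1.
Proof.
by rewrite -big_split; apply: eq_bigr => i _ /=; rewrite mxE real_complexD mulrDl.
Qed.
Lemma dirZl (a : R) v (g1 : 'I_d -> C) : dir (a *: v) g1 = a%:C%C * dir v g1.
Proof.
by rewrite mulr_sumr; apply: eq_bigr => i _ /=; rewrite mxE real_complexM mulrA.
Qed.
Lemma dir0l (g1 : 'I_d -> C) : dir 0 g1 = 0.
Proof. by apply: big1 => i _; rewrite mxE mul0r. Qed.
Lemma Re_dir v (g1 : 'I_d -> C) : (complex.Re (dir v g1))%:C%C = dir v (fun i => (complex.Re (g1 i))%:C%C).
Proof.
rewrite Re_sum real_complex_sum; apply: eq_bigr => i _.
by rewrite Re_realM real_complexM.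
Qed.
Lemma Im_dir v (g1 : 'I_d -> C) : (complex.Im (dir v g1))%:C%C = dir v (fun i => (complex.Im (g1 i))%:C%C).
Proof.
rewrite Im_sum real_complex_sum; apply: eq_bigr => i _.
by rewrite Im_realM real_complexM.
Qed.
Lemma cabs_dir v (g1 : 'I_d -> C) (K : R) : (forall i, cabs (g1 i) <= K) ->
  cabs (dir v g1) <= d%:R * K * `|v|.
Proof.
move=> H; rewrite (le_trans (cabs_sum _ _ _))//.
rewrite -mulrA -[d in d%:R]card_ord mulr_natl -sumr_const; apply: ler_sum => i _.
rewrite cabsM cabs_real mulrC ler_pM ?cabs_ge0 ?normr_coord//.
Qed.

Definition D2at B (K e : R) (f : Rd -> C) (f' : Rd -> 'I_d -> C) := forall xi, B xi ->
  [/\ cabs (f xi) <= K, forall i, cabs (f' xi i) <= K &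
   forall h : Rd, `|h| <= e -> cabs (f (xi + h) - f xi - dir h (f' xi)) <= K * `|h| ^+ 2].

(* Differentiability on [B] with a quadratic remainder that is uniform in the base point, so that it is
   inherited by the functional [mean] below. *)
Definition D2 B f f' := exists K e : R, [/\ 0 <= K, 0 < e & D2at B K e f f'].

Lemma D2at_le B K e K1 e1 f f' : K <= K1 -> e1 <= e -> D2at B K e f f' -> D2at B K1 e1 f f'.
Proof.
move=> KK ee H xi Bx; have [h1 h2 h3] := H xi Bx; split.
- exact: le_trans KK.
- by move=> i; exact: le_trans KK.
- by move=> h he; rewrite (le_trans (h3 h (le_trans he ee)))// ler_wpM2r// sqr_ge0.
Qed.

Lemma D2_pair B f f' g g' : D2 B f f' -> D2 B g g' ->
  exists K e : R, [/\ 0 <= K, 0 < e, D2at B K e f f' & D2at B K e g g'].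
Proof.
move=> [K [e [K0 e0 H]]] [K1 [e1 [K10 e10 H1]]].
exists (Num.max K K1), (Num.min e e1); split.
- by rewrite le_max K0.
- by rewrite lt_min e0.
- by apply: D2at_le H; rewrite ?le_max ?ge_min lexx.
- by apply: D2at_le H1; rewrite ?le_max ?ge_min lexx orbT.
Qed.

(** The linear term contributes d K |h| and the remainder at most K e |h|. This Lipschitz bound
    handles the second-order terms in the rules for products, inverses and compositions. *)
Lemma D2at_lip B K e f f' xi h : 0 <= K -> D2at B K e f f' -> B xi -> `|h| <= e ->
  cabs (f (xi + h) - f xi) <= K * (d%:R + e) * `|h|.
Proof.
move=> K0 H Bx he; have [_ h2 h3] := H xi Bx.
rewrite -[f _ - _](subrK (dir h (f' xi))) (le_trans (cabsD _ _))//.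
rewrite mulrDr mulrDl addrC; apply: lerD.
  by rewrite [K * d%:R]mulrC; exact: cabs_dir.
apply: le_trans (h3 _ he) _; rewrite expr2 -!mulrA ler_wpM2l// ler_wpM2r//.
Qed.

Lemma D2_sub B B1 f f' : B1 `<=` B -> D2 B f f' -> D2 B1 f f'.
Proof. by move=> BB [K [e [K0 e0 H]]]; exists K, e; split=> // xi /BB; exact: H. Qed.

Lemma D2_eq B f f' g g' : f =1 g -> (forall xi, B xi -> f' xi =1 g' xi) -> D2 B f f' -> D2 B g g'.
Proof.
move=> E E' [K [e [K0 e0 H]]]; exists K, e; split=> // xi Bx.
have [h1 h2 h3] := H xi Bx; split; rewrite -?E//.
- by move=> i; rewrite -E'.
- by move=> h he; rewrite -!E -(dir_eq _ (E' xi Bx)); exact: h3.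
Qed.

Lemma D2_bounded B f f' : D2 B f f' -> exists K : R, 0 <= K /\ forall xi, B xi -> cabs (f xi) <= K.
Proof. by move=> [K [e [K0 e0 H]]]; exists K; split=> // xi /H[]. Qed.
Lemma D2_bounded' B f f' : D2 B f f' -> exists K : R, 0 <= K /\ forall xi i, B xi -> cabs (f' xi i) <= K.
Proof. by move=> [K [e [K0 e0 H]]]; exists K; split=> // xi i /H[]. Qed.

Lemma D2_const B (c : C) : D2 B (fun=> c) (fun _ _ => 0).
Proof.
exists (cabs c), 1; split; rewrite ?cabs_ge0// => xi Bx; split=> //.
- by move=> i; rewrite cabs0 cabs_ge0.
- move=> h _; rewrite subrr /dir big1 ?subrr ?cabs0 ?mulr_ge0 ?cabs_ge0 ?sqr_ge0//.
  by move=> i _; rewrite mulr0.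
Qed.

Lemma D2_coord B i : (exists M : R, forall xi, B xi -> `|xi| <= M) ->
  D2 B (fun xi => (xi 0 i)%:C%C) (fun _ j => (i == j)%:R).
Proof.
move=> [M HM]; exists (Num.max M 1), 1; split=> // [|xi Bx]; first by rewrite le_max ler01 orbT.
split.
- by rewrite cabs_real (le_trans (normr_coord _ _))// le_max HM.
- by move=> j; case: eqP; rewrite ?cabs1 ?cabs0 le_max ?lexx ?ler01 orbT.
- move=> h _; rewrite /dir (bigD1 i)//= eqxx mulr1 big1 ?addr0; last first.
    by move=> j ji; rewrite eq_sym (negbTE ji) mulr0.
  rewrite mxE real_complexD [X in cabs X](_ : _ = 0) ?cabs0; last by ring.
  by rewrite mulr_ge0 ?sqr_ge0// le_max ler01 orbT.
Qed.

Lemma D2_add B f f' g g' : D2 B f f' -> D2 B g g' ->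
  D2 B (fun xi => f xi + g xi) (fun xi i => f' xi i + g' xi i).
Proof.
move=> Hf Hg; have [K [e [K0 e0 Ff Fg]]] := D2_pair Hf Hg.
exists (K + K), e; split; rewrite ?addr_ge0// => xi Bx.
have [f1 f2 f3] := Ff xi Bx; have [g1 g2 g3] := Fg xi Bx; split.
- by rewrite (le_trans (cabsD _ _))// lerD.
- by move=> i; rewrite (le_trans (cabsD _ _))// lerD.
- move=> h he; rewrite dirDr.
  rewrite (_ : _ - _ - _ = (f (xi + h) - f xi - dir h (f' xi)) + (g (xi + h) - g xi - dir h (g' xi))); last by ring.
  by rewrite (le_trans (cabsD _ _))// mulrDl lerD ?f3 ?g3.
Qed.

Lemma D2_mul B f f' g g' : D2 B f f' -> D2 B g g' ->
  D2 B (fun xi => f xi * g xi) (fun xi i => f' xi i * g xi + f xi * g' xi i).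
Proof.
move=> Hf Hg; have [K [e [K0 e0 Ff Fg]]] := D2_pair Hf Hg.
set L := K * (d%:R + e).
have L0 : 0 <= L by rewrite mulr_ge0 ?addr_ge0// ltW.
exists (K * K + K * K + L * L), e; split=> //.
  by rewrite !addr_ge0 ?(mulr_ge0 L0 L0) ?(mulr_ge0 K0 K0).
move=> xi Bx.
have [f1 f2 f3] := Ff xi Bx; have [g1 g2 g3] := Fg xi Bx.
have KK0 : 0 <= K * K by rewrite mulr_ge0.
have LL0 : 0 <= L * L by rewrite mulr_ge0.
split.
- rewrite cabsM (@le_trans _ _ (K * K))// ?ler_pM ?cabs_ge0//; lra.
- move=> i; rewrite (le_trans (cabsD _ _))// !cabsM.
  apply: (@le_trans _ _ (K * K + K * K)); last by lra.
  by rewrite lerD ?ler_pM ?cabs_ge0.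
- move=> h he; rewrite dirDr dirMr dirMl.
  rewrite (_ : _ - _ - _ = (f (xi + h) - f xi - dir h (f' xi)) * g xi + f xi * (g (xi + h) - g xi - dir h (g' xi)) + (f (xi + h) - f xi) * (g (xi + h) - g xi)); last by ring.
  apply: le_trans (cabsD _ _) _; rewrite [X in _ <= X]mulrDl; apply: lerD.
    apply: le_trans (cabsD _ _) _; rewrite [X in _ <= X]mulrDl; apply: lerD.
      by rewrite cabsM mulrAC ler_pM ?cabs_ge0// f3.
    by rewrite cabsM -mulrA ler_pM ?cabs_ge0// g3.
  by rewrite cabsM expr2 mulrACA ler_pM ?cabs_ge0//; [apply: D2at_lip Ff _ _|apply: D2at_lip Fg _ _].
Qed.

Lemma D2_scale B (c : C) f f' : D2 B f f' -> D2 B (fun xi => c * f xi) (fun xi i => c * f' xi i).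
Proof.
move=> Hf; apply: D2_eq (D2_mul (D2_const B c) Hf) => //= xi _ i.
by rewrite mul0r add0r.
Qed.

Lemma D2_opp B f f' : D2 B f f' -> D2 B (fun xi => - f xi) (fun xi i => - f' xi i).
Proof.
move=> Hf; apply: D2_eq (D2_scale (-1) Hf) => [xi|xi _ i]; by rewrite mulN1r.
Qed.

Lemma D2_sum (I : Type) (r : seq I) B (F : I -> Rd -> C) F' :
  (forall i, D2 B (F i) (F' i)) ->
  D2 B (fun xi => \sum_(i <- r) F i xi) (fun xi j => \sum_(i <- r) F' i xi j).
Proof.
move=> H; elim: r => [|i r IH].
  by apply: D2_eq (D2_const B 0) => [xi|xi _ j]; rewrite big_nil.
by apply: D2_eq (D2_add (H i) IH) => [xi|xi _ j]; rewrite big_cons.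
Qed.

Lemma D2_exp B f f' n : D2 B f f' ->
  D2 B (fun xi => f xi ^+ n) (fun xi i => n%:R * f xi ^+ n.-1 * f' xi i).
Proof.
move=> H; elim: n => [|n IH].
  by apply: D2_eq (D2_const B 1) => [xi|xi _ j]; rewrite ?expr0// !mul0r.
apply: D2_eq (D2_mul H IH) => [xi|xi _ j]; first by rewrite exprS.
case: n {IH} => [|n] /=; first by rewrite expr0; ring.
by rewrite !exprS -[n.+2%:R]natr1 -[n.+1%:R]natr1; ring.
Qed.

Lemma D2_Re B f f' : D2 B f f' ->
  D2 B (fun xi => (complex.Re (f xi))%:C%C) (fun xi i => (complex.Re (f' xi i))%:C%C).
Proof.
move=> [K [e [K0 e0 H]]]; exists K, e; split=> // xi /H[h1 h2 h3]; split.
- by rewrite cabs_real (le_trans (Re_le_cabs _)).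
- by move=> i; rewrite cabs_real (le_trans (Re_le_cabs _)).
- move=> h /h3; apply: le_trans; rewrite -Re_dir -!real_complexN -!real_complexD.
  by rewrite cabs_real -!ReN -!ReD Re_le_cabs.
Qed.

Lemma D2_Im B f f' : D2 B f f' ->
  D2 B (fun xi => (complex.Im (f xi))%:C%C) (fun xi i => (complex.Im (f' xi i))%:C%C).
Proof.
move=> [K [e [K0 e0 H]]]; exists K, e; split=> // xi /H[h1 h2 h3]; split.
- by rewrite cabs_real (le_trans (Im_le_cabs _)).
- by move=> i; rewrite cabs_real (le_trans (Im_le_cabs _)).
- move=> h /h3; apply: le_trans; rewrite -Im_dir -!real_complexN -!real_complexD.
  by rewrite cabs_real -!ImN -!ImD Im_le_cabs.
Qed.

Lemma D2_inv B f f' (c : R) : 0 < c -> (forall xi, B xi -> c <= cabs (f xi)) -> D2 B f f' ->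
  D2 B (fun xi => (f xi)^-1) (fun xi i => - (f' xi i) * (f xi)^-1 ^+ 2).
Proof.
move=> c0 Hc [K [e [K0 e0 H]]].
set L := K * (d%:R + e).
have L0 : 0 <= L by rewrite mulr_ge0 ?addr_ge0// ltW.
have ci0 : 0 <= c^-1 by rewrite invr_ge0 ltW.
pose M := c^-1 + K * c^-1 ^+ 2 + (2 * L ^+ 2 * c^-1 ^+ 3).
(* The second bound on the step keeps |f (xi + h)| at least c / 2. *)
exists M, (Num.min e (c / (2 * (L + 1)))); split.
- have K1 : 0 <= K * c^-1 ^+ 2 by rewrite mulr_ge0 ?exprn_ge0.
  have K2 : 0 <= 2 * L ^+ 2 * c^-1 ^+ 3.
    by apply: mulr_ge0; [apply: mulr_ge0; [|exact: sqr_ge0]|exact: exprn_ge0].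
  rewrite /M; lra.
- by rewrite lt_min e0 divr_gt0// mulr_gt0// ltr_wpDl.
move=> xi Bx; have [h1 h2 h3] := H xi Bx.
have a0 : f xi != 0 by apply: contraTneq (Hc _ Bx) => ->; rewrite cabs0 -ltNge.
have iv : cabs (f xi)^-1 <= c^-1 by rewrite cabsV lef_pV2 ?posrE ?cabs_gt0// Hc.
have iv2 : cabs (f xi)^-1 ^+ 2 <= c^-1 ^+ 2 by rewrite lerXn2r ?nnegrE ?cabs_ge0.
have p1 : 0 <= K * c^-1 ^+ 2 by rewrite mulr_ge0 ?exprn_ge0.
have p2 : 0 <= 2 * L ^+ 2 * c^-1 ^+ 3.
  by apply: mulr_ge0; [apply: mulr_ge0; [|exact: sqr_ge0]|exact: exprn_ge0].
split.
- by apply: le_trans iv _; rewrite /M; lra.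
- move=> i; rewrite cabsM cabsN cabsX; apply: (@le_trans _ _ (K * c^-1 ^+ 2)).
    by rewrite ler_pM ?cabs_ge0// sqr_ge0.
  by rewrite /M; lra.
move=> h; rewrite le_min => /andP[he hc].
have Lh := D2at_lip K0 H Bx he; rewrite -/L in Lh.
have Lc : L * `|h| <= c / 2.
  apply: (@le_trans _ _ ((L + 1) * (c / (2 * (L + 1))))).
    by rewrite ler_pM// lerDl.
  by rewrite le_eqVlt; apply/orP; left; apply/eqP; field; lra.
have bc : c / 2 <= cabs (f (xi + h)).
  have := cabsB (f (xi + h)) (f (xi + h) - f xi); rewrite opprB addrC subrK => H1.
  have := Hc _ Bx; lra.
have b0 : f (xi + h) != 0.
  by apply: contraTneq bc => ->; rewrite cabs0 -ltNge divr_gt0.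
rewrite dirMl dirNr.
(* With x = f xi, y = f (xi + h): 1/y - 1/x + (y - x)/x^2 = (y - x)^2 / (x^2 y), which is quadratic
   in h. *)
rewrite (_ : _ - _ - _ = (f (xi + h) - f xi) ^+ 2 * (f xi)^-1 ^+ 2 * (f (xi + h))^-1 - (f (xi + h) - f xi - dir h (f' xi)) * (f xi)^-1 ^+ 2); last first.
  by field; rewrite a0 b0.
have ivb : cabs (f (xi + h))^-1 <= 2 * c^-1.
  rewrite cabsV -[2]invrK -invfM lef_pV2 ?posrE ?cabs_gt0//; first by rewrite mulrC.
  by rewrite mulr_gt0// invr_gt0.
apply: le_trans (cabsB _ _) _.
apply: (@le_trans _ _ ((L * `|h|) ^+ 2 * c^-1 ^+ 2 * (2 * c^-1) + K * `|h| ^+ 2 * c^-1 ^+ 2)).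
  apply: lerD.
    rewrite cabsM cabsM 2!cabsX.
    apply: ler_pM; rewrite ?cabs_ge0//; first by apply: mulr_ge0; exact: sqr_ge0.
    apply: ler_pM; rewrite ?sqr_ge0//.
    by rewrite lerXn2r ?nnegrE ?cabs_ge0//; exact: mulr_ge0.
  by rewrite cabsM cabsX; apply: ler_pM; rewrite ?cabs_ge0 ?sqr_ge0//; exact: h3.
rewrite /M !mulrDl -addrA addrC -subr_ge0.
rewrite (_ : _ - _ = c^-1 * `|h| ^+ 2); last by ring.
by rewrite mulr_ge0 ?sqr_ge0.
Qed.

(** The Taylor bound on [G] is requested only at the values of [u], so that [G] may be singular
    elsewhere, as a negative power is. *)
Lemma D2_comp B (u : Rd -> R) (u' : Rd -> 'I_d -> R) (G G' : R -> R) (K e : R) :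
  0 <= K -> 0 < e ->
  (forall xi, B xi -> [/\ `|G (u xi)| <= K, `|G' (u xi)| <= K &
      forall v, `|v| <= e -> `|G (u xi + v) - G (u xi) - v * G' (u xi)| <= K * v ^+ 2]) ->
  D2 B (fun xi => (u xi)%:C%C) (fun xi i => (u' xi i)%:C%C) ->
  D2 B (fun xi => (G (u xi))%:C%C) (fun xi i => (G' (u xi) * u' xi i)%:C%C).
Proof.
move=> K0 e0 HG [K1 [e1 [K10 e10 H]]].
set L := K1 * (d%:R + e1).
have L0 : 0 <= L by rewrite mulr_ge0 ?addr_ge0// ltW.
exists (K + K * K1 + K * L ^+ 2), (Num.min e1 (e / (L + 1))); split.
- have q1 : 0 <= K * K1 by rewrite mulr_ge0.
  have q2 : 0 <= K * L ^+ 2 by rewrite mulr_ge0 ?sqr_ge0.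
  lra.
- by rewrite lt_min e10 divr_gt0// ltr_wpDl.
move=> xi Bx; have [h1 h2 h3] := H xi Bx; have [G1 G2 G3] := HG xi Bx.
have q1 : 0 <= K * K1 by rewrite mulr_ge0.
have q2 : 0 <= K * L ^+ 2 by rewrite mulr_ge0 ?sqr_ge0.
split.
- by rewrite cabs_real; lra.
- move=> i; rewrite cabs_real normrM; apply: (@le_trans _ _ (K * K1)); last by lra.
  by apply: ler_pM => //; have := h2 i; rewrite cabs_real.
move=> h; rewrite le_min => /andP[he hc].
have Lh := D2at_lip K10 H Bx he; rewrite -/L -real_complexN -real_complexD cabs_real in Lh.
have ve : `|u (xi + h) - u xi| <= e.
  apply: le_trans Lh _; apply: (@le_trans _ _ ((L + 1) * (e / (L + 1)))).
    by rewrite ler_pM// lerDl.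
  by rewrite le_eqVlt; apply/orP; left; apply/eqP; field; lra.
have := G3 _ ve; rewrite [u xi + _]addrC subrK => G4.
rewrite (@dir_eq h _ (fun i => (G' (u xi))%:C%C * (u' xi i)%:C%C)); last first.
  by move=> i; rewrite real_complexM.
rewrite dirMr.
rewrite (_ : _ - _ - _ = (G (u (xi + h)) - G (u xi) - (u (xi + h) - u xi) * G' (u xi))%:C%C + (G' (u xi))%:C%C * ((u (xi + h))%:C%C - (u xi)%:C%C - dir h (fun i => (u' xi i)%:C%C))); last first.
  by rewrite !(real_complexD, real_complexN, real_complexM); ring.
rewrite (le_trans (cabsD _ _))// cabsM !cabs_real.
apply: (@le_trans _ _ (K * (L * `|h|) ^+ 2 + K * (K1 * `|h| ^+ 2))).
  apply: lerD.
    apply: le_trans G4 _; rewrite ler_wpM2l// -real_normK ?num_real//.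
    by rewrite lerXn2r ?nnegrE//; exact: mulr_ge0.
  by apply: ler_pM; rewrite ?cabs_ge0//; exact: h3.
rewrite -subr_ge0 (_ : _ - _ = K * `|h| ^+ 2); last by ring.
by rewrite mulr_ge0 ?sqr_ge0.
Qed.

Lemma D2_shift B f f' c : D2 B f f' ->
  D2 [set xi | B (xi - c)] (fun xi => f (xi - c)) (fun xi i => f' (xi - c) i).
Proof.
move=> [K [e [K0 e0 H]]]; exists K, e; split=> // xi /H[h1 h2 h3]; split=> // h he.
by rewrite (_ : xi + h - c = xi - c + h); [exact: h3|rewrite addrAC].
Qed.

(** Along t e_i the expansion reduces to t |f'_i| <= K t^2 for all small t. *)
Lemma D2_grad0 B f f' (r : R) xi : 0 < r -> D2 B f f' -> B xi ->
  (forall h, `|h| <= r -> f (xi + h) = 0) -> forall i, f' xi i = 0.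
Proof.
move=> r0 [K [e [K0 e0 H]]] Bx Z i; have [_ _ h3] := H xi Bx.
apply: cabs_eq0; apply/eqP; rewrite eq_le cabs_ge0 andbT; apply/ler_addgt0Pr => eps eps0.
rewrite add0r; pose t := Num.min (Num.min e r) (eps / (K + 1)).
have t0 : 0 < t by rewrite !lt_min e0 r0/= divr_gt0// ltr_wpDl.
have n1 : `|t *: delta_mx 0 i : Rd| <= t.
  apply: normr_rV_le => [|j]; first exact: ltW.
  rewrite !mxE eqxx normrM gtr0_norm//= ler_piMr//; first exact: ltW.
  by case: eqP; rewrite /= ?normr1 ?normr0.
have te : t <= e by rewrite /t !ge_min lexx.
have tr : t <= r by rewrite /t !ge_min lexx orbT.
have tk : t * (K + 1) <= eps.
  by rewrite -ler_pdivlMr ?ltr_wpDl// /t ge_min lexx orbT.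
have Z0 : f xi = 0 by rewrite -[xi]addr0 Z// normr0 ltW.
have := h3 _ (le_trans n1 te); rewrite Z0 (Z _ (le_trans n1 tr)).
rewrite subrr sub0r cabsN dirZl cabsM cabs_real gtr0_norm// => H1.
have E : dir (delta_mx 0 i) (f' xi) = f' xi i.
  rewrite /dir (bigD1 i)//= mxE !eqxx mul1r big1 ?addr0// => j ji.
  by rewrite mxE (negbTE ji) andbF mul0r.
rewrite E in H1.
have : t * cabs (f' xi i) <= t * (K * t).
  apply: le_trans H1 _; rewrite (_ : t * (K * t) = K * t ^+ 2); last by ring.
  by rewrite ler_wpM2l// lerXn2r ?nnegrE// ltW.
by rewrite ler_pM2l// => /le_trans; apply; apply: le_trans tk; nra.
Qed.

(** Outside the ball where [g] is controlled, [f] and its gradient vanish; steps shorter than r - r1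
    starting there never reach the support of [f]. *)
Lemma D2_cut (r r1 : R) f f' g g' : r1 < r -> D2 setT f f' ->
  (forall xi, f xi != 0 -> `|xi| <= r1) -> D2 [set xi | `|xi| <= r] g g' ->
  D2 setT (fun xi => f xi * g xi) (fun xi i => f' xi i * g xi + f xi * g' xi i).
Proof.
move=> rr Df sf Dg.
have [K [e [K0 e0 H]]] := D2_mul (D2_sub (@subsetT _ _) Df) Dg.
exists K, (Num.min e (r - r1)); split=> //; first by rewrite lt_min e0 subr_gt0.
move=> xi _; have [xr|xr] := leP `|xi| r.
  by apply: (D2at_le _ _ H) xr => //; rewrite ge_min lexx.
have Z h : `|h| <= r - r1 -> f (xi + h) = 0.
  move=> hr; apply/eqP; case: (boolP (f (xi + h) == 0)) => // /sf.
  have := ler_normB (xi + h) h; rewrite addrK; lra.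
have Z0 : f xi = 0 by rewrite -[xi]addr0 Z// normr0; lra.
have Z1 : forall i, f' xi i = 0.
  by move=> i; apply: (@D2_grad0 setT f f' (r - r1) xi _ Df _ Z i) => //; rewrite subr_gt0.
split.
- by rewrite Z0 mul0r cabs0.
- by move=> i; rewrite Z0 Z1 !mul0r addr0 cabs0.
- move=> h; rewrite le_min => /andP[_ hr]; rewrite Z// Z0 !mul0r.
  rewrite /dir big1 ?subrr ?cabs0 ?mulr_ge0 ?sqr_ge0// => i _.
  by rewrite Z1 !mul0r addr0 mulr0.
Qed.

End UniformDifferentiability.

(** * A positive translation-invariant functional built from Riemann sums *)

Section MeanFunctional.
Variables (R : realType) (d : nat).
Notation Rd := 'rV[R]_d.
Notation C := R[i].

Lemma ultra_fmap (T U : Type) (u : T -> U) (F : set_system T) :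
  UltraFilter F -> UltraFilter (u @ F).
Proof.
move=> FU; have FP := @ultra_proper _ _ FU; apply: Build_UltraFilter.
move=> G GP FG; rewrite eqEsubset; split => // B GB.
have [//|FB] := in_ultra_setVsetC (u @^-1` B) FU.
have GB' : G (~` B) by apply: FG.
by have /filter_ex[x []] : G (B `&` ~` B) by exact: filterI.
Qed.

Lemma exists_ultra_eventually : exists G : set_system nat, UltraFilter G /\ \oo `<=` G.
Proof. exact: ultraFilterLemma. Qed.
Definition ultra_oo : set_system nat := projT1 (cid exists_ultra_eventually).
Lemma ultra_oo_ultra : UltraFilter ultra_oo.
Proof. by have [] := projT2 (cid exists_ultra_eventually). Qed.
#[local] Instance ultra_oo_proper : ProperFilter ultra_oo := @ultra_proper _ _ ultra_oo_ultra.
Lemma ultra_oo_eventually : \oo `<=` ultra_oo.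
Proof. by have [] := projT2 (cid exists_ultra_eventually). Qed.

Definition grid_pt (n : nat) (j : {ffun 'I_d -> 'I_(8 * n.+1).+1}) : Rd :=
  \row_i (2 * pi * ((j i)%:R / n.+1%:R - 4)).
(** Normalised so that a half-open period cell, which holds (n + 1)^d grid points, has mass one. The
    whole cube then has mass at most 9^d. *)
Definition grid_mean (n : nat) (f : Rd -> R) : R :=
  (n.+1%:R ^+ d)^-1 * \sum_j f (grid_pt (n := n) j).
(* The Riemann sums of a bounded function over the cube [-8 pi, 8 pi]^d converge along an ultrafilter;
   for continuous functions the limit is the normalised Lebesgue integral, but only positivity,
   linearity and invariance under one grid step are ever needed. *)
Definition mean (f : Rd -> R) : R := lim (grid_mean n f @[n --> ultra_oo]).
Definition bndf (f : Rd -> R) := exists K : R, forall xi, `|f xi| <= K.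

Lemma card_grid n : #|{ffun 'I_d -> 'I_(8 * n.+1).+1}| = ((8 * n.+1).+1 ^ d)%N.
Proof. by rewrite card_ffun !card_ord. Qed.

Lemma grid_mean_le n (f g : Rd -> R) : (forall xi, f xi <= g xi) ->
  grid_mean n f <= grid_mean n g.
Proof.
move=> H; rewrite ler_wpM2l// ?invr_ge0 ?exprn_ge0//.
by apply: ler_sum => j _.
Qed.
Lemma grid_mean_cst n (c : R) : 0 <= c -> grid_mean n (fun=> c) <= 9 ^+ d * c.
Proof.
move=> c0; rewrite /grid_mean sumr_const card_grid -[_ *+ (_ ^ _)]mulr_natl mulrA ler_wpM2r//.
rewrite mulrC ler_pdivrMr ?exprn_gt0// -exprMn natrX lerXn2r ?nnegrE ?mulr_ge0//.
by rewrite -natrM ler_nat; clear; lia.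
Qed.
Lemma grid_meanD n f g : grid_mean n (fun xi => f xi + g xi) = grid_mean n f + grid_mean n g.
Proof. by rewrite /grid_mean big_split mulrDr. Qed.
Lemma grid_meanZ n c f : grid_mean n (fun xi => c * f xi) = c * grid_mean n f.
Proof. by rewrite /grid_mean -mulr_sumr mulrCA. Qed.
Lemma grid_mean_bound n f K : (forall xi, `|f xi| <= K) -> `|grid_mean n f| <= 9 ^+ d * K.
Proof.
move=> H; have K0 : 0 <= K by apply: le_trans (H 0).
rewrite ler_norml; apply/andP; split; last first.
  by apply: le_trans (grid_mean_cst n K0); apply: grid_mean_le => xi; have := H xi; rewrite ler_norml => /andP[].
have := @grid_mean_le n (fun=> - K) f; rewrite -[- K]mulN1r => H1.
apply: le_trans (H1 _); last by move=> xi; have := H xi; rewrite ler_norml mulN1r => /andP[].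
by rewrite grid_meanZ mulN1r lerN2 grid_mean_cst.
Qed.

(** The Riemann sums of a bounded function stay in a compact interval, where every ultrafilter
    converges. *)
Lemma mean_cvg f : bndf f -> grid_mean n f @[n --> ultra_oo] --> mean f.
Proof.
move=> [K HK].
have := @segment_compact R (- (9 ^+ d * K)) (9 ^+ d * K); rewrite compact_ultra.
move=> /(_ (grid_mean n f @[n --> ultra_oo])) => H.
have [] := H (ultra_fmap _ ultra_oo_ultra).
  change (ultra_oo [set n | `[- (9 ^+ d * K), 9 ^+ d * K] (grid_mean n f)]).
  apply: filterE => n; rewrite /= in_itv /=.
  by have := grid_mean_bound n HK; rewrite ler_norml.
move=> l [_ /= Hl].
by rewrite /mean (cvg_lim _ Hl).
Qed.

(** The ultrafilter contains the tails of the naturals, so an ordinary limit, where one exists, is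
    the value of [mean]. Exact values are obtained this way. *)
Lemma mean_lim f l : grid_mean n f @[n --> \oo] --> l -> mean f = l.
Proof.
by move=> H; apply: cvg_lim => // A /H HA; exact: ultra_oo_eventually.
Qed.

Lemma bndf_D f g : bndf f -> bndf g -> bndf (fun xi => f xi + g xi).
Proof.
move=> [K H] [L H']; exists (K + L) => xi.
by rewrite (le_trans (ler_normD _ _))// lerD.
Qed.
Lemma bndf_M f g : bndf f -> bndf g -> bndf (fun xi => f xi * g xi).
Proof.
move=> [K H] [L H']; exists (K * L) => xi.
by rewrite normrM ler_pM.
Qed.
Lemma bndf_cst c : bndf (fun=> c). Proof. by exists `|c|. Qed.
Lemma bndf_Z c f : bndf f -> bndf (fun xi => c * f xi).
Proof. by apply: bndf_M; exact: bndf_cst. Qed.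
Lemma bndf_N f : bndf f -> bndf (fun xi => - f xi).
Proof. by move=> [K H]; exists K => xi; rewrite normrN. Qed.
Lemma bndf_le f g : (forall xi, `|f xi| <= g xi) -> bndf g -> bndf f.
Proof.
by move=> H [K HK]; exists K => xi; rewrite (le_trans (H xi))// (le_trans (ler_norm _)).
Qed.

Lemma meanD f g : bndf f -> bndf g -> mean (fun xi => f xi + g xi) = mean f + mean g.
Proof.
move=> bf bg; have E : grid_mean^~ (fun xi => f xi + g xi) = grid_mean^~ f \+ grid_mean^~ g.
  by apply/funext => n; rewrite /= grid_meanD.
by rewrite {1}/mean E; apply: cvg_lim => //; apply: cvgD; exact: mean_cvg.
Qed.
Lemma meanZ c f : bndf f -> mean (fun xi => c * f xi) = c * mean f.
Proof.
move=> bf; have E : grid_mean^~ (fun xi => c * f xi) = (fun n => c * grid_mean n f).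
  by apply/funext => n; rewrite /= grid_meanZ.
by rewrite {1}/mean E; apply: cvg_lim => //; apply: cvgMr; exact: mean_cvg.
Qed.
Lemma mean_le f g : (forall xi, f xi <= g xi) -> bndf f -> bndf g -> mean f <= mean g.
Proof.
move=> H bf bg; apply: ler_cvg_to (mean_cvg bf) (mean_cvg bg) _.
by apply: filterE => n; exact: grid_mean_le.
Qed.
Lemma mean_cst0 : mean (fun=> 0) = 0.
Proof. by rewrite -[X in mean X](_ : (fun=> 0 * 0) = _) ?(meanZ _ (bndf_cst 0)) ?mul0r. Qed.
Lemma mean_ge0 f : (forall xi, 0 <= f xi) -> bndf f -> 0 <= mean f.
Proof. by move=> H bf; rewrite -mean_cst0; apply: mean_le => //; exact: bndf_cst. Qed.
Lemma meanN f : bndf f -> mean (fun xi => - f xi) = - mean f.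
Proof.
move=> bf; rewrite -mulN1r -meanZ//; congr mean; apply/funext => xi.
by rewrite mulN1r.
Qed.
Lemma mean_abs f g : (forall xi, `|f xi| <= g xi) -> bndf g -> `|mean f| <= mean g.
Proof.
move=> H bg; have bf := bndf_le H bg.
rewrite ler_norml -meanN// !mean_le//.
- by move=> xi; have := H xi; rewrite ler_norml => /andP[].
- by move=> xi; have := H xi; rewrite ler_norml => /andP[].
- exact: bndf_N.
Qed.

Definition bndc (f : Rd -> C) := exists K : R, forall xi, cabs (f xi) <= K.
Definition cmean (f : Rd -> C) : C :=
  (mean (fun xi => complex.Re (f xi)) +i* mean (fun xi => complex.Im (f xi)))%C.

Lemma bndc_Re f : bndc f -> bndf (fun xi => complex.Re (f xi)).
Proof. by move=> [K H]; exists K => xi; rewrite (le_trans (Re_le_cabs _)). Qed.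
Lemma bndc_Im f : bndc f -> bndf (fun xi => complex.Im (f xi)).
Proof. by move=> [K H]; exists K => xi; rewrite (le_trans (Im_le_cabs _)). Qed.
Lemma bndc_le f g : (forall xi, cabs (f xi) <= g xi) -> bndf g -> bndc f.
Proof. by move=> H [K HK]; exists K => xi; rewrite (le_trans (H xi))// (le_trans (ler_norm _)). Qed.
Lemma bndc_D f g : bndc f -> bndc g -> bndc (fun xi => f xi + g xi).
Proof.
move=> [K H] [L H']; exists (K + L) => xi.
by rewrite (le_trans (cabsD _ _))// lerD.
Qed.
Lemma bndc_M f g : bndc f -> bndc g -> bndc (fun xi => f xi * g xi).
Proof.
move=> [K H] [L H']; exists (K * L) => xi.
by rewrite cabsM ler_pM ?cabs_ge0.
Qed.
Lemma bndc_cst c : bndc (fun=> c). Proof. by exists (cabs c). Qed.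
Lemma bndc_sum (I : Type) (r : seq I) (F : I -> Rd -> C) : (forall i, bndc (F i)) ->
  bndc (fun xi => \sum_(i <- r) F i xi).
Proof.
move=> H; elim: r => [|i r IH]; first by exists 0 => xi; rewrite big_nil cabs0.
have [K HK] := bndc_D (H i) IH; exists K => xi; rewrite big_cons; exact: HK.
Qed.
Lemma bndc_X f n : bndc f -> bndc (fun xi => f xi ^+ n).
Proof.
move=> [K H]; exists (K ^+ n) => xi; rewrite cabsX lerXn2r ?nnegrE ?cabs_ge0//.
by apply: le_trans (H xi); exact: cabs_ge0.
Qed.
Lemma bndc_conj f : bndc f -> bndc (fun xi => (f xi)^*%C).
Proof. by move=> [K H]; exists K => xi; rewrite cabs_conj. Qed.
Lemma D2_bndc f f' : D2 setT f f' -> bndc f.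
Proof. by move=> /D2_bounded[K [_ H]]; exists K => xi; exact: H. Qed.

Lemma cmeanD f g : bndc f -> bndc g -> cmean (fun xi => f xi + g xi) = cmean f + cmean g.
Proof.
move=> bf bg; rewrite /cmean; apply: complexRI; rewrite ?ReD ?ImD /=.
  rewrite -meanD; [|exact: bndc_Re..].
  by congr mean; apply/funext => xi; rewrite ReD.
rewrite -meanD; [|exact: bndc_Im..].
by congr mean; apply/funext => xi; rewrite ImD.
Qed.
Lemma cmeanZ c f : bndc f -> cmean (fun xi => c * f xi) = c * cmean f.
Proof.
move=> bf; have bR := bndc_Re bf; have bI := bndc_Im bf.
have bM (x : R) g : bndf g -> bndf (fun xi => x * g xi) by exact: bndf_M (bndf_cst x).
rewrite /cmean; apply: complexRI; rewrite ?ReM ?ImM /= -!meanZ//.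
  rewrite -(meanN (bM _ _ bI)) -meanD; [|exact: bM|exact/bndf_N/bM].
  by congr mean; apply/funext => xi; rewrite ReM.
rewrite -meanD; [|exact: bM..].
by congr mean; apply/funext => xi; rewrite ImM.
Qed.
Lemma cmean0 : cmean (fun=> 0) = 0.
Proof. by rewrite /cmean /= !mean_cst0. Qed.
Lemma cmeanN f : bndc f -> cmean (fun xi => - f xi) = - cmean f.
Proof.
move=> bf; rewrite -mulN1r -cmeanZ//; congr cmean; apply/funext => xi.
by rewrite mulN1r.
Qed.
Lemma cmeanB f g : bndc f -> bndc g -> cmean (fun xi => f xi - g xi) = cmean f - cmean g.
Proof.
move=> bf bg; rewrite cmeanD ?cmeanN//.
by have [K H] := bg; exists K => xi; rewrite cabsN.
Qed.
Lemma cmean_sum (I : Type) (r : seq I) (F : I -> Rd -> C) : (forall i, bndc (F i)) ->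
  cmean (fun xi => \sum_(i <- r) F i xi) = \sum_(i <- r) cmean (F i).
Proof.
move=> H; elim: r => [|i r IH].
  by rewrite big_nil -[RHS]cmean0; congr cmean; apply/funext => xi; rewrite big_nil.
rewrite big_cons -IH -cmeanD//; last exact: bndc_sum.
by congr cmean; apply/funext => xi; rewrite big_cons.
Qed.
Lemma cmean_conj f : bndc f -> cmean (fun xi => (f xi)^*%C) = (cmean f)^*%C.
Proof.
move=> bf; rewrite /cmean /=; apply: complexRI => /=.
  by congr mean; apply/funext => xi; case: (f xi).
by rewrite -meanN; [congr mean; apply/funext => xi; case: (f xi)|exact: bndc_Im].
Qed.
(** The factor 2 comes from estimating real and imaginary parts separately; sharp constants are
    irrelevant here. *)
Lemma cmean_le f g : (forall xi, cabs (f xi) <= g xi) -> bndf g -> cabs (cmean f) <= 2 * mean g.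
Proof.
move=> H bg; rewrite (le_trans (cabs_le_ReIm _))//= mulr2n mulrDl !mul1r.
by rewrite lerD// mean_abs// => xi; rewrite (le_trans _ (H xi))// ?Re_le_cabs ?Im_le_cabs.
Qed.
Lemma cmean_real f : cmean (fun xi => (f xi)%:C%C) = (mean f)%:C%C.
Proof. by rewrite /cmean /= mean_cst0. Qed.

Definition grid_shift n (i : 'I_d) (j : {ffun 'I_d -> 'I_(8 * n.+1).+1}) :=
  [ffun k => if k == i then ordS (j k) else j k].
Lemma grid_shift_bij n i : bijective (@grid_shift n i).
Proof.
exists (fun j : {ffun 'I_d -> 'I_(8 * n.+1).+1} => [ffun k => if k == i then ord_pred (j k) else j k]) => j;
  apply/ffunP => k; rewrite !ffunE; case: eqP => // _; [exact: ordSK|exact: ord_predK].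
Qed.

(* One grid step permutes the grid up to wrapping around, and wrapping only occurs outside the support. *)
Lemma grid_sum_shift n i (f : Rd -> C) : (forall xi, f xi != 0 -> `|xi| <= 6 * pi) ->
  \sum_j f (grid_pt (n := n) j + (2 * pi / n.+1%:R) *: delta_mx 0 i) = \sum_j f (grid_pt (n := n) j).
Proof.
move=> sf; have p0 := pi_gt0 R.
have out (xi : Rd) : 6 * pi < `|xi 0 i| -> f xi = 0.
  move=> H; apply/eqP; case: (boolP (f xi == 0)) => // /sf.
  by have := normr_coord xi i; lra.
rewrite [RHS](reindex (@grid_shift n i)) /=; last first.
  by apply: onW_bij; exact: grid_shift_bij.
apply: eq_bigr => j _.
have [jl|jl] := ltnP (j i).+1 (8 * n.+1).+1.
  congr f; apply/rowP => k; rewrite !mxE ffunE; case: (k =P i) => [->|/eqP ki] /=.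
    by rewrite mulr1 modn_small// -[(j i).+1%:R]natr1 mulrDl; ring.
  by rewrite mulr0 addr0.
have ji : j i = (8 * n.+1)%N :> nat by have := ltn_ord (j i); lia.
rewrite !out//.
  rewrite !mxE ffunE eqxx /= ji modnn mul0r sub0r mulrN normrN gtr0_norm; nra.
rewrite !mxE !eqxx ji /= mulr1 natrM mulfK// gtr0_norm.
  have q : (0 : R) < 2 * pi / n.+1%:R by rewrite divr_gt0 ?mulr_gt0.
  rewrite -subr_gt0 (_ : _ - _ = 2 * pi + 2 * pi / n.+1%:R); last by ring.
  by rewrite addr_gt0 ?mulr_gt0.
have q : (0 : R) < 2 * pi / n.+1%:R by rewrite divr_gt0 ?mulr_gt0.
rewrite (_ : _ - _ = 4); last by ring.
by rewrite addr_gt0 ?mulr_gt0.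
Qed.

Lemma Re_grid_mean n (f : Rd -> C) :
  grid_mean n (fun xi => complex.Re (f xi)) = complex.Re ((n.+1%:R ^+ d)^-1%:C%C * \sum_j f (grid_pt (n := n) j)).
Proof. by rewrite Re_realM Re_sum. Qed.
Lemma Im_grid_mean n (f : Rd -> C) :
  grid_mean n (fun xi => complex.Im (f xi)) = complex.Im ((n.+1%:R ^+ d)^-1%:C%C * \sum_j f (grid_pt (n := n) j)).
Proof. by rewrite Im_realM Im_sum. Qed.

Lemma cmean_lim (f : Rd -> C) (l : C) (a : nat -> R) :
  (\forall n \near \oo, cabs ((n.+1%:R ^+ d)^-1%:C%C * (\sum_j f (grid_pt (n := n) j)) - l) <= a n) ->
  a @ \oo --> 0 -> cmean f = l.
Proof.
move=> H a0; apply: complexRI => /=; apply: mean_lim; apply/cvgrPdist_le => e e0;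
  have H1 : \forall n \near \oo, a n <= e by [exact: (cvgr_le _ a0 _ e0)];
  apply: filterS2 H H1 => n H an; apply: le_trans (le_trans H an).
  by rewrite Re_grid_mean distrC -ReN -ReD Re_le_cabs.
by rewrite Im_grid_mean distrC -ImN -ImD Im_le_cabs.
Qed.

(** The first differences of [f] over one grid step h sum to zero, and each equals h times the
    partial derivative up to K h^2. Hence the Riemann sum of the derivative is O(h). *)
Lemma cmean_partial (f : Rd -> C) f' i : D2 setT f f' ->
  (forall xi, f xi != 0 -> `|xi| <= 6 * pi) -> cmean (fun xi => f' xi i) = 0.
Proof.
move=> [K [e [K0 e0 H]]] sf; have p0 := pi_gt0 R.
apply: (@cmean_lim _ _ (fun n => (9 ^+ d * K * (2 * pi)) * n.+1%:R^-1)); last first.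
  rewrite -[0](mulr0 (9 ^+ d * K * (2 * pi))); apply: cvgMr; exact: cvg_harmonic.
have Hn : \forall n \near \oo, (n.+1%:R)^-1 <= e / (2 * pi).
  by apply: (cvgr_le _ (@cvg_harmonic R)); rewrite divr_gt0// mulr_gt0.
apply: filterS Hn => n Hn; pose h : R := 2 * pi / n.+1%:R.
have h0 : 0 < h by rewrite divr_gt0// mulr_gt0.
have he : h <= e by rewrite /h mulrC -ler_pdivlMr ?mulr_gt0.
rewrite subr0.
have nh : `|h *: delta_mx 0 i : Rd| <= h.
  apply: normr_rV_le => [|j]; first exact: ltW.
  rewrite !mxE eqxx normrM gtr0_norm//= ler_piMr//; first exact: ltW.
  by case: eqP; rewrite /= ?normr1 ?normr0.
have Ei xi : dir (delta_mx 0 i) (f' xi) = f' xi i.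
  rewrite /dir (bigD1 i)//= mxE !eqxx mul1r big1 ?addr0// => j ji.
  by rewrite mxE (negbTE ji) andbF mul0r.
have S : \sum_j (f (grid_pt (n := n) j + h *: delta_mx 0 i) - f (grid_pt j) - h%:C%C * f' (grid_pt j) i)
   = - (h%:C%C * \sum_j f' (grid_pt (n := n) j) i).
  by rewrite sumrB sumrB grid_sum_shift// subrr sub0r mulr_sumr.
have B : h * cabs (\sum_j f' (grid_pt (n := n) j) i) <= ((8 * n.+1).+1 ^ d)%:R * (K * h ^+ 2).
  rewrite -{1}(gtr0_norm h0) -cabs_real -cabsM -cabsN -S.
  apply: le_trans (cabs_sum _ _ _) _.
  rewrite -card_grid mulr_natl -sumr_const; apply: ler_sum => j _.
  have [_ _ /(_ _ (le_trans nh he))] := H (grid_pt j) I.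
  rewrite dirZl Ei => H1; apply: le_trans H1 _.
  by rewrite ler_wpM2l// lerXn2r ?nnegrE// ltW.
rewrite cabsM cabs_real ger0_norm ?invr_ge0 ?exprn_ge0//.
have B' : cabs (\sum_j f' (grid_pt (n := n) j) i) <= ((8 * n.+1).+1 ^ d)%:R * K * h.
  rewrite -(ler_pM2l h0); apply: le_trans B _.
  by rewrite le_eqVlt; apply/orP; left; apply/eqP; ring.
apply: le_trans (ler_wpM2l _ B') _; first by rewrite invr_ge0 exprn_ge0.
rewrite (_ : _ / n.+1%:R = 9 ^+ d * (K * h)); last by rewrite /h; ring.
rewrite -(mulrA _ K h) [leLHS]mulrA ler_wpM2r//; first by rewrite mulr_ge0// ltW.
rewrite mulrC ler_pdivrMr ?exprn_gt0// -exprMn natrX lerXn2r ?nnegrE ?mulr_ge0//.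
by rewrite -natrM ler_nat; clear; lia.
Qed.

End MeanFunctional.

(** * Cutoff functions and a periodic partition of unity *)

Section Bumps.
Variables (R : realType) (d : nat).
Notation Rd := 'rV[R]_d.
Notation C := R[i].
Implicit Types (B : set Rd).

Definition isD2 B (f : Rd -> C) := exists f', D2 B f f'.

Lemma isD2_sub B B1 f : B1 `<=` B -> isD2 B f -> isD2 B1 f.
Proof. by move=> BB [f' H]; exists f'; exact: D2_sub H. Qed.
Lemma isD2_cst B c : isD2 B (fun=> c).
Proof. by eexists; exact: D2_const. Qed.
Lemma isD2_add B f g : isD2 B f -> isD2 B g -> isD2 B (fun xi => f xi + g xi).
Proof. by move=> [f' H] [g' H']; eexists; exact: D2_add H H'. Qed.
Lemma isD2_mul B f g : isD2 B f -> isD2 B g -> isD2 B (fun xi => f xi * g xi).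
Proof. by move=> [f' H] [g' H']; eexists; exact: D2_mul H H'. Qed.
Lemma isD2_eq B f g : f =1 g -> isD2 B f -> isD2 B g.
Proof. by move=> E [f' H]; exists f'; apply: D2_eq H. Qed.

Lemma D2_extend (r r1 : R) (f : Rd -> C) (f' : Rd -> 'I_d -> C) : r1 < r ->
  (forall xi, f xi != 0 -> `|xi| <= r1) -> D2 [set xi | `|xi| <= r] f f' ->
  D2 setT f (fun xi i => if `|xi| <= r then f' xi i else 0).
Proof.
move=> rr sf [K [e [K0 e0 H]]].
exists K, (Num.min e (r - r1)); split=> //; first by rewrite lt_min e0 subr_gt0.
move=> xi _; have [xr|xr] := leP `|xi| r.
  by apply: (D2at_le _ _ H) xr => //; rewrite ge_min lexx.
have Z h : `|h| <= r - r1 -> f (xi + h) = 0.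
  move=> hr; apply/eqP; case: (boolP (f (xi + h) == 0)) => // /sf.
  have := ler_normB (xi + h) h; rewrite addrK; lra.
have Z0 : f xi = 0 by rewrite -[xi]addr0 Z// normr0; lra.
split.
- by rewrite Z0 cabs0.
- by move=> i; rewrite cabs0.
- move=> h; rewrite le_min => /andP[_ hr]; rewrite Z// Z0.
  by rewrite /dir big1 ?subrr ?cabs0 ?mulr_ge0 ?sqr_ge0// => i _; rewrite mulr0.
Qed.

Lemma isD2_extend (r r1 : R) (f : Rd -> C) : r1 < r ->
  (forall xi, f xi != 0 -> `|xi| <= r1) -> isD2 [set xi | `|xi| <= r] f -> isD2 setT f.
Proof. move=> rr sf [f' H]; exists (fun xi i => if `|xi| <= r then f' xi i else 0).
exact: (D2_extend rr sf H). Qed.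

Lemma isD2_coord (r : R) i : isD2 [set xi | `|xi| <= r] (fun xi => (xi 0 i)%:C%C).
Proof. by eexists; apply: D2_coord; exists r. Qed.

Lemma isD2_comp B (u : Rd -> R) (G G' : R -> R) (K e : R) :
  0 <= K -> 0 < e ->
  (forall xi, B xi -> [/\ `|G (u xi)| <= K, `|G' (u xi)| <= K &
      forall v, `|v| <= e -> `|G (u xi + v) - G (u xi) - v * G' (u xi)| <= K * v ^+ 2]) ->
  isD2 B (fun xi => (u xi)%:C%C) -> isD2 B (fun xi => (G (u xi))%:C%C).
Proof.
move=> K0 e0 H [u' Hu]; eexists.
apply: (D2_comp (u' := fun xi i => complex.Re (u' xi i)) K0 e0 H).
exact: D2_Re Hu.
Qed.

(** The simplest function that vanishes on a half-line and has a Lipschitz derivative; every cutoff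
    below is composed from it. *)
Definition sqpos (x : R) : R := Num.max 0 x ^+ 2.
Lemma sqpos_taylor x v : `|sqpos (x + v) - sqpos x - v * (2 * Num.max 0 x)| <= v ^+ 2.
Proof.
rewrite /sqpos ler_norml.
by have [x0|x0] := leP 0 x; have [y0|y0] := leP 0 (x + v); apply/andP; split; nra.
Qed.
Lemma sqpos_ge0 x : 0 <= sqpos x. Proof. exact: sqr_ge0. Qed.
Lemma sqpos_eq0 x : x <= 0 -> sqpos x = 0.
Proof. by move=> x0; rewrite /sqpos max_l// expr0n. Qed.
Lemma sqpos_pos x : 0 <= x -> sqpos x = x ^+ 2.
Proof. by move=> x0; rewrite /sqpos max_r. Qed.

Lemma isD2_sqpos B (u : Rd -> R) : isD2 B (fun xi => (u xi)%:C%C) ->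
  isD2 B (fun xi => (sqpos (u xi))%:C%C).
Proof.
move=> Hu; have [u' Hu'] := Hu; have [K [K0 HK]] := D2_bounded Hu'.
apply: (isD2_comp (G' := fun x => 2 * Num.max 0 x) (K := K ^+ 2 + 2 * K + 1) (e := 1)) Hu => //.
  by rewrite !addr_ge0 ?sqr_ge0 ?mulr_ge0.
move=> xi /HK; rewrite cabs_real ler_norml => /andP[h1 h2].
have [m0 mK] : 0 <= Num.max 0 (u xi) /\ Num.max 0 (u xi) <= K.
  by split; rewrite ?le_max ?ge_max ?lexx// K0.
split.
- rewrite ger0_norm ?sqpos_ge0// /sqpos; nra.
- rewrite ger0_norm ?mulr_ge0//; nra.
- move=> v _; apply: le_trans (sqpos_taylor _ _) _.
  by rewrite ler_peMl ?sqr_ge0//; nra.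
Qed.

Lemma isD2r_add B (u v : Rd -> R) : isD2 B (fun xi => (u xi)%:C%C) ->
  isD2 B (fun xi => (v xi)%:C%C) -> isD2 B (fun xi => (u xi + v xi)%:C%C).
Proof. by move=> Hu Hv; apply: isD2_eq (isD2_add Hu Hv) => xi; rewrite real_complexD. Qed.
Lemma isD2r_mul B (u v : Rd -> R) : isD2 B (fun xi => (u xi)%:C%C) ->
  isD2 B (fun xi => (v xi)%:C%C) -> isD2 B (fun xi => (u xi * v xi)%:C%C).
Proof. by move=> Hu Hv; apply: isD2_eq (isD2_mul Hu Hv) => xi; rewrite real_complexM. Qed.
Lemma isD2r_addc B (u : Rd -> R) c : isD2 B (fun xi => (u xi)%:C%C) ->
  isD2 B (fun xi => (u xi + c)%:C%C).
Proof. by move=> Hu; apply: (isD2r_add (v := fun=> c)) => //; exact: isD2_cst. Qed.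
Lemma isD2r_mulc B (u : Rd -> R) c : isD2 B (fun xi => (u xi)%:C%C) ->
  isD2 B (fun xi => (c * u xi)%:C%C).
Proof. by move=> Hu; apply: (isD2r_mul (u := fun=> c)) => //; exact: isD2_cst. Qed.
Lemma isD2r_opp B (u : Rd -> R) : isD2 B (fun xi => (u xi)%:C%C) ->
  isD2 B (fun xi => (- u xi)%:C%C).
Proof.
move=> Hu; apply: isD2_eq (isD2_mul (isD2_cst B (-1)) Hu) => xi.
by rewrite mulN1r real_complexN.
Qed.
Lemma isD2r_sum (I : Type) (r : seq I) B (F : I -> Rd -> R) :
  (forall i, isD2 B (fun xi => (F i xi)%:C%C)) ->
  isD2 B (fun xi => (\sum_(i <- r) F i xi)%:C%C).
Proof.
move=> H; elim: r => [|i r IH].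
  by apply: isD2_eq (isD2_cst B 0) => xi; rewrite big_nil.
by apply: isD2_eq (isD2r_add (H i) IH) => xi; rewrite big_cons.
Qed.
Lemma isD2r_prod (I : Type) (r : seq I) B (F : I -> Rd -> R) :
  (forall i, isD2 B (fun xi => (F i xi)%:C%C)) ->
  isD2 B (fun xi => (\prod_(i <- r) F i xi)%:C%C).
Proof.
move=> H; elim: r => [|i r IH].
  by apply: isD2_eq (isD2_cst B 1) => xi; rewrite big_nil.
by apply: isD2_eq (isD2r_mul (H i) IH) => xi; rewrite big_cons.
Qed.
Lemma isD2r_exp B (u : Rd -> R) n : isD2 B (fun xi => (u xi)%:C%C) ->
  isD2 B (fun xi => (u xi ^+ n)%:C%C).
Proof.
move=> H; elim: n => [|n IH].
  by apply: isD2_eq (isD2_cst B 1) => xi; rewrite expr0.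
by apply: isD2_eq (isD2r_mul H IH) => xi; rewrite exprS.
Qed.

Definition kappa (u : R) : R := sqpos (1 - sqpos (u - 1)).
Lemma isD2_kappa B (u : Rd -> R) : isD2 B (fun xi => (u xi)%:C%C) ->
  isD2 B (fun xi => (kappa (u xi))%:C%C).
Proof.
move=> Hu; apply: isD2_sqpos; apply: (isD2r_add (u := fun=> 1)); first exact: isD2_cst.
by apply: isD2r_opp; apply: isD2_sqpos; exact: isD2r_addc.
Qed.
Lemma kappa1 u : u <= 1 -> kappa u = 1.
Proof.
move=> u1; rewrite /kappa (sqpos_eq0 (x := u - 1)); last by lra.
by rewrite subr0 sqpos_pos// expr1n.
Qed.
Lemma kappa0 u : 2 <= u -> kappa u = 0.
Proof.
move=> u1; rewrite /kappa sqpos_eq0// (sqpos_pos (x := u - 1)); last by lra.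
nra.
Qed.
Lemma kappa_ge0 u : 0 <= kappa u. Proof. exact: sqpos_ge0. Qed.
Lemma kappa_le1 u : kappa u <= 1.
Proof.
rewrite /kappa {1}/sqpos; have := sqpos_ge0 (u - 1) => H.
have H1 : 0 <= Num.max 0 (1 - sqpos (u - 1)) by rewrite le_max lexx.
have H2 : Num.max 0 (1 - sqpos (u - 1)) <= 1 by rewrite ge_max ler01; lra.
nra.
Qed.

(** Piecewise quadratic bump on [-1, 1]: its second derivative is 4, -4, 4 on [-1, -1/2],
    [-1/2, 1/2], [1/2, 1]. These values make the integer translates add up to one. *)
Definition hat (w : R) : R :=
  2 * (sqpos (w + 1) - 2 * sqpos (w + 2^-1) + 2 * sqpos (w - 2^-1) - sqpos (w - 1)).
Lemma hat_out w : 1 <= `|w| -> hat w = 0.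
Proof.
rewrite /hat; have [w0|w0] := leP 0 w => w1.
  by rewrite ger0_norm// in w1; rewrite !sqpos_pos; [field|lra..].
by rewrite ltr0_norm// in w1; rewrite !sqpos_eq0; [ring|lra..].
Qed.
Lemma hat_partition w : 0 <= w <= 1 -> hat w + hat (w - 1) = 1.
Proof.
move=> /andP[w0 w1]; rewrite /hat.
rewrite (sqpos_pos (x := w + 1)); last by lra.
rewrite (sqpos_pos (x := w + 2^-1)); last by lra.
rewrite (sqpos_eq0 (x := w - 1)); last by lra.
rewrite (sqpos_pos (x := w - 1 + 1)); last by lra.
rewrite (sqpos_eq0 (x := w - 1 - 2^-1)); last by lra.
rewrite (sqpos_eq0 (x := w - 1 - 1)); last by lra.
rewrite (_ : w - 1 + 2^-1 = w - 2^-1); last by field.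
by field.
Qed.
Lemma hat_ge0 w : 0 <= hat w.
Proof.
have [H|H] := leP 1 `|w|; first by rewrite hat_out.
move: H; rewrite ltr_norml => /andP[h1 h2]; rewrite /hat.
rewrite (sqpos_pos (x := w + 1)); last by lra.
rewrite (sqpos_eq0 (x := w - 1)); last by lra.
have [a|a] := leP 0 (w + 2^-1); have [b|b] := leP 0 (w - 2^-1).
- rewrite !sqpos_pos//; nra.
- rewrite [sqpos (w + _)]sqpos_pos// sqpos_eq0; [nra|lra].
- lra.
- rewrite !sqpos_eq0; [nra|lra..].
Qed.
Lemma hat_le1 w : hat w <= 1.
Proof.
have [H|H] := leP 1 `|w|; first by rewrite hat_out.
move: H; rewrite ltr_norml => /andP[h1 h2].
have [w0|w0] := leP 0 w.
  have := @hat_partition w; have := hat_ge0 (w - 1) => A /(_ _) B; have := B ltac:(lra); lra.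
have := @hat_partition (w + 1); rewrite addrK; have := hat_ge0 (w + 1) => A B.
have := B ltac:(lra); lra.
Qed.
Lemma hat_ge_half w : `|w| <= 2^-1 -> 2^-1 <= hat w.
Proof.
rewrite ler_norml => /andP[h1 h2]; rewrite /hat.
rewrite (sqpos_pos (x := w + 1)); last by lra.
rewrite (sqpos_eq0 (x := w - 1)); last by lra.
rewrite (sqpos_pos (x := w + 2^-1)); last by lra.
rewrite (sqpos_eq0 (x := w - 2^-1)); last by lra.
nra.
Qed.
Lemma isD2_hat B (u : Rd -> R) : isD2 B (fun xi => (u xi)%:C%C) ->
  isD2 B (fun xi => (hat (u xi))%:C%C).
Proof.
move=> Hu; rewrite /hat.
apply: isD2r_mulc.
have S c : isD2 B (fun xi => (sqpos (u xi + c))%:C%C).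
  exact/isD2_sqpos/isD2r_addc.
apply: isD2r_add; last exact: isD2r_opp.
apply: isD2r_add; last exact: isD2r_mulc.
by apply: isD2r_add => //; apply: isD2r_opp; exact: isD2r_mulc.
Qed.

(** The translates by 2 pi Z^d sum to one, so for periodic f the mean of [theta] f is the average of
    f over the torus, with no sharp cut at the boundary of a cell. *)
Definition theta (xi : Rd) : R := \prod_i hat (xi 0 i / (2 * pi)).
Lemma theta_ge0 xi : 0 <= theta xi.
Proof. by apply: prodr_ge0 => i _; exact: hat_ge0. Qed.
Lemma theta_le1 xi : theta xi <= 1.
Proof.
apply: (@le_trans _ _ (\prod_(i < d) 1)); last by rewrite big1.
by apply: ler_prod => i _; rewrite hat_ge0 hat_le1.
Qed.
Lemma theta_supp xi : theta xi != 0 -> `|xi| <= 2 * pi.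
Proof.
have p0 := pi_gt0 R; move=> t0; apply: normr_rV_le => [|i]; first by lra.
rewrite leNgt; apply: contra t0 => H; rewrite /theta (bigD1 i)//= hat_out ?mul0r//.
by rewrite normrM normfV [`|2 * pi|]gtr0_norm ?mulr_gt0// ler_pdivlMr ?mulr_gt0// mul1r ltW.
Qed.
Lemma isD2_theta : isD2 setT (fun xi => (theta xi)%:C%C).
Proof.
have p0 := pi_gt0 R.
apply: (@isD2_extend (3 * pi) (2 * pi)); first by lra.
  move=> xi H; apply: theta_supp; apply: contra_neq H => -> //.
apply: isD2r_prod => i; apply: isD2_hat.
by apply: (isD2r_mul (v := fun=> (2 * pi)^-1)); [exact: isD2_coord|exact: isD2_cst].
Qed.
Lemma theta_near0 xi : `|xi| <= pi -> 2^-1 ^+ d <= theta xi.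
Proof.
have p0 := pi_gt0 R; move=> H; rewrite -[d in _ ^+ d]card_ord -prodr_const.
apply: ler_prod => i _; rewrite invr_ge0 ler0n hat_ge_half//.
rewrite normrM normfV [`|2 * pi|]gtr0_norm ?mulr_gt0// ler_pdivrMr ?mulr_gt0//.
by rewrite mulKf//; apply: le_trans (normr_coord _ _) H.
Qed.
Lemma bndc_theta : bndc (fun xi : Rd => (theta xi)%:C%C).
Proof. by exists 1 => xi; rewrite cabs_real ger0_norm ?theta_ge0 ?theta_le1. Qed.
Lemma bndf_theta : bndf theta.
Proof. by exists 1 => xi; rewrite ger0_norm ?theta_ge0 ?theta_le1. Qed.

Lemma expi_2pi_int (x : int) : expi (x%:~R * (2 * pi)) = 1 :> C.
Proof.
have e1 : expi (2 * pi : R) = 1.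
  by rewrite /expi mulr_natl cos2pi sin2pi.
have en (n : nat) : expi (n%:R * (2 * pi) : R) = 1 by rewrite -expiX e1 expr1n.
case: x => n; first exact: en.
by rewrite NegzE mulrNz mulNr expiN -pmulrn en conjc1.
Qed.

(** If cos t = 1 then sin (t / 2) = 0 by the half-angle formula, while |t| / 2 lies strictly between
    0 and pi. *)
Lemma expi_neq1 (t : R) : 0 < `|t| < 2 * pi -> expi t != 1 :> C.
Proof.
move=> /andP[t0 t1]; apply/eqP => /(congr1 (@complex.Re R)) /= ct.
have := ct; rewrite {1}(_ : t = t / 2 + t / 2); last by field.
rewrite cosD -!expr2 cos2sin2 => H.
have s0 : sin (t / 2) = 0 by apply/eqP; rewrite -sqrf_eq0; apply/eqP; lra.
have : 0 < sin (`|t| / 2) by apply: sin_gt0_pi; lra.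
have [tp|tn] := leP 0 t; first by rewrite ger0_norm// s0 ltxx.
by rewrite ltr0_norm// mulNr sinN s0 oppr0 ltxx.
Qed.

(** Orthogonality of characters holds exactly on the grid. The phase at index k is z^k with z^N = 1,
    N = n + 1. Folding the support of [hat] onto one period leaves the sum of the powers of z, and z
    differs from 1 for nonzero x because |x| < N. *)
Lemma hat_expi_sum (n : nat) (x : int) : `|x| < n.+1 ->
  \sum_(k < (8 * n.+1).+1) (hat (k%:R / n.+1%:R - 4))%:C%C * expi (x%:~R * (2 * pi * (k%:R / n.+1%:R - 4)))
  = n.+1%:R * (x == 0)%:R :> C.
Proof.
move=> xn; pose N := n.+1; pose z : C := expi (x%:~R * (2 * pi / N%:R)).
have N0 : (0 : R) < N%:R by rewrite ltr0n.
have zN : z ^+ N = 1.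
  rewrite expiX -[RHS](expi_2pi_int x); congr expi.
  by rewrite mulrCA [N%:R * _]mulrC divfK// gt_eqF.
have E (k : nat) : expi (x%:~R * (2 * pi * (k%:R / n.+1%:R - 4))) = z ^+ k.
  rewrite expiX; have -> : x%:~R * (2 * pi * (k%:R / n.+1%:R - 4)) =
    k%:R * (x%:~R * (2 * pi / N%:R)) + (- (4 : int) * x)%:~R * (2 * pi) :> R.
    rewrite rmorphM rmorphN /=; ring.
  by rewrite expiD expi_2pi_int mulr1.
under eq_bigr do rewrite E.
pose F k := (hat (k%:R / N%:R - 4))%:C%C * z ^+ k.
rewrite -(big_mkord xpredT F).
rewrite (@big_cat_nat _ _ _ (3 * N)%N) /=; [|lia..].
rewrite (@big_cat_nat _ _ _ (5 * N)%N (3 * N)%N) /=; [|lia..].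
rewrite (@big_cat_nat _ _ _ (4 * N)%N (3 * N)%N) /=; [|lia..].
rewrite [X in X + _]big_nat big1 ?add0r; last first.
  move=> k /andP[_ k3]; rewrite /F hat_out ?mul0r//.
  have : (k%:R : R) / N%:R <= 3.
    by rewrite ler_pdivrMr// -natrM ler_nat; lia.
  by move=> H; rewrite ler0_norm; lra.
rewrite [X in _ + X]big_nat [X in _ + X]big1 ?addr0; last first.
  move=> k /andP[k5 _]; rewrite /F hat_out ?mul0r//.
  have : 5 <= (k%:R : R) / N%:R.
    by rewrite ler_pdivlMr// -natrM ler_nat; lia.
  by move=> H; rewrite ger0_norm; lra.
rewrite -{1}[(3 * N)%N]add0n big_addn -{1}[in X in _ + X](add0n (4 * N)%N) big_addn.
rewrite (_ : (4 * N - 3 * N = N)%N); last by lia.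
rewrite (_ : (5 * N - 4 * N = N)%N); last by lia.
rewrite -big_split big_nat /=.
(* The indices k + 3N and k + 4N carry the same power of z, and their two weights sum to one. *)
have G k : (0 <= k < N)%N -> F (k + 3 * N)%N + F (k + 4 * N)%N = z ^+ k.
  move=> /andP[_ kN]; rewrite /F !exprD ![(_ * N)%N]mulnC !exprM zN !expr1n !mulr1 -mulrDl.
  have e m : (k + N * m)%:R / N%:R = k%:R / N%:R + m%:R :> R.
    by rewrite natrD natrM mulrDl mulrAC mulfV ?mul1r// gt_eqF.
  rewrite -real_complexD addrC !e.
  rewrite (_ : _ + 4 - 4 = k%:R / N%:R); last by ring.
  rewrite (_ : _ + 3 - 4 = k%:R / N%:R - 1); last by ring.
  by rewrite hat_partition ?mul1r// divr_ge0 ?ler0n//= ler_pdivrMr// mul1r ler_nat ltnW.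
rewrite (eq_bigr _ G) -big_nat big_mkord.
case: eqP => [x0|/eqP x0].
  rewrite (eq_bigr (fun=> 1)); first by rewrite sumr_const card_ord mulr1.
  by move=> i _; rewrite /z x0 mul0r expi0 expr1n.
rewrite mulr0; have := subrX1 z N; rewrite zN subrr => /esym/eqP.
rewrite mulf_eq0 subr_eq0 => /orP[|/eqP//]; rewrite (negbTE (expi_neq1 _))//.
have P0 : (0 : R) < 2 * pi / N%:R by rewrite divr_gt0 ?mulr_gt0 ?pi_gt0.
have X0 : (0 : R) < `|x%:~R| by rewrite normr_gt0 intr_eq0.
rewrite normrM (gtr0_norm P0) mulr_gt0//=.
have pp : (0 : R) < 2 * pi by rewrite mulr_gt0 ?pi_gt0.
rewrite mulrCA gtr_pMr// ltr_pdivrMr// mul1r.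
by rewrite -intr_norm (_ : N%:R = N%:Z%:~R :> R)// ltr_int.
Qed.

(** The sum over the grid factorises over the coordinates, and each factor is known exactly once n +
    1 exceeds all |x_i|; hence the error sequence 0. *)
Lemma cmean_theta_expi (x : 'rV[int]_d) :
  cmean (fun xi => (theta xi)%:C%C * expi (dotZR x xi)) = (x == 0)%:R.
Proof.
apply: (@cmean_lim _ _ _ _ (fun=> 0)); last exact: cvg_cst.
have H : \forall n \near \oo, forall i, `|x 0 i| < n.+1 :> int.
  exists (\sum_(i < d) absz (x ord0 i))%N => // n /= Hn i.
  have H : (absz (x ord0 i) <= \sum_(i < d) absz (x ord0 i))%N by rewrite (bigD1 i)//= leq_addr.
  have := leq_trans H Hn; rewrite -[ord0]/(0 : 'I_1); clear; lia.
apply: filterS H => n Hn; rewrite [X in cabs X](_ : _ = 0) ?cabs0//.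
apply/eqP; rewrite subr_eq0; apply/eqP.
rewrite (eq_bigr (fun j : {ffun 'I_d -> 'I_(8 * n.+1).+1} => \prod_i ((hat ((j i)%:R / n.+1%:R - 4))%:C%C *
   expi ((x 0 i)%:~R * (2 * pi * ((j i)%:R / n.+1%:R - 4)))))); last first.
  move=> j _; rewrite big_split /= -expi_sum; congr (_ * expi _); last first.
    by apply: eq_bigr => i _; rewrite mxE.
  rewrite /theta rmorph_prod /=; apply: eq_bigr => i _; rewrite mxE.
  by rewrite mulrAC mulfV ?mul1r// gt_eqF// mulr_gt0// pi_gt0.
rewrite -(bigA_distr_bigA (fun i (k : 'I_(8 * n.+1).+1) => (hat (k%:R / n.+1%:R - 4))%:C%C *
   expi ((x 0 i)%:~R * (2 * pi * (k%:R / n.+1%:R - 4))))).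
rewrite (eq_bigr _ (fun i _ => hat_expi_sum (Hn i))) big_split /= prodr_const card_ord.
rewrite rmorphV ?unitfE ?expf_neq0 ?pnatr_eq0// rmorphXn rmorph_nat mulKf ?expf_neq0 ?pnatr_eq0//.
case: eqP => [->|x0]; first by rewrite big1// => i _; rewrite mxE.
have [i xi0] : exists i, x 0 i != 0.
  apply: contrapT => Hx; apply: x0; apply/rowP => i; rewrite mxE.
  by apply/eqP; apply: contrapT => Hi; apply: Hx; exists i; exact/negP.
by rewrite (bigD1 i)//= (negbTE xi0) mul0r.
Qed.

End Bumps.

(** * Absolutely summable families on the lattice and smoothness of the Fourier transform *)

Section LatticeSums.
Variables (R : realType) (d : nat).
Notation Zd := 'rV[int]_d.
Notation Rd := 'rV[R]_d.
Notation C := R[i].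
Implicit Types (f g : Zd -> C) (w : Zd -> R) (x y : Zd).

Lemma box_pt_inj N : injective (@box_pt d N).
Proof.
move=> j k /rowP H; apply/rowP => i; apply/val_inj.
have := H i; rewrite !mxE => /addIr [] //.
Qed.
Definition boxset N : seq Zd := [seq box_pt j | j in 'rV['I_(N.*2.+1)]_d].
Lemma boxset_uniq N : uniq (boxset N).
Proof. by rewrite map_inj_uniq ?enum_uniq//; exact: box_pt_inj. Qed.
Lemma mem_boxset N x : (x \in boxset N) = [forall i, `|x ord0 i| <= N%:Z].
Proof.
apply/idP/idP => [/mapP[j _ ->]|/forallP H].
  apply/forallP => i; rewrite mxE; have := ltn_ord (j ord0 i); move: (nat_of_ord _) => k; lia.
have lt i : (absz (x ord0 i + N%:Z)%R < N.*2.+1)%N by have := H i; lia.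
apply/mapP; exists (\row_i Ordinal (lt i)); first by rewrite mem_enum.
apply/rowP => i; rewrite !mxE /=.
have := H i; rewrite -[0]/(ord0 : 'I_1); lia.
Qed.
Lemma boxsumE N f : boxsum N f = \sum_(x <- boxset N) f x.
Proof. by rewrite big_image. Qed.
Lemma boxset_sub N M x : (N <= M)%N -> x \in boxset N -> x \in boxset M.
Proof.
rewrite !mem_boxset => NM /forallP H; apply/forallP => i.
by apply: le_trans (H i) _; rewrite lez_nat.
Qed.
Lemma boxset_split (V : nmodType) N M (F : Zd -> V) : (N <= M)%N ->
  \sum_(x <- boxset M) F x = \sum_(x <- boxset N) F x + \sum_(x <- boxset M | x \notin boxset N) F x.
Proof.
move=> NM; rewrite (bigID (mem (boxset N))) /=; congr (_ + _).
rewrite -big_filter; apply: perm_big; apply: uniq_perm.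
- exact/filter_uniq/boxset_uniq.
- exact: boxset_uniq.
- move=> x; rewrite mem_filter andb_idr//; exact: boxset_sub.
Qed.
Lemma boxset_cover x : exists N0, forall N, (N0 <= N)%N -> x \in boxset N.
Proof.
exists (\sum_i absz (x ord0 i))%N => N HN; rewrite mem_boxset; apply/forallP => i.
have H : (absz (x ord0 i) <= \sum_(i < d) absz (x ord0 i))%N by rewrite (bigD1 i)//= leq_addr.
by have := leq_trans H HN; clear; lia.
Qed.

(** Summability with an explicit bound, phrased on the cubes along which [zsum] takes its limit. *)
Definition sumb w (K : R) := (forall x, 0 <= w x) /\ forall N, \sum_(x <- boxset N) w x <= K.

Lemma sumb_add w v K L : sumb w K -> sumb v L -> sumb (fun x => w x + v x) (K + L).
Proof.
move=> [w0 wK] [v0 vL]; split; first by move=> x; rewrite addr_ge0.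
by move=> N; rewrite big_split lerD.
Qed.
Lemma sumb_sum (I : finType) (w : I -> Zd -> R) : (forall i, exists K, sumb (w i) K) ->
  exists K, sumb (fun x => \sum_i w i x) K.
Proof.
move=> H; elim: (index_enum I) => [|i r [K IH]].
  by exists 0; split => [x|N]; rewrite ?big_nil// big1// => x _; rewrite big_nil.
have [L HL] := H i; exists (L + K).
have [a b] := sumb_add HL IH; split => [x|N]; first by rewrite big_cons.
by under eq_bigr do rewrite big_cons; exact: b.
Qed.

Lemma zsum_lim f (z : C) :
  (forall e : R, 0 < e -> \forall N \near \oo, cabs (boxsum N f - z) <= e) -> zsum f = z.
Proof.
by move=> H; rewrite /zsum (cvg_lim _ (cvg_real_complex H))//; exact: norm_hausdorff.
Qed.

(** The tail [t] depends only on the majorant [w]. This uniformity over all dominated families gives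
    uniform convergence of Fourier series in the frequency variable. *)
Lemma zsum_tail w K : sumb w K -> exists t : nat -> R, t @ \oo --> 0 /\
  forall f, (forall x, cabs (f x) <= w x) -> forall N, cabs (zsum f - boxsum N f) <= t N.
Proof.
move=> [w0 wK]; pose S N := \sum_(x <- boxset N) w x.
have Sinc : {homo S : n m / (n <= m)%N >-> n <= m}.
  by move=> n m nm; rewrite /S (boxset_split _ nm) lerDl sumr_ge0.
have ub : has_ubound (range S) by exists K => _ [N _ <-]; exact: wK.
have Scv := nondecreasing_is_cvgn Sinc ub.
exists (fun N => limn S - S N); split.
  rewrite -[0](subrr (limn S)); apply: cvgB => //; exact: cvg_cst.
move=> f fw.
have part (r : Zd -> R) : (forall x, `|r x| <= w x) -> cvgn (fun N => \sum_(x <- boxset N) r x).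
  (* Adding [w] makes the summands nonnegative, hence the partial sums monotone and bounded. *)
  move=> rw; pose T N := \sum_(x <- boxset N) (r x + w x).
  have Tinc : {homo T : n m / (n <= m)%N >-> n <= m}.
    move=> n m nm; rewrite /T (boxset_split _ nm) lerDl sumr_ge0// => x _.
    by have := rw x; rewrite ler_norml => /andP[]; lra.
  have Tub : has_ubound (range T).
    exists (K + K) => _ [N _ <-]; rewrite /T big_split /= lerD//.
    by apply: le_trans (wK N); apply: ler_sum => x _; rewrite (le_trans (ler_norm _)).
  have Tcv := nondecreasing_is_cvgn Tinc Tub.
  have -> : (fun N => \sum_(x <- boxset N) r x) = T \- S.
    by apply/funext => N; rewrite /T /S /= big_split /= addrK.
  exact: is_cvgB.
have cR := part (fun x => complex.Re (f x)) (fun x => le_trans (Re_le_cabs _) (fw x)).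
have cI := part (fun x => complex.Im (f x)) (fun x => le_trans (Im_le_cabs _) (fw x)).
pose z : C := (limn (fun N => \sum_(x <- boxset N) complex.Re (f x)) +i* limn (fun N => \sum_(x <- boxset N) complex.Im (f x)))%C.
have near_z e : 0 < e -> \forall N \near \oo, cabs (boxsum N f - z) <= e.
  move=> e0; have e2 : 0 < e / 2 by rewrite divr_gt0.
  move: (cR) => /cvgrPdist_le/(_ _ e2) A; move: (cI) => /cvgrPdist_le/(_ _ e2) B.
  apply: filterS2 A B => N A B; apply: le_trans (cabs_le_ReIm _) _.
  rewrite boxsumE ReD ImD ReN ImN Re_sum Im_sum /=; rewrite distrC in A; rewrite distrC in B.
  by apply: le_trans (lerD A B) _; lra.
have Ez : zsum f = z by exact: zsum_lim.
move=> N; rewrite Ez; apply/ler_addgt0Pr => e e0.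
have := near_z e e0; have NM : \forall M \near \oo, (N <= M)%N by exists N.
move=> H; have [M [HM NM']] := filter_ex (filterI H NM).
rewrite -[z - _](subrKA (boxsum M f)) (le_trans (cabsD _ _))// addrC lerD//; last first.
  by rewrite -opprB cabsN.
rewrite !boxsumE (boxset_split _ NM') addrAC subrr add0r.
apply: le_trans (cabs_sum _ _ _) _; apply: le_trans (ler_sum _ (fun x _ => fw x)) _.
have := nondecreasing_cvgn_le Sinc Scv M.
rewrite {1}/S (boxset_split _ NM') -/(S N); lra.
Qed.

Lemma zsum_le w K f : sumb w K -> (forall x, cabs (f x) <= w x) -> cabs (zsum f) <= K.
Proof.
move=> Sw fw; have [t [t0 Ht]] := zsum_tail Sw.
apply/ler_addgt0Pr => e e0.
have [N HN] := filter_ex (cvgr_le _ t0 e e0).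
rewrite -[zsum f](subrK (boxsum N f)) (le_trans (cabsD _ _))// addrC lerD//.
  rewrite boxsumE; apply: le_trans (cabs_sum _ _ _) _.
  by apply: le_trans (ler_sum _ (fun x _ => fw x)) _; case: Sw.
exact: le_trans (Ht _ fw N) HN.
Qed.

Lemma zsum_near w K f : sumb w K -> (forall x, cabs (f x) <= w x) ->
  forall e : R, 0 < e -> \forall N \near \oo, cabs (boxsum N f - zsum f) <= e.
Proof.
move=> Sw fw e e0; have [t [t0 Ht]] := zsum_tail Sw.
apply: filterS (cvgr_le _ t0 e e0) => N; apply: le_trans.
by rewrite -cabsN opprB Ht.
Qed.

Lemma in_Sd_sumb (phi : Zd -> C) : in_Sd phi -> exists K, sumb (fun x => cabs (phi x)) K.
Proof.
move=> /(_ (fun=> 0%N)) H.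
have E : (\esum_(x in [set: Zd]) (cabs (phi x))%:E < +oo)%E.
  apply: le_lt_trans H; apply: le_esum => x _.
  by rewrite lee_fin big1 ?mul1r.
exists (fine (\esum_(x in [set: Zd]) (cabs (phi x))%:E)); split; first by move=> x; exact: cabs_ge0.
move=> N; rewrite -lee_fin fineK; last first.
  by rewrite ge0_fin_numE// esum_ge0// => x _; rewrite lee_fin cabs_ge0.
apply: esum_ge; exists [set` boxset N]; first by split => //; exact: finite_seq.
by rewrite -fsbig_seq ?boxset_uniq// sumEFin.
Qed.

(** These are the coefficients of the partial derivatives of the Fourier transform; staying in the
    same class allows differentiating again. *)
Lemma in_Sd_coord (phi : Zd -> C) j : in_Sd phi -> in_Sd (fun x => 'i%C * ((x 0 j)%:~R : R)%:C%C * phi x).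
Proof.
move=> H beta; apply: le_lt_trans (H (fun i => beta i + (i == j))%N).
apply: le_esum => x _; rewrite lee_fin !cabsM cabsi mul1r cabs_real mulrA.
rewrite ler_wpM2r ?cabs_ge0//.
rewrite [X in _ <= X](eq_bigr (fun i => (`|x 0 i|%:~R : R) ^+ beta i * (`|x 0 i|%:~R : R) ^+ (i == j))); last first.
  by move=> i _; rewrite exprD.
rewrite big_split /= ler_wpM2l//; first by apply: prodr_ge0 => i _; rewrite exprn_ge0// ler0z.
rewrite (bigD1 j)//= eqxx expr1 big1 ?mulr1 ?intr_norm//.
by move=> i /negbTE ->.
Qed.

Definition character x (xi : Rd) : C := expi (dotZR x xi).
Lemma fourierE (phi : Zd -> C) xi : fourier phi xi = zsum (fun x => phi x * character x xi).
Proof. by []. Qed.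
Lemma dotZRD x (xi eta : Rd) : dotZR x (xi + eta) = dotZR x xi + dotZR x eta.
Proof. by rewrite /dotZR -big_split /=; apply: eq_bigr => i _; rewrite mxE mulrDr. Qed.
Lemma dotZRN x (xi : Rd) : dotZR x (- xi) = - dotZR x xi.
Proof. by rewrite /dotZR -sumrN /=; apply: eq_bigr => i _; rewrite mxE mulrN. Qed.
Lemma characterD x (xi eta : Rd) : character x (xi + eta) = character x xi * character x eta.
Proof. by rewrite /character dotZRD expiD. Qed.
Lemma characterDl x y (xi : Rd) : character (x + y) xi = character x xi * character y xi.
Proof.
rewrite /character -expiD; congr expi; rewrite /dotZR -big_split /=.
by apply: eq_bigr => i _; rewrite mxE intrD mulrDl.
Qed.
Lemma characterNl x (xi : Rd) : character (- x) xi = (character x xi)^*%C.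
Proof.
rewrite /character -expiN; congr expi; rewrite /dotZR -sumrN.
by apply: eq_bigr => i _; rewrite mxE mulrNz mulNr.
Qed.
Lemma character0 (xi : Rd) : character 0 xi = 1.
Proof. by rewrite /character /dotZR big1 ?expi0// => i _; rewrite mxE mul0r. Qed.
Lemma cabs_character x xi : cabs (character x xi) = 1.
Proof. exact: cabs_expi. Qed.
Lemma bndc_character x : bndc (character x).
Proof. by exists 1 => xi; rewrite cabs_character. Qed.

Lemma cabs_term (phi : Zd -> C) xi x : cabs (phi x * character x xi) <= cabs (phi x).
Proof. by rewrite cabsM cabs_character mulr1. Qed.

(** Taylor expansion of each character to second order; the remainder is summed with the second
    moments |phi(x)| (sum_j |x_j|)^2. *)
Lemma D2_fourier B (phi : Zd -> C) : in_Sd phi ->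
  D2 B (fourier phi) (fun xi j => fourier (fun x => 'i%C * ((x 0 j)%:~R : R)%:C%C * phi x) xi).
Proof.
move=> Sphi; have [K0 H0] := in_Sd_sumb Sphi.
pose phi1 j x := 'i%C * ((x 0 j)%:~R : R)%:C%C * phi x.
have S1 j : in_Sd (phi1 j) by exact: in_Sd_coord.
have [K1 H1] : exists K, sumb (fun x => \sum_j cabs (phi1 j x)) K.
  by apply: sumb_sum => j; exact: in_Sd_sumb.
have [K2 H2] : exists K, sumb (fun x => \sum_j \sum_k cabs ('i%C * ((x 0 k)%:~R : R)%:C%C * phi1 j x)) K.
  apply: sumb_sum => j; apply: sumb_sum => k; exact/in_Sd_sumb/in_Sd_coord.
have K00 : 0 <= K0 by case: H0 => a /(_ 0%N); apply: le_trans; apply: sumr_ge0.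
have K10 : 0 <= K1 by case: H1 => a /(_ 0%N); apply: le_trans; apply: sumr_ge0.
have K20 : 0 <= K2 by case: H2 => a /(_ 0%N); apply: le_trans; apply: sumr_ge0.
have le1 j x : cabs (phi1 j x) <= \sum_j cabs (phi1 j x).
  by rewrite (bigD1 j)//= lerDl sumr_ge0// => i _; exact: cabs_ge0.
exists (K0 + K1 + 2 * K2), 1; split => //; first by rewrite !addr_ge0 ?mulr_ge0.
move=> xi _; split.
- apply: (@le_trans _ _ K0); last by lra.
  by apply: zsum_le H0 _ => x; exact: cabs_term.
- move=> j; apply: (@le_trans _ _ K1); last by lra.
  by apply: zsum_le H1 _ => x; apply: le_trans (cabs_term _ _ _) (le1 _ _).
move=> h _; pose T x := phi x * character x (xi + h) - phi x * character x xi
   - \sum_j (h 0 j)%:C%C * (phi1 j x * character x xi).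
have near0 e : 0 < e -> \forall N \near \oo, cabs (boxsum N T -
    (fourier phi (xi + h) - fourier phi xi - dir h (fun j => fourier (phi1 j) xi))) <= e.
  (* The tolerance is shared between two Fourier series and d derivative series, the latter weighted
     by at most |h|. *)
  move=> e0; pose e1 := e / (2 + d%:R * `|h|).
  have p0 : 0 < 2 + d%:R * `|h| by rewrite ltr_pwDl// mulr_ge0.
  have e10 : 0 < e1 by rewrite divr_gt0.
  have A := zsum_near H0 (cabs_term phi (xi + h)) e10.
  have B1 := zsum_near H0 (cabs_term phi xi) e10.
  have D : \forall N \near \oo, forall j, cabs (boxsum N (fun x => phi1 j x * character x xi) - fourier (phi1 j) xi) <= e1.
    apply: filter_forall => j; apply: zsum_near H1 _ _ e10 => x.
    exact: le_trans (cabs_term _ _ _) (le1 _ _).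
  apply: filterS3 A B1 D => N A B1 D.
  rewrite /boxsum /T !sumrB exchange_big /=.
  rewrite (eq_bigr (fun j => (h 0 j)%:C%C * boxsum N (fun x => phi1 j x * character x xi))); last first.
    by move=> j _; rewrite /boxsum mulr_sumr.
  rewrite -/(dir h (fun j => boxsum N (fun x => phi1 j x * character x xi))).
  set b := dir h _; set c := dir h _.
  have bc : cabs (b - c) <= d%:R * e1 * `|h|.
    rewrite /b /c -dirNr -dirDr; exact: cabs_dir.
  rewrite -/(boxsum N (fun x => phi x * character x (xi + h))) -/(boxsum N (fun x => phi x * character x xi)).
  rewrite (_ : _ - _ = (boxsum N (fun x => phi x * character x (xi + h)) - fourier phi (xi + h))
     - (boxsum N (fun x => phi x * character x xi) - fourier phi xi) - (b - c)); last by ring.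
  apply: le_trans (cabsB _ _) _; apply: le_trans (lerD (cabsB _ _) bc) _.
  apply: le_trans (lerD (lerD A B1) (lexx _)) _.
  by rewrite le_eqVlt; apply/orP; left; apply/eqP; rewrite /e1; field; lra.
have bT N : cabs (boxsum N T) <= 2 * K2 * `|h| ^+ 2.
  rewrite boxsumE; apply: le_trans (cabs_sum _ _ _) _.
  have TB x : cabs (T x) <= 2 * `|h| ^+ 2 * \sum_j \sum_k cabs ('i%C * ((x 0 k)%:~R : R)%:C%C * phi1 j x).
    pose s := dotZR x h.
    have -> : T x = phi x * character x xi * (expi s - 1 - 'i%C * s%:C%C).
      rewrite /T characterD /phi1 /s [character x h]/character.
      rewrite (_ : \sum_j _ = phi x * character x xi * ('i%C * (dotZR x h)%:C%C)); first by ring.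
      rewrite /dotZR real_complex_sum !mulr_sumr; apply: eq_bigr => j _.
      rewrite real_complexM; ring.
    rewrite cabsM; apply: le_trans (ler_wpM2l (cabs_ge0 _) (expi_taylor2 _)) _.
    rewrite cabsM cabs_character mulr1.
    have sb : `|s| <= `|h| * \sum_j `|(x 0 j)%:~R|.
      apply: le_trans (ler_norm_sum _ _ _) _; rewrite mulr_sumr; apply: ler_sum => j _.
      by rewrite normrM mulrC ler_wpM2r// normr_coord.
    have -> : \sum_j \sum_k cabs ('i%C * ((x 0 k)%:~R : R)%:C%C * phi1 j x) = cabs (phi x) * (\sum_j `|(x 0 j)%:~R|) ^+ 2.
      rewrite expr2 big_distrlr /= mulr_sumr; apply: eq_bigr => j _.
      rewrite mulr_sumr; apply: eq_bigr => k _.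
      rewrite !cabsM !cabsi !cabs_real; ring.
    have s2 : s ^+ 2 <= (`|h| * \sum_j `|(x 0 j)%:~R|) ^+ 2.
      rewrite -[s ^+ 2]real_normK ?num_real// lerXn2r ?nnegrE//.
      by rewrite mulr_ge0// sumr_ge0.
    rewrite (_ : 2 * `|h| ^+ 2 * _ = cabs (phi x) * (2 * (`|h| * \sum_j `|(x 0 j)%:~R|) ^+ 2)); last by ring.
    by rewrite ler_wpM2l ?cabs_ge0// ler_wpM2l.
  apply: le_trans (ler_sum _ (fun x _ => TB x)) _; rewrite -mulr_sumr.
  rewrite [leRHS]mulrAC ler_wpM2l ?mulr_ge0 ?sqr_ge0//; by case: H2.
apply/ler_addgt0Pr => e e0; have [N HN] := filter_ex (near0 e e0).
set A := _ - _ - _ in HN *.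
rewrite -[A](subrKC (boxsum N T)) (le_trans (cabsD _ _))//.
apply: lerD; last by rewrite -cabsN opprB.
apply: le_trans (bT N) _; rewrite ler_wpM2r ?sqr_ge0//; lra.
Qed.

End LatticeSums.

(** * Fourier coefficients, convolution powers and Bessel's inequality *)

Section FourierInversion.
Variables (R : realType) (d : nat).
Notation Zd := 'rV[int]_d.
Notation Rd := 'rV[R]_d.
Notation C := R[i].
Implicit Types (x y : Zd) (f G : Rd -> C).

(** For periodic [f] this is the Fourier coefficient at [x], the weight [theta] replacing
    integration over a period cell. *)
Definition coef (f : Rd -> C) x : C :=
  cmean (fun xi => (theta xi)%:C%C * f xi * (character x xi)^*%C).

Lemma mean_theta : mean (@theta R d) = 1.
Proof.
have /(congr1 (@complex.Re R)) /= := @cmean_theta_expi R d 0; rewrite eqxx /= => <-.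
congr mean; apply/funext => xi; rewrite /dotZR big1.
  by rewrite cos0 sin0 mulr1 mul0r subr0.
by move=> i _; rewrite mxE mul0r.
Qed.

Lemma bndc_coef f x : bndc f -> bndc (fun xi => (theta xi)%:C%C * f xi * (character x xi)^*%C).
Proof.
move=> bf; apply: bndc_M; last exact/bndc_conj/bndc_character.
by apply: bndc_M => //; exact: bndc_theta.
Qed.

Lemma coef_character x y : coef (character y) x = (x == y)%:R.
Proof.
rewrite /coef; have -> : (x == y) = (y - x == 0) by rewrite subr_eq0 eq_sym.
rewrite -cmean_theta_expi; congr cmean; apply/funext => xi.
by rewrite -mulrA -characterNl -characterDl.
Qed.

Lemma coef_le f (e : R) x : (forall xi, cabs (f xi) <= e) -> cabs (coef f x) <= 2 * e.
Proof.
move=> fe; have e0 : 0 <= e by apply: le_trans (fe 0); exact: cabs_ge0.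
have B : bndf (fun xi : Rd => e * theta xi) by apply: bndf_M; [exact: bndf_cst|exact: bndf_theta].
apply: le_trans (cmean_le (g := fun xi => e * theta xi) _ B) _.
  move=> xi; rewrite !cabsM cabs_conj cabs_character mulr1 cabs_real ger0_norm ?theta_ge0//.
  by rewrite mulrC ler_wpM2r// theta_ge0.
by rewrite meanZ ?mean_theta ?mulr1//; exact: bndf_theta.
Qed.

Lemma coefB f G x : bndc f -> bndc G -> coef (fun xi => f xi - G xi) x = coef f x - coef G x.
Proof.
move=> bf bG; rewrite /coef -cmeanB; [|exact: bndc_coef..].
congr cmean; apply/funext => xi; ring.
Qed.

Variables (phi : Zd -> C).
Hypothesis Sphi : in_Sd phi.

Lemma fourier_bndc : bndc (fourier phi).
Proof. by apply: D2_bndc (D2_fourier setT Sphi). Qed.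

Lemma fourier_approx : exists t : nat -> R, t @ \oo --> 0 /\
  forall N xi, cabs (fourier phi xi - boxsum N (fun x => phi x * character x xi)) <= t N.
Proof.
have [K0 H0] := in_Sd_sumb Sphi; have [t [t0 Ht]] := zsum_tail H0.
by exists t; split=> // N xi; apply: Ht => x; exact: cabs_term.
Qed.

(** For a finite trigonometric sum this is linearity. The Fourier series converges uniformly, and
    [coef] is continuous for uniform convergence, which justifies exchanging it with the lattice
    sum. *)
Lemma coef_mul_fourier G x : bndc G ->
  coef (fun xi => G xi * fourier phi xi) x = zsum (fun y => coef G (x - y) * phi y).
Proof.
move=> bG; have [t [t0 Ht]] := fourier_approx; apply/esym/zsum_lim => e e0.
have [K HK] := bG; have K0 : 0 <= K by apply: le_trans (HK 0); exact: cabs_ge0.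
have K1 : 0 < 2 * K + 1 by rewrite ltr_wpDl// mulr_ge0.
apply: filterS (cvgr_le _ t0 (e / (2 * K + 1)) _) => [N HN|]; last by rewrite divr_gt0.
have bS : bndc (fun xi => boxsum N (fun y => phi y * character y xi)).
  apply: bndc_sum => j; apply: bndc_M; [exact: bndc_cst|exact: bndc_character].
rewrite (_ : boxsum N _ = coef (fun xi => G xi * boxsum N (fun y => phi y * character y xi)) x); last first.
  rewrite /boxsum /coef.
  rewrite (eq_bigr (fun j => cmean (fun xi => phi (box_pt j) * ((theta xi)%:C%C * G xi * (character (x - box_pt j) xi)^*%C)))); last first.
    by move=> j _; rewrite cmeanZ 1?mulrC//; exact: bndc_coef.
  rewrite -cmean_sum; last first.
    by move=> j; apply: bndc_M; [exact: bndc_cst|exact: bndc_coef].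
  congr cmean; apply/funext => xi; rewrite !mulr_sumr mulr_suml; apply: eq_bigr => j _.
  rewrite -!characterNl opprB characterDl; ring.
have bF := fourier_bndc.
rewrite -coefB; [|exact: bndc_M..].
apply: (@le_trans _ _ (2 * (K * (e / (2 * K + 1))))).
  apply: coef_le => xi; rewrite -mulrBr cabsM ler_pM ?cabs_ge0//.
  by rewrite -cabsN opprB (le_trans (Ht N xi)).
rewrite (_ : _ * _ = 2 * K * e / (2 * K + 1)); last by ring.
rewrite ler_pdivrMr//; nra.
Qed.

(** Multiplication by the Fourier transform acts on coefficients as convolution with [phi]. The base
    case multiplies the constant 1, whose coefficients form the unit mass at the origin. *)
Lemma convpow_coef n x : convpow phi n.+1 x = coef (fun xi => fourier phi xi ^+ n.+1) x.
Proof.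
elim: n x => [|n IH] x.
  have -> : (fun xi => fourier phi xi ^+ 1) = (fun xi => 1 * fourier phi xi).
    by apply/funext => xi; rewrite expr1 mul1r.
  rewrite coef_mul_fourier; last exact: bndc_cst.
  apply/esym/zsum_lim => e e0; have [N0 HN0] := boxset_cover x.
  exists N0 => // N /= /HN0 xN; rewrite boxsumE (bigD1_seq x) ?boxset_uniq//=.
  have E y : coef (fun=> 1) (x - y) = (x == y)%:R.
    have -> : (fun=> 1) = character (R := R) (0 : Zd) by apply/funext => xi; rewrite character0.
    by rewrite coef_character subr_eq0.
  rewrite E eqxx mul1r big1 ?addr0 ?subrr ?cabs0 ?ltW// => y yx.
  by rewrite E eq_sym (negbTE yx) mul0r.
have -> : (fun xi => fourier phi xi ^+ n.+2) = (fun xi => fourier phi xi ^+ n.+1 * fourier phi xi).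
  by apply/funext => xi; rewrite exprSr.
rewrite coef_mul_fourier; last exact/bndc_X/fourier_bndc.
rewrite /convpow iterS -/(convpow phi n.+1) /conv; congr zsum; apply/funext => y.
by rewrite IH.
Qed.

Definition trig (s : seq (Zd * C)) (xi : Rd) : C := \sum_(p <- s) p.2 * character p.1 xi.

Lemma bndc_trig s : bndc (trig s).
Proof. by apply: bndc_sum => p; apply: bndc_M; [exact: bndc_cst|exact: bndc_character]. Qed.

(** Approximation by finitely many characters turns the quadratic form of the lower bound into a
    finite sum. *)
Lemma trig_approx n (e : R) : 0 < e ->
  exists s, forall xi, cabs (fourier phi xi ^+ n - trig s xi) <= e.
Proof.
have [K HK] := fourier_bndc.
have K0 : 0 <= K by apply: le_trans (HK 0); exact: cabs_ge0.
elim: n e => [|n IH] e e0.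
  exists [:: (0, 1)] => xi; rewrite /trig big_seq1 character0 expr0 mulr1 subrr cabs0 ltW//.
pose e1 := e / (2 * (K + 1)).
have e10 : 0 < e1 by rewrite divr_gt0// mulr_gt0// ltr_wpDl.
have [s Hs] := IH e1 e10.
have [L HL] := bndc_trig s; have L0 : 0 <= L by apply: le_trans (HL 0); exact: cabs_ge0.
have [t [t0 Ht]] := fourier_approx.
have e2 : 0 < e / (2 * (L + 1)) by rewrite divr_gt0// mulr_gt0// ltr_wpDl.
have [N HN] := filter_ex (cvgr_le _ t0 _ e2).
exists [seq (p.1 + x, p.2 * phi x) | p <- s, x <- boxset d N] => xi.
have -> : trig [seq (p.1 + x, p.2 * phi x) | p <- s, x <- boxset d N] xi =
    trig s xi * boxsum N (fun x => phi x * character x xi).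
  rewrite /trig big_allpairs_dep boxsumE mulr_suml; apply: eq_bigr => p _.
  rewrite mulr_sumr; apply: eq_bigr => x _ /=; rewrite characterDl; ring.
rewrite exprSr (_ : _ - _ = (fourier phi xi ^+ n - trig s xi) * fourier phi xi +
   trig s xi * (fourier phi xi - boxsum N (fun x => phi x * character x xi))); last by ring.
apply: le_trans (cabsD _ _) _; rewrite !cabsM.
apply: (@le_trans _ _ (e1 * (K + 1) + (L + 1) * (e / (2 * (L + 1))))).
  apply: lerD; apply: ler_pM; rewrite ?cabs_ge0//.
  - by apply: le_trans (HK xi) _; rewrite lerDl.
  - by apply: le_trans (HL xi) _; rewrite lerDl.
  - exact: le_trans (Ht N xi) HN.
rewrite le_eqVlt; apply/orP; left; apply/eqP; rewrite /e1; field; lra.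
Qed.

(** Products of trigonometric polynomials repeat frequencies; collecting them makes each coefficient
    a value of [coef] and lets Bessel's inequality apply. *)
Lemma trig_uniq (s : seq (Zd * C)) : exists (X : seq Zd) (t : Zd -> C), uniq X /\
  forall xi, trig s xi = \sum_(x <- X) t x * character x xi.
Proof.
exists (undup [seq p.1 | p <- s]), (fun x => \sum_(p <- s | p.1 == x) p.2).
split; first exact: undup_uniq.
move=> xi; rewrite /trig big_seq.
rewrite (eq_bigr (fun p => \sum_(x <- undup [seq p.1 | p <- s] | p.1 == x) p.2 * character x xi)); last first.
  move=> p ps; rewrite big_mkcond (bigD1_seq p.1) ?undup_uniq ?mem_undup ?map_f//=.
  rewrite eqxx big1 ?addr0// => x xp; by rewrite eq_sym (negbTE xp).
rewrite -big_seq (exchange_big_dep xpredT) //=; apply: eq_bigr => x _.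
by rewrite mulr_suml; apply: eq_bigl => p.
Qed.

(** The weighted square norm of f - g is nonnegative, where g is the projection of f on the
    characters of [X]; the products (f, g), (g, f) and (g, g) all equal the left-hand side. *)
Lemma bessel (X : seq Zd) f : uniq X -> bndc f ->
  \sum_(x <- X) cabs (coef f x) ^+ 2 <= mean (fun xi => theta xi * cabs (f xi) ^+ 2).
Proof.
move=> uX bf; pose c := coef f; pose g xi := \sum_(x <- X) c x * character x xi.
have bg : bndc g by apply: bndc_sum => x; apply: bndc_M; [exact: bndc_cst|exact: bndc_character].
have bfg : bndc (fun xi => f xi - g xi).
  by apply: bndc_D => //; have [K H] := bg; exists K => xi; rewrite cabsN.
have bth := @bndc_theta R d.
have bc := bndc_conj.
pose ip (u v : Rd -> C) := cmean (fun xi => (theta xi)%:C%C * u xi * (v xi)^*%C).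
have bip (u v : Rd -> C) : bndc u -> bndc v -> bndc (fun xi => (theta xi)%:C%C * u xi * (v xi)^*%C).
  by move=> bu bv; apply: bndc_M; [exact: bndc_M|exact: bc].
pose S := \sum_(x <- X) cabs (c x) ^+ 2.
have ipug u : bndc u -> ip u g = \sum_(x <- X) (c x)^*%C * coef u x.
  move=> bu; rewrite /ip; rewrite (eq_bigr (fun x => cmean (fun xi => (c x)^*%C * ((theta xi)%:C%C * u xi * (character x xi)^*%C)))); last first.
    by move=> x _; rewrite cmeanZ//; exact: bndc_coef.
  rewrite -cmean_sum; last by move=> x; apply: bndc_M; [exact: bndc_cst|exact: bndc_coef].
  congr cmean; apply/funext => xi; rewrite /g conjc_sum mulr_sumr; apply: eq_bigr => x _.
  rewrite conjcM; ring.
have fg : ip f g = S%:C%C.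
  rewrite ipug// /S real_complex_sum; apply: eq_bigr => x _.
  by rewrite mulrC mul_conj.
have cg x : x \in X -> coef g x = c x.
  move=> xX; rewrite /coef /g.
  rewrite (_ : (fun xi => _) = (fun xi => \sum_(y <- X) c y * ((theta xi)%:C%C * character y xi * (character x xi)^*%C))); last first.
    by apply/funext => xi; rewrite mulr_sumr mulr_suml; apply: eq_bigr => y _; ring.
  rewrite cmean_sum; last first.
    by move=> y; apply: bndc_M; [exact: bndc_cst|exact/bndc_coef/bndc_character].
  rewrite (bigD1_seq x)//= cmeanZ; last exact/bndc_coef/bndc_character.
  rewrite -/(coef (character x) x) coef_character eqxx mulr1 big1 ?addr0// => y yx.
  rewrite cmeanZ; last exact/bndc_coef/bndc_character.
  by rewrite -/(coef (character y) x) coef_character eq_sym (negbTE yx) mulr0.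
have gg : ip g g = S%:C%C.
  rewrite ipug// /S real_complex_sum big_seq [RHS]big_seq; apply: eq_bigr => x xX.
  by rewrite cg// mulrC mul_conj.
have gf : ip g f = S%:C%C.
  rewrite -[RHS]conjc_real -fg /ip -cmean_conj; last exact: bip.
  congr cmean; apply/funext => xi; rewrite !conjcM conjc_real conjcK; ring.
have P u : bndc u -> ip u u = (mean (fun xi => theta xi * cabs (u xi) ^+ 2))%:C%C.
  move=> bu; rewrite /ip -cmean_real; congr cmean; apply/funext => xi.
  by rewrite -mulrA mul_conj real_complexM.
have E : ip (fun xi => f xi - g xi) (fun xi => f xi - g xi) = ip f f - ip f g - (ip g f - ip g g).
  rewrite /ip -!cmeanB; do ?[exact: bip].
    by congr cmean; apply/funext => xi; rewrite conjcB; ring.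
  - by apply: bndc_D; [exact: bip|have [K H] := bip f g bf bg; exists K => xi; rewrite cabsN].
  - by apply: bndc_D; [exact: bip|have [K H] := bip g g bg bg; exists K => xi; rewrite cabsN].
rewrite fg gf gg subrr subr0 !P// in E.
have B0 (u : Rd -> C) : bndc u -> bndf (fun xi => theta xi * cabs (u xi) ^+ 2).
  move=> [K HK]; exists (1 * K ^+ 2) => xi; rewrite normrM ler_pM//.
    by rewrite ger0_norm ?theta_ge0 ?theta_le1.
  by rewrite ger0_norm ?sqr_ge0// lerXn2r ?nnegrE ?cabs_ge0//; apply: le_trans (HK 0); exact: cabs_ge0.
have : 0 <= mean (fun xi => theta xi * cabs (f xi - g xi) ^+ 2).
  by apply: mean_ge0; [move=> xi; rewrite mulr_ge0 ?theta_ge0 ?sqr_ge0|exact: (B0 (fun xi => f xi - g xi))].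
by move/(congr1 (@complex.Re R)): E => /= ->; rewrite subr_ge0.
Qed.

(* Testing the multiplier against [1_S e^(-i a.xi)] gives a quadratic form whose coefficients are the values of the
   convolution power; Bessel's inequality bounds it by the supremum of these values. *)
Lemma convpow_sup_ge (n : nat) (M : R) (xi0 a : Rd) (u : C) (S : pred Rd) :
  (forall x, cabs (convpow phi n.+1 x) <= M) -> cabs u = 1 ->
  (forall xi eta, S xi -> S eta ->
     2^-1 <= complex.Re (u * fourier phi (xi0 + (xi - eta)) ^+ n.+1 * expi (- dotR a (xi - eta)))) ->
  0 < mean (fun xi => theta xi * (S xi)%:R) ->
  2^-1 * mean (fun xi => theta xi * (S xi)%:R) <= M.
Proof.
move=> HM u1 HS v0; set v := mean _ in v0 *.
have M0 : 0 <= M by apply: le_trans (HM 0); exact: cabs_ge0.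
(* The argument ends with v / 2 <= M + e (v + 2), which fixes the choice of [e]. *)
apply/ler_addgt0Pr => e' e'0; pose e := e' / (v + 2).
have v2 : 0 < v + 2 by rewrite addr_gt0.
have e0 : 0 < e by rewrite divr_gt0.
suff key : (2^-1 - e) * v ^+ 2 <= (M + 2 * e) * v.
  have : (2^-1 - e) * v <= M + 2 * e by rewrite -(ler_pM2r v0) -mulrA -expr2.
  have : e * (v + 2) = e' by rewrite /e divfK// gt_eqF.
  by rewrite mulrDr; lra.
have [s Hs] := trig_approx n.+1 e0; have [X [t [uX Et]]] := trig_uniq s.
pose f (xi : Rd) : C := (S xi)%:R * expi (- dotR a xi).
have cf xi : cabs (f xi) = (S xi)%:R.
  by rewrite /f cabsM cabs_expi mulr1; case: (S xi); rewrite ?cabs1 ?cabs0.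
have bf : bndc f by exists 1 => xi; rewrite cf; case: (S xi).
have bfc := bndc_conj bf.
have bth := @bndc_theta R d.
have bS : bndf (fun xi => theta xi * (S xi)%:R).
  by apply: bndf_M; [exact: bndf_theta|exists 1 => xi; case: (S xi); rewrite ?normr1 ?normr0].
pose c x := coef (fun xi => (f xi)^*%C) x.
have Ec x : (c x)^*%C = cmean (fun xi => (theta xi)%:C%C * f xi * character x xi).
  rewrite /c /coef -cmean_conj; last exact: bndc_coef.
  by congr cmean; apply/funext => xi; rewrite !conjcM conjc_real !conjcK.
have Bc : \sum_(x <- X) cabs (c x) ^+ 2 <= v.
  apply: le_trans (bessel uX bfc) _; rewrite le_eqVlt; apply/orP; left; apply/eqP.
  by congr mean; apply/funext => xi; rewrite cabs_conj cf; case: (S xi); rewrite ?expr1n ?expr0n.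
have bT : bndc (fun xi => \sum_(x <- X) t x * character x xi).
  by apply: bndc_sum => x; apply: bndc_M; [exact: bndc_cst|exact: bndc_character].
(* The coefficient of the trigonometric approximant differs from that of the power of the Fourier
   transform, a value of [convpow], by at most 2 e. *)
have tM x : x \in X -> cabs (t x) <= M + 2 * e.
  move=> xX; have -> : t x = coef (fun xi => \sum_(x <- X) t x * character x xi) x.
    rewrite /coef (_ : (fun xi => _) = (fun xi => \sum_(y <- X) t y * ((theta xi)%:C%C * character y xi * (character x xi)^*%C))); last first.
      by apply/funext => xi; rewrite mulr_sumr mulr_suml; apply: eq_bigr => y _; ring.
    rewrite cmean_sum; last first.
      by move=> y; apply: bndc_M; [exact: bndc_cst|exact/bndc_coef/bndc_character].
    rewrite (bigD1_seq x)//= cmeanZ; last exact/bndc_coef/bndc_character.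
    rewrite -/(coef (character x) x) coef_character eqxx mulr1 big1 ?addr0// => y yx.
    rewrite cmeanZ; last exact/bndc_coef/bndc_character.
    by rewrite -/(coef (character y) x) coef_character eq_sym (negbTE yx) mulr0.
  have bF : bndc (fun xi => fourier phi xi ^+ n.+1) by exact/bndc_X/fourier_bndc.
  rewrite -[X in cabs X](subrK (coef (fun xi => fourier phi xi ^+ n.+1) x)) -coefB//.
  apply: le_trans (cabsD _ _) _; rewrite addrC lerD//; first by rewrite -convpow_coef.
  apply: coef_le => xi; rewrite -cabsN opprB -Et; exact: Hs.
pose T xi := \sum_(x <- X) t x * character x xi.
(* The quadratic form in diagonal form. It equals the double mean of u T(xi0 + xi - eta) f(xi)
   conj(f(eta)) against [theta] in both variables, which is bounded below through the coherence
   hypothesis. *)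
pose A := \sum_(x <- X) u * t x * character x xi0 * ((c x)^*%C * c x).
have A1 : cabs A <= (M + 2 * e) * v.
  apply: le_trans (cabs_sum _ _ _) _; apply: (@le_trans _ _ (\sum_(x <- X) (M + 2 * e) * cabs (c x) ^+ 2)).
    rewrite big_seq [leRHS]big_seq; apply: ler_sum => x xX.
    rewrite !cabsM cabs_conj u1 mul1r cabs_character mulr1 -expr2 ler_wpM2r ?sqr_ge0//.
    exact: tM.
  by rewrite -mulr_sumr ler_wpM2l// addr_ge0// mulr_ge0// ltW.
apply: le_trans A1; apply: le_trans (le_trans (ler_norm _) (Re_le_cabs A)).
pose h xi : C := cmean (fun eta => (theta eta)%:C%C * (u * T (xi0 + (xi - eta)) * (f xi * (f eta)^*%C))).
have bh xi : bndc (fun eta => (theta eta)%:C%C * (u * T (xi0 + (xi - eta)) * (f xi * (f eta)^*%C))).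
  apply: bndc_M => //; apply: bndc_M; last by apply: bndc_M => //; exact: bndc_cst.
  apply: bndc_M; first exact: bndc_cst.
  by have [K HK] := bT; exists K => eta; exact: HK.
have Eh xi : h xi = \sum_(x <- X) (u * t x * character x xi0 * c x) * (f xi * character x xi).
  rewrite /h (_ : (fun eta => _) = (fun eta => \sum_(x <- X) (u * t x * character x xi0 * (f xi * character x xi)) * ((theta eta)%:C%C * (f eta)^*%C * (character x eta)^*%C))); last first.
    apply/funext => eta; rewrite /T !mulr_sumr !mulr_suml mulr_sumr; apply: eq_bigr => x _.
    rewrite !characterD -(characterNl x eta) (_ : character x (- eta) = character (- x) eta); first by ring.
    by rewrite characterNl /character dotZRN expiN.
  rewrite cmean_sum; last by move=> x; apply: bndc_M; [exact: bndc_cst|exact: bndc_coef].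
  apply: eq_bigr => x _; rewrite cmeanZ; last exact: bndc_coef.
  rewrite -/(coef (fun xi => (f xi)^*%C) x) -/(c x); ring.
have bh' : bndc h.
  rewrite (_ : h = fun xi => \sum_(x <- X) (u * t x * character x xi0 * c x) * (f xi * character x xi)); last exact/funext.
  by apply: bndc_sum => x; apply: bndc_M; [exact: bndc_cst|apply: bndc_M => //; exact: bndc_character].
have EA : A = cmean (fun xi => (theta xi)%:C%C * h xi).
  rewrite (_ : (fun xi => _ * h xi) = (fun xi => \sum_(x <- X) (u * t x * character x xi0 * c x) * ((theta xi)%:C%C * f xi * character x xi))); last first.
    by apply/funext => xi; rewrite Eh mulr_sumr; apply: eq_bigr => x _; ring.
  have bx x : bndc (fun xi => (theta xi)%:C%C * f xi * character x xi).
    by apply: bndc_M; [exact: bndc_M|exact: bndc_character].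
  rewrite cmean_sum; last by move=> x; apply: bndc_M; [exact: bndc_cst|].
  by apply: eq_bigr => x _; rewrite cmeanZ// -Ec; ring.
(* On [S] the phase of [f] is the one in the hypothesis; replacing the power of the Fourier
   transform by [T] costs [e]. *)
have Hh xi : (2^-1 - e) * v * (S xi)%:R <= complex.Re (h xi).
  rewrite /h /= -meanZ // mulrC -meanZ; last exact: bndf_Z.
  apply: mean_le; last 1 first.
  - exact: (bndc_Re (bh xi)).
  - move=> eta; rewrite Re_realM /f.
    have [Sx|_] := boolP (S xi); last by rewrite !mul0r mulr0 /= !mulr0.
    have [Se|_] := boolP (S eta); last first.
      by rewrite !(mul0r, mulr0, conjc0) /=; rewrite ?(mulr0,mul0r).
    rewrite !mul1r -expiN opprK -expiD (_ : - dotR a xi + dotR a eta = - dotR a (xi - eta)); last first.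
      rewrite /dotR -!sumrN -big_split; apply: eq_bigr => i _ /=; rewrite !mxE; ring.
    rewrite mulr1 mulrC ler_wpM2l ?theta_ge0//.
    set z := expi _; set Fz := fourier phi (xi0 + (xi - eta)) ^+ n.+1.
    have H1 := HS _ _ Sx Se; rewrite -/z -/Fz in H1.
    have H2 := Hs (xi0 + (xi - eta)); rewrite -/Fz Et -/(T _) in H2.
    have -> : u * T (xi0 + (xi - eta)) * z = u * Fz * z - u * (Fz - T (xi0 + (xi - eta))) * z by ring.
    rewrite ReD ReN lerB// (le_trans (le_trans (ler_norm _) (Re_le_cabs _)))//.
    by rewrite !cabsM u1 mul1r cabs_expi mulr1.
  - by apply: bndf_Z; exact: bndf_Z.
rewrite EA expr2 mulrA -meanZ//.
rewrite -[complex.Re _]/(mean (fun xi => complex.Re ((theta xi)%:C%C * h xi))); apply: mean_le.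
- by move=> xi; rewrite Re_realM mulrCA ler_wpM2l ?theta_ge0.
- exact: bndf_Z.
- by apply: (bndc_Re (f := fun xi => (theta xi)%:C%C * h xi)); exact: bndc_M.
Qed.

End FourierInversion.

(** * Matrix exponentials and the flow of a linear vector field *)

Section LinearFlow.
Variables (R : realType) (d : nat).
Notation Rd := 'rV[R]_d.
Notation C := R[i].
Notation M := 'M[R]_d.
Implicit Types (E A : M).

Lemma is_deriveP (f : R -> R) (t v : R) : is_derive t 1 f v <->
  forall e : R, 0 < e -> exists2 r, 0 < r & forall h, `|h| <= r -> `|f (t + h) - f t - h * v| <= e * `|h|.
Proof.
split=> [[df dv] e e0|H].
  have : h^-1 *: ((f \o shift t) (h *: 1) - f t) @[h --> 0^'] --> v.
    by rewrite -dv; exact: df.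
  move=> /cvgrPdist_le /(_ e e0) [r /= r0 Hr]; exists (r / 2); first by rewrite divr_gt0.
  move=> h hr; have [->|h0] := eqVneq h 0; first by rewrite addr0 subrr mul0r subrr normr0 mulr0.
  have := Hr h; rewrite /= sub0r normrN => /(_ _ h0) H.
  have {}H := H ltac:(lra).
  rewrite -[leLHS]normrN (_ : - (f (t + h) - f t - h * v) = (v - h^-1 *: (f (h *: 1 + t) - f t)) * h); last first.
    by rewrite /GRing.scale /= mulr1 (addrC h t); field.
  by rewrite normrM ler_wpM2r.
have cv : h^-1 *: ((f \o shift t) (h *: 1) - f t) @[h --> 0^'] --> v.
  apply/cvgrPdist_le => e e0; have [r r0 Hr] := H e e0.
  exists r => //= h; rewrite /= sub0r normrN => hr h0.
  have h0' : 0 < `|h| by rewrite normr_gt0.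
  rewrite -(ler_pM2r h0') -normrM -[leLHS]normrN.
  rewrite (_ : - ((v - h^-1 *: (f (h *: 1 + t) - f t)) * h) = f (t + h) - f t - h * v); first by apply: Hr; exact: ltW.
  by rewrite /GRing.scale /= mulr1 (addrC h t); field.
by apply: DeriveDef; [apply/cvg_ex; exists v|exact: cvg_lim cv].
Qed.

Lemma is_derive_unique (f : R -> R) (t v w : R) : is_derive t 1 f v -> is_derive t 1 f w -> v = w.
Proof. by move=> [_ <-] [_ <-]. Qed.

Lemma is_derive_cont (f : R -> R) (t v : R) : is_derive t 1 f v -> {for t, continuous f}.
Proof. by move=> H; apply/differentiable_continuous/derivable1_diffP; exact: ex_derive. Qed.

Lemma is_derive_bigsum (I : Type) (r : seq I) (f : I -> R -> R) (v : I -> R) (t : R) :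
  (forall i, is_derive t 1 (f i) (v i)) ->
  is_derive t 1 (fun s => \sum_(i <- r) f i s) (\sum_(i <- r) v i).
Proof.
move=> H; elim: r => [|i r IH].
  rewrite big_nil (_ : (fun s => _) = cst 0); first exact: is_derive_cst.
  by apply/funext => s; rewrite big_nil.
rewrite big_cons (_ : (fun s => _) = f i \+ (fun s => \sum_(i <- r) f i s)); first exact: is_deriveD.
by apply/funext => s; rewrite big_cons.
Qed.

Lemma normr_entry A i j : `|A i j| <= `|A|.
Proof.
rewrite [X in _ <= X]mx_normrE.
exact: (le_bigmax _ (fun k : 'I_d * 'I_d => `|A k.1 k.2|) (i, j)).
Qed.
Lemma normr_mx_le A (e : R) : 0 <= e -> (forall i j, `|A i j| <= e) -> `|A| <= e.
Proof.
move=> e0 H; rewrite [X in X <= _]mx_normE -[e]/((NngNum e0)%:num) num_le.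
apply/bigmax_leP; split => [|[i j] _]; first by rewrite -num_le.
by rewrite -num_le /= H.
Qed.

(** The sum of the absolute entries is submultiplicative, so the exponential series is dominated by
    a scalar one. *)
Definition mx1norm A : R := \sum_i \sum_j `|A i j|.
Lemma mx1norm_ge0 A : 0 <= mx1norm A.
Proof. by apply: sumr_ge0 => i _; apply: sumr_ge0. Qed.
Lemma entry_mx1norm A i j : `|A i j| <= mx1norm A.
Proof.
rewrite /mx1norm (bigD1 i)//= (bigD1 j)//= -addrA lerDl addr_ge0 ?sumr_ge0// => k _.
exact: sumr_ge0.
Qed.
Lemma mx1normM A E : mx1norm (A *m E) <= mx1norm A * mx1norm E.
Proof.
rewrite /mx1norm mulr_suml; apply: ler_sum => i _.
apply: (@le_trans _ _ (\sum_j \sum_k `|A i k| * `|E k j|)).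
  apply: ler_sum => j _; rewrite mxE; apply: le_trans (ler_norm_sum _ _ _) _.
  by apply: ler_sum => k _; rewrite normrM.
rewrite exchange_big /= mulr_suml; apply: ler_sum => k _.
rewrite -mulr_sumr ler_wpM2l// [leRHS](bigD1 k)//= lerDl.
by apply: sumr_ge0 => l _; apply: sumr_ge0.
Qed.

(** Taylor coefficient of order k of an entry of exp(u E) A. With the factor [A] the family is
    stable under d/du, which replaces [A] by [E *m A]. *)
Definition expc E A (i j : 'I_d) (k : nat) : R := (k`!%:R)^-1 * (E ^+ k *m A) i j.

Lemma expc_le E A i j k : `|expc E A i j k| <= (k`!%:R)^-1 * (mx1norm E ^+ k * mx1norm A).
Proof.
rewrite normrM ger0_norm ?invr_ge0// ler_wpM2l ?invr_ge0//.
apply: le_trans (entry_mx1norm _ _ _) _.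
elim: k => [|k IH]; first by rewrite expr0 mul1mx expr0 mul1r.
rewrite exprS -[E * _]/(E *m _) -mulmxA; apply: le_trans (mx1normM _ _) _.
by rewrite exprS -mulrA ler_wpM2l// mx1norm_ge0.
Qed.

Lemma cvg_expc E A i j (u : R) : cvgn (pseries (expc E A i j) u).
Proof.
apply: normed_cvg; apply: (@series_le_cvg _ _ (fun k => mx1norm A * exp_coeff (mx1norm E * `|u|) k)).
- by move=> k; exact: normr_ge0.
- by move=> k; rewrite mulr_ge0 ?mx1norm_ge0// /exp_coeff /= divr_ge0// exprn_ge0// mulr_ge0// mx1norm_ge0.
- move=> k /=; rewrite normrM normrX; apply: le_trans (ler_wpM2r _ (expc_le _ _ _ _ _)) _.
    by rewrite exprn_ge0.
  by rewrite /exp_coeff /= exprMn le_eqVlt; apply/orP; left; apply/eqP; ring.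
- rewrite (_ : series _ = (fun n => mx1norm A * series (exp_coeff (mx1norm E * `|u|)) n)).
    by apply: is_cvgMr; exact: is_cvg_series_exp_coeff.
  by apply/funext => n; rewrite /series /= mulr_sumr.
Qed.

Lemma expc_diffs E A i j : pseries_diffs (expc E A i j) = expc E (E *m A) i j.
Proof.
apply/funext => k; rewrite /pseries_diffs /expc exprSr -[_ * E]/(_ *m E) -mulmxA.
by rewrite factS natrM invfM mulrA mulVKf// pnatr_eq0.
Qed.

Definition expm E A (u : R) : M := \matrix_(i, j) limn (pseries (expc E A i j) u).

Lemma is_derive_expm E A i j (u : R) : is_derive u 1 (fun u => expm E A u i j) (expm E (E *m A) u i j).
Proof.
rewrite mxE -expc_diffs (_ : (fun u => _) = (fun u => limn (pseries (expc E A i j) u))); last first.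
  by apply/funext => v; rewrite mxE.
apply: (@pseries_snd_diffs _ _ (`|u| + 1)).
- exact: cvg_expc.
- rewrite expc_diffs; exact: cvg_expc.
- rewrite !expc_diffs; exact: cvg_expc.
- by rewrite [`|_ + 1|]ger0_norm ?addr_ge0// ltrDl.
Qed.

Lemma mexpE E (u : R) : mexp (u *: E) = expm E 1%:M u.
Proof.
apply: cvg_lim; first exact: norm_hausdorff.
apply/cvgrPdist_le => e e0.
have H : \forall n \near \oo, forall i, forall j, `|expm E 1%:M u i j - pseries (expc E 1%:M i j) u n| <= e.
  apply: filter_forall => i; apply: filter_forall => j; rewrite mxE.
  by have /cvgrPdist_le/(_ _ e0) := @cvg_expc E 1%:M i j u.
apply: filterS H => n H; apply: normr_mx_le; first exact: ltW.
move=> i j; have := H i j; rewrite !mxE; congr (`|_ - _| <= e).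
rewrite /pseries /series /= summxE; apply: eq_bigr => k _.
rewrite /expc mulmx1 !mxE mulrAC -mulrA; congr (_ * _).
elim: k i j {H} => [|k IH] i j; first by rewrite !expr0 mul1r.
rewrite !exprS -[E * _]/(E *m _) -[(u *: E) * _]/((u *: E) *m _) !mxE mulr_sumr.
by apply: eq_bigr => l _; rewrite mxE -IH; ring.
Qed.

Lemma cvg_expm_sum (a : 'I_d -> nat -> R) (l : 'I_d -> R) (b : 'I_d -> R) :
  (forall k, a k @ \oo --> l k) ->
  (fun n => \sum_k a k n * b k) @ \oo --> \sum_k l k * b k.
Proof.
move=> H; apply: (@cvg_big _ _ +%R); first exact: add_continuous.
by move=> k _; apply: cvgMl; exact: H.
Qed.

Lemma expm_mulr E A (u : R) : expm E A u = expm E 1%:M u *m A.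
Proof.
apply/matrixP => i j; rewrite !mxE; apply: cvg_lim => //.
under [X in _ --> X]eq_bigr do rewrite mxE.
have H := cvg_expm_sum (b := fun k => A k j) (fun k => @cvg_expc E 1%:M i k u).
rewrite (_ : pseries _ _ = (fun n => \sum_k pseries (expc E 1%:M i k) u n * A k j)) //.
apply/funext => n; rewrite /pseries /series /=.
under [RHS]eq_bigr do rewrite mulr_suml.
rewrite exchange_big /=; apply: eq_bigr => k _.
rewrite /expc mulmx1 mxE mulr_sumr mulr_suml; apply: eq_bigr => l _; ring.
Qed.

Lemma expm_comm E (u : R) : E *m expm E 1%:M u = expm E 1%:M u *m E.
Proof.
rewrite -expm_mulr; apply/matrixP => i j; rewrite !mxE; apply/esym; apply: cvg_lim => //.
under [X in _ --> X]eq_bigr do rewrite mxE mulrC.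
have H := cvg_expm_sum (b := fun k => E i k) (fun k => @cvg_expc E 1%:M k j u).
rewrite (_ : pseries _ _ = (fun n => \sum_k pseries (expc E 1%:M k j) u n * E i k)) //.
apply/funext => n; rewrite /pseries /series /=.
under [RHS]eq_bigr do rewrite mulr_suml.
rewrite exchange_big /=; apply: eq_bigr => k _.
rewrite /expc mulmx1 -[_ *m E]/(_ * E) -exprSr exprS -[E * _]/(E *m _) mxE mulr_sumr mulr_suml.
apply: eq_bigr => l _; ring.
Qed.

Lemma expm0 E : expm E 1%:M 0 = 1%:M.
Proof.
apply/matrixP => i j; rewrite mxE; apply: cvg_lim => //.
apply: (@cvg_near_cst); exists 1%N => // n /= n1.
case: n n1 => // n _; rewrite /pseries /series /= big_nat_recl// expr0 mulr1 /expc fact0 invr1 mul1r expr0 mulmx1 big1 ?addr0// => k _.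
by rewrite expr0n mulr0.
Qed.

(** The product exp(v E) exp(- v E) has zero derivative in v, since [E] commutes with its
    exponential, and it is the identity at v = 0. *)
Lemma expm_inv E (u : R) : expm E 1%:M u *m expm E 1%:M (- u) = 1%:M.
Proof.
apply/matrixP => i j.
pose g (v : R) := (expm E 1%:M v *m expm E 1%:M (- v)) i j.
have dg (v : R) : is_derive v 1 g 0.
  have -> : g = fun v => \sum_k expm E 1%:M v i k * expm E 1%:M (- v) k j.
    by apply/funext => w; rewrite /g mxE.
  pose D k : R := expm E 1%:M v i k * - (E *m expm E 1%:M (- v)) k j + (expm E 1%:M (- v) k j) * (expm E 1%:M v *m E) i k.
  have ED : \sum_k D k = 0.
    rewrite /D big_split /=.
    have -> : \sum_k expm E 1%:M v i k * - (E *m expm E 1%:M (- v)) k j = - (expm E 1%:M v *m (E *m expm E 1%:M (- v))) i j.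
      by rewrite [in RHS]mxE -sumrN; apply: eq_bigr => k _; rewrite mulrN.
    have -> : \sum_k expm E 1%:M (- v) k j * (expm E 1%:M v *m E) i k = ((expm E 1%:M v *m E) *m expm E 1%:M (- v)) i j.
      by rewrite [in RHS]mxE; apply: eq_bigr => k _; rewrite mulrC.
    by rewrite mulmxA addrC subrr.
  apply: is_derive_eq ED; apply: is_derive_bigsum => k.
  have d1 := is_derive_expm E 1%:M i k v; rewrite mulmx1 expm_mulr in d1.
  have d2 : is_derive v 1 (fun w => expm E 1%:M (- w) k j) (- (E *m expm E 1%:M (- v)) k j).
    have d3 := is_derive_expm E 1%:M k j (- v); rewrite mulmx1 expm_mulr -expm_comm in d3.
    have dN : is_derive v 1 (-%R : R -> R) (- 1) by apply: is_deriveN.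
    have := is_derive1_comp d3 dN; rewrite mulrN1; exact.
  exact: (is_deriveM d1 d2).
have := is_derive_0_is_cst u 0 dg; rewrite /g => ->.
by rewrite oppr0 expm0 mulmx1.
Qed.

Lemma tpowE t E : tpow t E = expm E 1%:M (ln t).
Proof. exact: mexpE. Qed.
(** The orbits of E / k are those of E with time raised to the power k. This relates the scalings of
    [Rr] and of |Q|, and that of a square to that of its base. *)
Lemma tpow_powR t (k : R) E : 0 < t -> k != 0 -> tpow (t `^ k) (k^-1 *: E) = tpow t E.
Proof. by move=> t0 k0; rewrite /tpow ln_powR scalerA mulrAC mulfV// mul1r. Qed.
Lemma act_powR t (k : R) E (xi : Rd) : 0 < t -> k != 0 -> act (t `^ k) (k^-1 *: E) xi = act t E xi.
Proof. by move=> t0 k0; rewrite /act tpow_powR. Qed.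

Lemma act1 E (xi : Rd) : act 1 E xi = xi.
Proof. by rewrite /act tpowE ln1 expm0 trmx1 mulmx1. Qed.
Lemma actK t E (xi : Rd) : 0 < t -> act t E (act t^-1 E xi) = xi.
Proof.
move=> t0; rewrite /act !tpowE lnV ?posrE// -mulmxA -trmx_mul expm_inv trmx1 mulmx1 //.
Qed.
Lemma actVK t E (xi : Rd) : 0 < t -> act t^-1 E (act t E xi) = xi.
Proof. by move=> t0; rewrite -{2}[t]invrK actK// invr_gt0. Qed.
Lemma actB t E (xi eta : Rd) : act t E (xi - eta) = act t E xi - act t E eta.
Proof. by rewrite /act mulmxBl. Qed.
Lemma act0 t E : act t E (0 : Rd) = 0.
Proof. by rewrite /act mul0mx. Qed.

Lemma is_derive_act (t : R) E (xi : Rd) j : 0 < t ->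
  is_derive t 1 (fun s => act s E xi 0 j) (t^-1 * (act t E xi *m E^T) 0 j).
Proof.
move=> t0.
have dl l : is_derive t 1 (fun s => xi 0 l * expm E 1%:M (ln s) j l) (xi 0 l * ((E *m tpow t E) j l * t^-1)).
  have d1 := is_derive_expm E 1%:M j l (ln t); rewrite mulmx1 expm_mulr -expm_comm -tpowE in d1.
  exact: (is_deriveZ (xi 0 l) (is_derive1_comp d1 (is_derive1_ln t0))).
have := is_derive_bigsum (index_enum 'I_d) dl.
rewrite (_ : (fun s => _) = (fun s => act s E xi 0 j)); last first.
  by apply/funext => s; rewrite /act mxE; apply: eq_bigr => l _; rewrite [in RHS]mxE tpowE.
rewrite (_ : \sum_l _ = t^-1 * (act t E xi *m E^T) 0 j)//.
rewrite /act -mulmxA -trmx_mul [in RHS]mxE mulr_sumr; apply: eq_bigr => l _.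
rewrite [in RHS]mxE; ring.
Qed.

Lemma normr_act t E (xi : Rd) : `|act t E xi| <= d%:R * `|tpow t E| * `|xi|.
Proof.
apply: normr_rV_le => [|j]; first by rewrite !mulr_ge0.
rewrite /act mxE; apply: le_trans (ler_norm_sum _ _ _) _.
rewrite -mulrA -[d in d%:R]card_ord mulr_natl -sumr_const; apply: ler_sum => l _.
by rewrite normrM mulrC ler_pM// ?normr_coord// mxE normr_entry.
Qed.

Lemma contracting_small E (K e : R) : contracting E -> 0 < e ->
  exists2 tau, 0 < tau & forall t (xi : Rd), 0 < t < tau -> `|xi| <= K -> `|act t E xi| <= e.
Proof.
move=> cE e0; have K1 : 0 < d%:R * `|K| + 1 by rewrite ltr_wpDl// mulr_ge0.
move: cE => /cvgrPdist_le /(_ (e / (d%:R * `|K| + 1))); rewrite divr_gt0// => /(_ isT).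
move=> [tau /= t0 Ht]; exists tau => // t xi /andP[tp tt] xK.
have := Ht t; rewrite /= !sub0r !normrN gtr0_norm// => /(_ tt tp) H.
apply: le_trans (normr_act _ _ _) _.
have xK' : `|xi| <= `|K| by rewrite (le_trans xK)// ler_norm.
apply: (@le_trans _ _ ((d%:R * `|K| + 1) * (e / (d%:R * `|K| + 1)))); last first.
  by rewrite mulrC divfK// gt_eqF.
rewrite mulrAC; apply: ler_pM; rewrite ?mulr_ge0//.
by apply: (@le_trans _ _ (d%:R * `|K|)); rewrite ?ler_wpM2l// lerDl.
Qed.

(** Chain rule along a curve; the quadratic remainder of [f] and the first-order error of the curve
    receive half of the tolerance each. *)
Lemma is_derive_D2_curve B (f : Rd -> C) f' (gam : R -> Rd) (v : Rd) (t : R) :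
  D2 B f f' -> B (gam t) -> (forall j, is_derive t 1 (fun s => gam s 0 j) (v 0 j)) ->
  is_derive t 1 (fun s => complex.Re (f (gam s))) (complex.Re (dir v (f' (gam t)))) /\
  is_derive t 1 (fun s => complex.Im (f (gam s))) (complex.Im (dir v (f' (gam t)))).
Proof.
move=> [K [e [K0 e0 H]]] Bg dg; have [h1 h2 h3] := H _ Bg.
suff key : forall eps : R, 0 < eps -> exists2 r, 0 < r & forall h : R, `|h| <= r ->
    cabs (f (gam (t + h)) - f (gam t) - h%:C%C * dir v (f' (gam t))) <= eps * `|h|.
  split; apply/is_deriveP => eps /key[r r0 Hr]; exists r => // h /Hr; apply: le_trans.
    by apply: le_trans (Re_le_cabs _); rewrite !ReD !ReN Re_realM.
  by apply: le_trans (Im_le_cabs _); rewrite !ImD !ImN Im_realM.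
move=> eps eps0.
pose L : R := `|v| + 1.
have L0 : 0 < L by rewrite ltr_wpDl.
have dK0 : 0 < 2 * (d%:R * K + 1) by rewrite mulr_gt0// ltr_wpDl// mulr_ge0.
pose e1 := Num.min 1 (eps / (2 * (d%:R * K + 1))).
have e10 : 0 < e1 by rewrite lt_min ltr01 divr_gt0.
have [r r0 Hr] : exists2 r, 0 < r & forall h : R, `|h| <= r -> `|gam (t + h) - gam t - h *: v| <= e1 * `|h|.
  have Hj j : \forall h \near (0 : R), `|gam (t + h) 0 j - gam t 0 j - h * v 0 j| <= e1 * `|h|.
    have /is_deriveP/(_ _ e10)[r r0 Hr] := dg j; exists r => //= h; rewrite /= sub0r normrN => hr.
    by apply: Hr; exact: ltW.
  have [r /= r0 Hr] : \forall h \near (0 : R), forall j, `|gam (t + h) 0 j - gam t 0 j - h * v 0 j| <= e1 * `|h|.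
    exact: (@filter_forall R 'I_d (fun j h => `|gam (t + h) 0 j - gam t 0 j - h * v 0 j| <= e1 * `|h|) (nbhs (0 : R)) (nbhs_filter (0 : R)) Hj).
  exists (r / 2); first by rewrite divr_gt0.
  move=> h hr; apply: normr_rV_le => [|j]; first by rewrite mulr_ge0// ltW.
  rewrite !mxE; apply: Hr => /=; rewrite sub0r normrN; lra.
pose r1 := Num.min r (Num.min (e / L) (eps / (2 * (K * L ^+ 2 + 1)))).
have KL : 0 < 2 * (K * L ^+ 2 + 1) by rewrite mulr_gt0// ltr_wpDl// mulr_ge0// sqr_ge0.
exists r1; first by rewrite !lt_min r0 !divr_gt0.
move=> h; rewrite !le_min => /and3P[hr he hk].
have Hd := Hr _ hr; set D := gam (t + h) - gam t in Hd *.
have DL : `|D| <= L * `|h|.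
  rewrite -[D](subrK (h *: v)); apply: le_trans (ler_normD _ _) _.
  rewrite normrZ /L mulrDl mul1r addrC [`|v| * _]mulrC lerD2l.
  by apply: le_trans Hd _; rewrite ler_piMl// /e1 ge_min lexx.
have De : `|D| <= e.
  by apply: le_trans DL _; rewrite mulrC -ler_pdivlMr.
have H3 := h3 _ De; rewrite /D [gam t + _]addrC subrK -/D in H3.
rewrite (_ : _ - _ - _ = (f (gam (t + h)) - f (gam t) - dir D (f' (gam t))) + dir (D - h *: v) (f' (gam t))); last first.
  have -> : D - h *: v = D + (- h) *: v by rewrite scaleNr.
  by rewrite dirDl dirZl real_complexN; ring.
apply: le_trans (cabsD _ _) _.
apply: le_trans (lerD H3 (@cabs_dir _ _ (D - h *: v) _ _ h2)) _.
apply: (@le_trans _ _ (K * (L * `|h|) ^+ 2 + d%:R * K * (e1 * `|h|))).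
  apply: lerD; last by rewrite ler_wpM2l// mulr_ge0.
  by rewrite ler_wpM2l// lerXn2r ?nnegrE// mulr_ge0// ltW.
have a1 : K * L ^+ 2 * `|h| <= eps / 2.
  have : (K * L ^+ 2 + 1) * `|h| <= eps / 2.
    apply: le_trans (ler_wpM2l _ hk) _; first by rewrite addr_ge0// mulr_ge0// sqr_ge0.
    by rewrite le_eqVlt; apply/orP; left; apply/eqP; field; lra.
  by apply: le_trans; rewrite ler_wpM2r// lerDl.
have a2 : d%:R * K * e1 <= eps / 2.
  have : (d%:R * K + 1) * e1 <= eps / 2.
    apply: (@le_trans _ _ ((d%:R * K + 1) * (eps / (2 * (d%:R * K + 1))))).
      by rewrite ler_wpM2l ?addr_ge0 ?mulr_ge0// /e1 ge_min lexx orbT.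
    by rewrite le_eqVlt; apply/orP; left; apply/eqP; field; lra.
  by apply: le_trans; rewrite ler_wpM2r// ?lerDl// ltW.
have h0 := normr_ge0 h.
rewrite (_ : _ + _ = (K * L ^+ 2 * `|h| + d%:R * K * e1) * `|h|); last by ring.
by rewrite ler_wpM2r//; lra.
Qed.

(* The derivation along the linear vector field of [E], i.e. [t d/dt] along the orbits [act t E xi]. *)
Definition euler E (f' : Rd -> 'I_d -> C) (z : Rd) : C := dir (z *m E^T) (f' z).

Lemma is_derive_act_D2 B (f : Rd -> C) f' E (eta : Rd) (t : R) : 0 < t ->
  D2 B f f' -> B (act t E eta) ->
  is_derive t 1 (fun s => complex.Re (f (act s E eta))) (t^-1 * complex.Re (euler E f' (act t E eta))) /\
  is_derive t 1 (fun s => complex.Im (f (act s E eta))) (t^-1 * complex.Im (euler E f' (act t E eta))).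
Proof.
move=> t0 Df Bt; have := @is_derive_D2_curve B f f' (fun s => act s E eta) (t^-1 *: (act t E eta *m E^T)) t Df Bt.
rewrite dirZl Re_realM Im_realM; apply => j; rewrite mxE; exact: is_derive_act.
Qed.

(** Euler's identity: differentiate P(act s E z) = s P(z) at s = 1. *)
Lemma euler_homogeneous B (P : Rd -> R) P' E z : D2 B (fun xi => (P xi)%:C%C) P' -> B z ->
  homogeneous P E -> euler E P' z = (P z)%:C%C.
Proof.
move=> DP Bz hP; have Bz1 : B (act 1 E z) by rewrite act1.
have [d1 d2] := is_derive_act_D2 ltr01 DP Bz1; rewrite invr1 !mul1r act1 in d1 d2.
apply: complexRI => /=; last by apply: is_derive_unique d2 _; exact: is_derive_cst.
apply: is_derive_unique d1 _.
have d3 : is_derive (1 : R) 1 (fun s : R => s * P z) (P z).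
  apply/is_deriveP => e e0; exists 1 => // h _.
  rewrite (_ : _ - _ - _ = 0); last by ring.
  by rewrite normr0 mulr_ge0// ltW.
apply: near_eq_is_derive d3.
near=> s; rewrite /= hP//; near: s; exact: lt_nbhsr.
Unshelve. all: by end_near.
Qed.

End LinearFlow.

(** * Homogeneous functions and polynomials without linear part *)

Section HomogeneousFunctions.
Variables (R : realType) (d : nat).
Notation Rd := 'rV[R]_d.
Notation C := R[i].
Implicit Types (P : Rd -> R) (E : 'M[R]_d).

(** Generalised polar coordinates: the value of P serves as the time along the orbit, and the
    angular part lies on the level set P = 1. Bounds on that compact set thus become bounds relative
    to P. *)
Lemma normal_form P E z : homogeneous P E -> 0 < P z ->
  exists2 eta, P eta = 1 & z = act (P z) E eta.
Proof.
move=> hP Pz; exists (act (P z)^-1 E z); last by rewrite actK.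
by rewrite hP ?invr_gt0// mulVf// gt_eqF.
Qed.

Lemma compact_norm_bound (A : set Rd) : compact A -> exists2 K : R, 0 < K & forall xi, A xi -> `|xi| <= K.
Proof.
move=> /compact_bounded [K [_ HK]]; exists (`|K| + 1); first by rewrite ltr_wpDl.
move=> xi Axi; apply: (HK (`|K| + 1)) => //.
by rewrite (le_lt_trans (ler_norm _))// ltrDl.
Qed.

(** A point with P z = t is the image at time t of a point of the compact set P = 1, and the flow
    contracts this set to the origin as t tends to 0. *)
Lemma sublevel_small P E (r : R) : homogeneous P E -> contracting E ->
  (forall z, 0 <= P z) -> (forall z, P z = 0 -> z = 0) ->
  compact [set xi | P xi = 1] -> 0 < r ->
  exists2 tau, 0 < tau & forall z, P z < tau -> `|z| <= r.
Proof.
move=> hP cE P0 Pd cP r0; have [K K0 HK] := compact_norm_bound cP.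
have [tau t0 Ht] := contracting_small K cE r0; exists tau => // z Pz.
have [Pz0|Pz0] := eqVneq (P z) 0; first by rewrite (Pd _ Pz0) normr0 ltW.
have Pzp : 0 < P z by rewrite lt0r Pz0 P0.
have [eta Pe ->] := normal_form hP Pzp.
by apply: Ht; [rewrite Pzp|exact: HK].
Qed.

Lemma monomial_bound (z : Rd) (m : 'I_d -> nat) : `|z| <= 1 -> (2 <= \sum_i m i)%N ->
  `|\prod_i z 0 i ^+ m i| <= `|z| ^+ 2.
Proof.
move=> z1 m2; rewrite normr_prod; apply: (@le_trans _ _ (\prod_i `|z| ^+ m i)).
  apply: ler_prod => i _; rewrite normr_ge0 normrX lerXn2r ?nnegrE//; exact: normr_coord.
rewrite -(big_morph (fun n : nat => `|z| ^+ n) (exprD _) (expr0 _)).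
exact: ler_wiXn2l.
Qed.

Lemma poly_nolin_bound P : poly_nolin P ->
  exists2 K, 0 <= K & forall z, `|z| <= 1 -> `|P z| <= K * `|z| ^+ 2.
Proof.
move=> [s [Hs HP]]; exists (\sum_(m <- s) `|m.2|); first by apply: sumr_ge0.
move=> z z1; rewrite HP; apply: le_trans (ler_norm_sum _ _ _) _.
rewrite mulr_suml big_seq [leRHS]big_seq; apply: ler_sum => m ms.
by rewrite normrM ler_wpM2l//; apply: monomial_bound => //; exact: Hs.
Qed.

Lemma poly_nolin0 P : poly_nolin P -> P 0 = 0.
Proof.
move=> /poly_nolin_bound[K K0 H]; apply/eqP; rewrite -normr_le0.
by have := H 0; rewrite normr0 expr0n mulr0; apply.
Qed.

Lemma isD2_poly_nolin P (r : R) : poly_nolin P ->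
  isD2 [set xi | `|xi| <= r] (fun xi => (P xi)%:C%C).
Proof.
move=> [s [_ HP]].
apply: (@isD2_eq _ _ _ (fun xi => (\sum_(m <- s) m.2 * \prod_(i < d) xi 0 i ^+ m.1 i)%:C%C)).
  by move=> xi; rewrite HP.
apply: isD2r_sum => m; apply: isD2r_mulc; apply: isD2r_prod => i.
apply: isD2r_exp; exact: isD2_coord.
Qed.

Lemma continuous_real_ball P z (e : R) : continuous P -> 0 < e ->
  exists2 r : R, 0 < r & forall xi, `|xi - z| <= r -> `|P xi - P z| <= e.
Proof.
move=> cP e0; have := cP z.
move=> /(@cvgrPdist_le _ _ _ _ (nbhs_filter z) _ _)/(_ e e0) H.
have /nbhs_ballP[r /= r0 Hr] := H; exists (r / 2); first by rewrite divr_gt0.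
move=> xi Hx; rewrite distrC; apply: Hr; rewrite -ball_normE /= distrC.
by apply: le_lt_trans Hx _; rewrite ltr_pdivrMr// ltr_pMr// ltr1n.
Qed.

End HomogeneousFunctions.

(** * One-variable calculus for the profiles used in the volume estimates *)

Section RealCalculus.
Variable R : realType.
Implicit Types (f G : R -> R).

Lemma MVT_between f df (a b : R) :
  (forall x, Num.min a b <= x <= Num.max a b -> is_derive x 1 f (df x)) ->
  exists2 c, Num.min a b <= c <= Num.max a b & f b - f a = df c * (b - a).
Proof.
wlog ab : a b / a <= b.
  move=> H Hd; case/orP: (le_total a b) => ab; first exact: H ab Hd.
  have [|c Hc Ec] := H b a ab; first by move=> x; rewrite minC maxC; exact: Hd.
  exists c; first by rewrite minC maxC.
  by rewrite -opprB Ec; ring.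
rewrite min_l// max_r// => Hd.
have [||c Hc Ec] := MVT_segment ab _ _ (f := f) (df := df).
- by move=> x; rewrite in_itv /= => /andP[/ltW ax /ltW xb]; apply: Hd; rewrite ax.
- apply: derivable_within_continuous => x; rewrite in_itv /= => Hx.
  by have [] := Hd x Hx.
- by exists c => //; move: Hc; rewrite in_itv.
Qed.

Lemma nondecreasing_of_derive f df (a b : R) : a <= b ->
  (forall x, a <= x <= b -> is_derive x 1 f (df x)) ->
  (forall x, a <= x <= b -> 0 <= df x) -> f a <= f b.
Proof.
move=> ab Hd H0; have [|c] := @MVT_between f df a b; first by rewrite min_l// max_r.
rewrite min_l// max_r// => Hc Ec; rewrite -subr_ge0 Ec mulr_ge0 ?H0// subr_ge0//.
Qed.

(** Base points are nonnegative because profiles are evaluated at s^2 P; the radius 1/2 keeps 1 + u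
    + v away from the singularity of negative powers. *)
Definition C11 G G' := exists2 K : R, 0 <= K & forall u, 0 <= u ->
  [/\ `|G u| <= K, `|G' u| <= K &
   forall v, `|v| <= 2^-1 -> `|G (u + v) - G u - v * G' u| <= K * v ^+ 2].

Definition kappa' (u : R) : R :=
  2 * Num.max 0 (1 - sqpos (u - 1)) * (- (2 * Num.max 0 (u - 1))).

Lemma kappa'_le0 u : kappa' u <= 0.
Proof.
rewrite /kappa' mulrN oppr_le0; apply: mulr_ge0; apply: mulr_ge0 => //.
  by rewrite le_max lexx.
by rewrite le_max lexx.
Qed.
Lemma kappa'_eq0 u : u <= 1 -> kappa' u = 0.
Proof. by move=> u1; rewrite /kappa' [Num.max 0 (u - 1)]max_l ?mulr0 ?oppr0 ?mulr0//; lra. Qed.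
Lemma kappa'_out u : 2 <= u -> kappa' u = 0.
Proof.
move=> u1; rewrite /kappa' [Num.max 0 (1 - _)]max_l ?mulr0 ?mul0r//.
by rewrite sqpos_pos; nra.
Qed.
Lemma kappa'_bound u : `|kappa' u| <= 4.
Proof.
have [u1|u1] := leP u 1; first by rewrite kappa'_eq0// normr0.
have [u2|u2] := leP 2 u; first by rewrite kappa'_out// normr0.
rewrite ler0_norm ?kappa'_le0// /kappa'.
have a0 : 0 <= sqpos (u - 1) by exact: sqpos_ge0.
have b0 : 0 <= Num.max 0 (1 - sqpos (u - 1)) by rewrite le_max lexx.
have b1 : Num.max 0 (1 - sqpos (u - 1)) <= 1 by rewrite ge_max ler01; lra.
rewrite [Num.max 0 (u - 1)]max_r; last by lra.
nra.
Qed.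

Lemma kappa'_mul_bound u : 0 <= u -> `|kappa' u * (2 * u)| <= 16.
Proof.
move=> u0; have [u2|u2] := leP 2 u; first by rewrite kappa'_out// mul0r normr0.
rewrite normrM [`|2 * u|]ger0_norm ?mulr_ge0//.
have := kappa'_bound u; have := normr_ge0 (kappa' u); nra.
Qed.

(** [kappa] is [sqpos] of a, with a increment D satisfying |D| <= 5 |v|. The outer remainder is at
    most D^2 <= 25 v^2 and the inner one is multiplied by a derivative at most 2, hence 27. For u >=
    3 every term vanishes. *)
Lemma kappa_taylor u v : `|v| <= 1 -> `|kappa (u + v) - kappa u - v * kappa' u| <= 27 * v ^+ 2.
Proof.
move=> v1; have v2 : -1 <= v <= 1 by rewrite -ler_norml.
have [u3|u3] := leP 3 u.
  rewrite !kappa0 ?kappa'_out; [|lra..].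
  by rewrite mulr0 !subrr normr0 mulr_ge0// sqr_ge0.
pose m := 2 * Num.max 0 (u - 1).
have m0 : 0 <= m <= 4 by rewrite /m; have [?|?] := leP 0 (u - 1); lra.
pose a := 1 - sqpos (u - 1); pose D := - (sqpos (u - 1 + v) - sqpos (u - 1)).
have Eu : kappa (u + v) = sqpos (a + D).
  by rewrite /kappa /a /D; congr sqpos; rewrite (_ : u + v - 1 = u - 1 + v); ring.
have H1 := sqpos_taylor a D; have H2 := sqpos_taylor (u - 1) v.
have a1 : 0 <= 2 * Num.max 0 a <= 2.
  have := sqpos_ge0 (u - 1); rewrite /a; have [?|?] := leP 0 (1 - sqpos (u - 1)); lra.
rewrite -/m in H2; rewrite Eu /kappa' -/a -/m.
have -> : kappa u = sqpos a by [].
set A := 2 * Num.max 0 a in H1 a1 *.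
have HD : `|D + v * m| <= v ^+ 2.
  by rewrite -normrN (_ : - _ = sqpos (u - 1 + v) - sqpos (u - 1) - v * m)//; rewrite /D; ring.
have v0 := normr_ge0 v; have Ev : v ^+ 2 = `|v| ^+ 2 by rewrite real_normK ?num_real.
have D5 : `|D| <= 5 * `|v|.
  rewrite -[D](addrK (v * m)); apply: le_trans (ler_normB _ _) _.
  rewrite normrM [`|m|]ger0_norm; last by lra.
  nra.
have D2 : D ^+ 2 <= 25 * v ^+ 2.
  rewrite -[D ^+ 2]real_normK ?num_real// Ev; have := normr_ge0 D; nra.
rewrite (_ : _ - _ - _ = (sqpos (a + D) - sqpos a - D * A) + A * (D + v * m)); last first.
  by rewrite /A; ring.
apply: le_trans (ler_normD _ _) _; rewrite normrM [`|A|]ger0_norm; last by lra.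
have := normr_ge0 (D + v * m); nra.
Qed.

Lemma C11_kappa : C11 (@kappa R) kappa'.
Proof.
exists 27 => // u u0; split.
- rewrite ger0_norm ?kappa_ge0//; have := kappa_le1 u; lra.
- by have := kappa'_bound u; lra.
- by move=> v v1; apply: kappa_taylor; lra.
Qed.

Lemma powR_neg_le (y p q : R) : 0 < q -> q <= y -> 0 <= p -> y `^ (- p) <= q `^ (- p).
Proof.
move=> q0 qy p0; rewrite !powRN lef_pV2 ?posrE ?powR_gt0//; last exact: lt_le_trans qy.
by apply: (@ge0_ler_powR _ p p0 q y) => //; rewrite nnegrE ltW//; exact: lt_le_trans qy.
Qed.

(** The mean value theorem is applied twice; [K] adds the bounds at 1/2 of the function and of its
    first two derivatives. *)
Lemma C11_powR (p : R) : 0 < p -> C11 (fun u => (1 + u) `^ (- p)) (fun u => - p * (1 + u) `^ (- p - 1)).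
Proof.
move=> p0.
have dpow q (x : R) : 0 < 1 + x -> is_derive x 1 (fun u => (1 + u) `^ q) (q * (1 + x) `^ (q - 1)).
  move=> x0; have d1 : is_derive x 1 (fun u : R => 1 + u) 1.
    apply/is_deriveP => e e0; exists 1 => // h _.
    rewrite (_ : _ - _ - _ = 0); last by ring.
    by rewrite normr0 mulr_ge0// ltW.
  by have := is_derive1_comp (is_derive1_powR q x0) d1; rewrite mulr1.
have pb (q y : R) : 2^-1 <= y -> 0 <= q -> y `^ (- q) <= 2^-1 `^ (- q) by move=> *; exact: powR_neg_le.
pose K := 2^-1 `^ (- p) + p * 2^-1 `^ (- (p + 1)) + p * (p + 1) * 2^-1 `^ (- (p + 2)).
have b1 : 0 <= 2^-1 `^ (- p) :> R by exact: powR_ge0.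
have b2 : 0 <= p * 2^-1 `^ (- (p + 1)) by rewrite mulr_ge0 ?powR_ge0// ltW.
have b3 : 0 <= p * (p + 1) * 2^-1 `^ (- (p + 2)) by rewrite !mulr_ge0 ?powR_ge0// ?addr_ge0 ?ltW.
exists K; first by rewrite /K !addr_ge0.
move=> u u0; split.
- rewrite ger0_norm ?powR_ge0//; apply: le_trans (pb p (1 + u) _ _) _; rewrite /K; lra.
- rewrite normrM normrN (gtr0_norm p0) ger0_norm ?powR_ge0//.
  apply: (@le_trans _ _ (p * 2^-1 `^ (- (p + 1)))); last by rewrite /K; lra.
  rewrite ler_wpM2l ?(ltW p0)// -opprD; apply: pb; lra.
move=> v; rewrite ler_norml => /andP[v1 v2].
have pos x : Num.min u (u + v) <= x <= Num.max u (u + v) -> 2^-1 <= 1 + x.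
  move=> /andP[+ _]; rewrite ge_min => /orP[]; lra.
have [|c Hc Ec] := @MVT_between (fun u => (1 + u) `^ (- p)) (fun u => - p * (1 + u) `^ (- p - 1)) u (u + v).
  by move=> x /pos Hx; apply: dpow; lra.
rewrite Ec (addrC u v) addrK.
have sub x : Num.min u c <= x <= Num.max u c -> Num.min u (u + v) <= x <= Num.max u (u + v).
  move: Hc => /andP[c1 c2] /andP[x1 x2]; apply/andP; split.
    by apply: le_trans x1; rewrite le_min c1 andbT ge_min lexx.
  by apply: le_trans x2 _; rewrite ge_max c2 andbT le_max lexx.
have [|c' Hc' Ec'] := @MVT_between (fun u => - p * (1 + u) `^ (- p - 1)) (fun u => - p * ((- p - 1) * (1 + u) `^ (- p - 1 - 1))) u c.
  move=> x /sub/pos Hx; have := is_deriveZ (- p) (dpow (- p - 1) x ltac:(lra)); exact.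
rewrite (_ : _ - _ = v * (- p * (1 + c) `^ (- p - 1) - - p * (1 + u) `^ (- p - 1))); last by ring.
rewrite normrM Ec' normrM -[v ^+ 2]real_normK ?num_real// expr2 mulrCA mulrA [leRHS]mulrA.
have cuv : `|c - u| <= `|v|.
  move: Hc => /andP[]; have [v0|v0] := leP 0 v.
    rewrite min_l ?max_r; [|lra..]; move=> c1 c2; rewrite (ger0_norm v0) ger0_norm; lra.
  rewrite min_r ?max_l; [|lra..]; move=> c1 c2; rewrite (ltr0_norm v0) ler0_norm; lra.
rewrite -mulrA mulrCA mulrA [leRHS]mulrAC mulrC [leRHS]mulrC.
have Hp : 2^-1 <= 1 + c' by apply: pos; exact: sub.
have H2 : `|- p * ((- p - 1) * (1 + c') `^ (- p - 1 - 1))| <= K.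
  rewrite mulrA normrM [`|_ `^ _|]ger0_norm ?powR_ge0// (_ : - p * (- p - 1) = p * (p + 1)); last by ring.
  rewrite gtr0_norm; last by rewrite mulr_gt0// addr_gt0.
  apply: (@le_trans _ _ (p * (p + 1) * 2^-1 `^ (- (p + 2)))); last by rewrite /K; lra.
  rewrite ler_wpM2l//; first by rewrite mulr_ge0 ?addr_ge0 ?ltW.
  rewrite (_ : - p - 1 - 1 = - (p + 2)); last by ring.
  by apply: pb; lra.
have v0 := normr_ge0 v; have := normr_ge0 (c - u).
move: H2; set A := `|- p * _|; have : 0 <= A by exact: normr_ge0.
move=> A0 AK cu0.
apply: (@le_trans _ _ (`|v| * (K * `|v|))).
  rewrite [leRHS](_ : _ = `|v| * (`|v| * K)); last by ring.
  by apply: ler_pM => //; [exact: mulr_ge0|rewrite ler_wpM2l].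
by rewrite le_eqVlt; apply/orP; left; apply/eqP; ring.
Qed.

End RealCalculus.

(** * The divergence theorem and the size of means of functions of s^2 P *)

Section Volume.
Variables (R : realType) (d : nat).
Notation Rd := 'rV[R]_d.
Notation C := R[i].

(** The divergence of the field f(z) E z is V f + (tr E) f, and each of its partial derivatives has
    mean zero. The support, of radius 1 around a centre of norm at most 4 pi, lies in the ball of
    radius 6 pi where grid shifts are harmless. *)
Lemma cmean_divergence (E : 'M[R]_d) (c : Rd) f f' : D2 setT f f' ->
  (forall z, f z != 0 -> `|z| <= 1) -> `|c| <= 4 * pi ->
  cmean (fun xi => euler E f' (xi - c) + (\tr E)%:C%C * f (xi - c)) = 0.
Proof.
move=> Df sf c4; have p2 := @pi_ge2 R.
have bf : bndc f := D2_bndc Df.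
have [Kf' [Kf0 HKf']] := D2_bounded' Df.
pose g j z : C := f z * (z 0 j)%:C%C.
pose g' j z i : C := f' z i * (z 0 j)%:C%C + f z * (j == i)%:R.
have Dg j : D2 setT (g j) (g' j).
  apply: (@D2_cut _ _ 2 1) => //; first by rewrite ltr1n.
  by apply: D2_coord; exists 2.
have bg' j i : bndc (fun xi => g' j (xi - c) i).
  by have [K [_ HK]] := D2_bounded' (Dg j); exists K => xi; exact: HK.
have Zg i j : cmean (fun xi => g' j (xi - c) i) = 0.
  apply: (cmean_partial (f := fun xi => g j (xi - c)) (f' := fun xi => g' j (xi - c))).
    by have := D2_shift c (Dg j); rewrite (_ : [set xi | setT (xi - c)] = setT)// -subTset.
  move=> xi; rewrite /g mulf_eq0 negb_or => /andP[/sf zc _].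
  by have := ler_normD (xi - c) c; rewrite subrK; lra.
transitivity (cmean (fun xi => \sum_i \sum_j (E i j)%:C%C * g' j (xi - c) i)); last first.
  rewrite cmean_sum; last by move=> i; apply: bndc_sum => j; apply: bndc_M; [exact: bndc_cst|].
  apply: big1 => i _; rewrite cmean_sum; last by move=> j; apply: bndc_M; [exact: bndc_cst|].
  by apply: big1 => j _; rewrite cmeanZ// Zg mulr0.
congr cmean; apply/funext => xi; rewrite /euler /dir /mxtrace real_complex_sum mulr_suml -big_split /=.
apply: eq_bigr => i _; rewrite mxE real_complex_sum mulr_suml.
rewrite (_ : (E i i)%:C%C * f (xi - c) = \sum_j (E i j)%:C%C * (f (xi - c) * (j == i)%:R)); last first.
  by rewrite (bigD1 i)//= eqxx mulr1 big1 ?addr0// => j /negbTE ->; rewrite !mulr0.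
rewrite -big_split /=; apply: eq_bigr => j _.
have -> : E^T j i = E i j by rewrite mxE.
rewrite real_complexM /g'; ring.
Qed.

(** The ball contains a cube of side 2 pi / q, which captures at least the fraction q^(-d) of (n +
    1)^d grid points for every n. *)
Lemma mean_ball_pos (r : R) : 0 < r -> 0 < mean (fun xi : Rd => (`|xi| <= r)%R%:R).
Proof.
move=> r0; have p0 := pi_gt0 R.
pose q := (Num.truncn (2 * pi / r)).+1.
have q0 : (0 : R) < q%:R by rewrite ltr0n.
have qr : 2 * pi / q%:R <= r.
  rewrite ler_pdivrMr// [r * _]mulrC -ler_pdivrMr//; apply: ltW; exact: truncnS_gt.
have UP : ProperFilter ultra_oo := @ultra_proper _ _ ultra_oo_ultra.
have B : bndf (fun xi : Rd => (`|xi| <= r)%R%:R) by exists 1 => xi; case: (`|xi| <= r); rewrite ?normr1 ?normr0.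
apply: (@lt_le_trans _ _ (q%:R^-1 ^+ d)); first by rewrite exprn_gt0// invr_gt0.
apply: (ler_cvg_to (f := fun=> q%:R^-1 ^+ d)) (cvg_cst _) (mean_cvg B) _.
apply: filterE => n; set N := n.+1.
have N0 : (0 : R) < N%:R by rewrite ltr0n.
rewrite /grid_mean -/N mulrC ler_pdivlMr ?exprn_gt0// -exprMn.
(* Indicator of the indices whose coordinate lies in [0, 2 pi / q]; index 4N corresponds to the
   coordinate 0. *)
pose a (k : 'I_(8 * N).+1) : R := ((4 * N <= k) && (k <= 4 * N + N %/ q))%N%:R.
have Ha : q%:R^-1 * N%:R <= \sum_k a k.
  rewrite -(big_mkord xpredT (fun k : nat => ((4 * N <= k) && (k <= 4 * N + N %/ q))%N%:R)).
  have NqN : (N %/ q <= N)%N by exact: leq_div.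
  rewrite (@big_cat_nat _ _ _ (4 * N)%N) /=; [|lia..].
  have H1 : (4 * N <= 4 * N + (N %/ q).+1)%N by exact: leq_addr.
  have H2 : (4 * N + (N %/ q).+1 <= (8 * N).+1)%N by move: NqN; move: (N %/ q)%N => D; lia.
  rewrite (@big_cat_nat _ _ _ (4 * N + (N %/ q).+1)%N (4 * N)%N) //=.
  apply: (@le_trans _ _ (\sum_(4 * N <= i < 4 * N + (N %/ q).+1) 1)).
    rewrite sumr_const_nat addKn mulrC ler_pdivrMr// -natrM ler_nat.
    by rewrite ltnW// {1}(divn_eq N q) mulSn addnC ltn_add2r ltn_mod.
  rewrite addrA addrAC -[leLHS]add0r lerD//; first by apply: addr_ge0; apply: sumr_ge0.
  apply: ler_sum_nat => k /andP[k1 k2].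
  by rewrite k1 -ltnS -addnS k2.
apply: (@le_trans _ _ ((\sum_k a k) ^+ d)).
  by rewrite lerXn2r ?nnegrE ?sumr_ge0 ?mulr_ge0 ?invr_ge0.
rewrite -[d in _ ^+ d]card_ord -prodr_const bigA_distr_bigA /=.
apply: ler_sum => j _.
have [jr|jr] := boolP (`|grid_pt R j| <= r).
  apply: (@le_trans _ _ (\prod_(i < d) 1)); last by rewrite big1.
  by apply: ler_prod => i _; rewrite /a ler0n -[X in _ <= X]/(1%:R) ler_nat leq_b1.
have [i Hi] : exists i, ~~ ((4 * N <= j i) && (j i <= 4 * N + N %/ q))%N.
  apply: contrapT => H; move/negP: jr; apply; apply: normr_rV_le => [|i]; first exact: ltW.
  have /andP[j1 j2] : ((4 * N <= j i) && (j i <= 4 * N + N %/ q))%N.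
    by apply: contrapT => /negP Hi; apply: H; exists i.
  rewrite mxE -/N.
  have -> : ((j i : nat)%:R : R) / N%:R - 4 = (j i - 4 * N)%N%:R / N%:R.
    by rewrite natrB// natrM; field; rewrite gt_eqF.
  have jN : ((j i - 4 * N)%N%:R : R) / N%:R <= q%:R^-1.
    rewrite ler_pdivrMr// mulrC ler_pdivlMr// -natrM ler_nat.
    have jq : (j i - 4 * N <= N %/ q)%N by lia.
    by apply: leq_trans (leq_trunc_div N q); rewrite leq_mul2r jq orbT.
  rewrite ger0_norm; last by rewrite !mulr_ge0 ?divr_ge0 ?ler0n// ltW.
  by apply: le_trans qr; rewrite ler_wpM2l// mulr_ge0// ltW.
by rewrite (bigD1 i)//= /a (negbTE Hi) mul0r.
Qed.

(** [P] will be a multiple of the square of a polynomial, of weight 2 under V, and [g] either a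
    negative power of 1 + u for upper bounds or [kappa] for lower bounds. *)
Variables (E : 'M[R]_d) (c : Rd) (P : Rd -> R) (P' : Rd -> 'I_d -> C) (del : R).
Hypotheses (cpi : `|c| <= 4 * pi) (del0 : 0 < del) (P0 : forall z, 0 <= P z).
Hypotheses (DP : D2 [set z | `|z| <= 1] (fun z => (P z)%:C%C) P').
Hypothesis (eP : forall z, `|z| <= 1 -> euler E P' z = (2 * P z)%:C%C).
Hypothesis (sub : forall z, P z < 2 * del ^+ 2 -> `|z| <= 2^-1).
Variables (g g' : R -> R).
Hypotheses (Cg : C11 g g') (g01 : forall u, 0 <= u -> 0 <= g u <= 1).
Variables (p Kp : R).
Hypotheses (p0 : 0 < p) (mup : \tr E < 2 * p) (Kp0 : 0 <= Kp) (gdec : forall u, 0 < u -> g u <= Kp * u `^ (- p)).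

Let mu := \tr E.
Let chi z := kappa (P z / del ^+ 2).
Let w (s : R) z := chi z * g (s ^+ 2 * P z).
Let dw (s : R) z := chi z * g' (s ^+ 2 * P z) * (2 * s * P z).
(** The part of V w in which the derivation falls on the cutoff [chi]; the remaining part is s dw/ds
    because P has weight 2. *)
Let X (s : R) z := kappa' (P z / del ^+ 2) * (2 * P z / del ^+ 2) * g (s ^+ 2 * P z).
Let J s := mean (fun xi => w s (xi - c)).

Let d20 : 0 < del ^+ 2. Proof. by rewrite exprn_gt0. Qed.
Let Pd0 z : 0 <= P z / del ^+ 2. Proof. by rewrite divr_ge0// ltW. Qed.
Let chi_out z : 2^-1 < `|z| -> chi z = 0 /\ kappa' (P z / del ^+ 2) = 0.
Proof.
move=> z2; have H : 2 <= P z / del ^+ 2.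
  by rewrite ler_pdivlMr// leNgt; apply: contraTN z2 => /sub; rewrite leNgt.
by split; [exact: kappa0|exact: kappa'_out].
Qed.
Let chi01 z : 0 <= chi z <= 1. Proof. by rewrite kappa_ge0 kappa_le1. Qed.
Let s2P0 s z : 0 <= s ^+ 2 * P z. Proof. by rewrite mulr_ge0// sqr_ge0. Qed.

Let D2_w s : exists2 w', D2 setT (fun z => (w s z)%:C%C) w' &
  forall z, euler E w' z = (X s z + s * dw s z)%:C%C.
Proof.
pose u' z i := complex.Re (P' z i).
have DPr : D2 [set z | `|z| <= 1] (fun z => (P z)%:C%C) (fun z i => (u' z i)%:C%C) by exact: D2_Re DP.
have eu z : `|z| <= 1 -> euler E (fun z i => (u' z i)%:C%C) z = (2 * P z)%:C%C.
  by move=> z1; rewrite /euler -(@Re_dir _ _ (z *m E^T) (P' z)) -/(euler E P' z) eP.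
have [K [K0 HK]] := D2_bounded DP.
have scale (a : R) : D2 [set z | `|z| <= 1] (fun z => (a * P z)%:C%C) (fun z i => (a * u' z i)%:C%C).
  apply: D2_eq (D2_scale (a%:C%C) DPr) => [z|z _ i]; by rewrite real_complexM.
have comp (G G' : R -> R) (a : R) : C11 G G' -> 0 <= a ->
    D2 [set z | `|z| <= 1] (fun z => (G (a * P z))%:C%C) (fun z i => (G' (a * P z) * (a * u' z i))%:C%C).
  move=> [L L0 HL] a0; apply: (D2_comp (u := fun z => a * P z) (u' := fun z i => a * u' z i) (G := G) (G' := G') (K := L) (e := 2^-1)) => //.
    by move=> z _; apply: HL; rewrite mulr_ge0.
have Dk := comp _ _ (del ^+ 2)^-1 (@C11_kappa R) ltac:(by rewrite invr_ge0 ltW).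
have Dg := comp _ _ (s ^+ 2) Cg (sqr_ge0 _).
have Dw := D2_mul Dk Dg.
pose w0' z i := (kappa' ((del ^+ 2)^-1 * P z) * ((del ^+ 2)^-1 * u' z i))%:C%C * (g (s ^+ 2 * P z))%:C%C +
   (kappa ((del ^+ 2)^-1 * P z))%:C%C * (g' (s ^+ 2 * P z) * (s ^+ 2 * u' z i))%:C%C : C.
have Dw0 : D2 [set z | `|z| <= 1] (fun z => (w s z)%:C%C) w0'.
  by apply: D2_eq Dw => [z|z _ i]; rewrite // /w /chi real_complexM [_^-1 * _]mulrC.
exists (fun z i => if `|z| <= 1 then w0' z i else 0).
  apply: (@D2_extend _ _ 1 2^-1) => //; first by lra.
  move=> z; rewrite leNgt; apply: contra => z2; have [h _] := chi_out z2.
  by rewrite /w h mul0r.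
move=> z; have [z1|z1] := leP `|z| 1; last first.
  have [h1 h2] := chi_out (z := z) ltac:(lra).
  rewrite /X /dw h1 h2 !mul0r mulr0 addr0 /euler /dir; apply: big1 => i _.
  by rewrite leNgt z1 mulr0.
rewrite /euler (@dir_eq _ _ _ _ (w0' z)); last by move=> i; rewrite z1.
rewrite /w0' dirDr dirMl.
rewrite (@dir_eq _ _ _ _ (fun i => (kappa' ((del ^+ 2)^-1 * P z) * (del ^+ 2)^-1)%:C%C * (u' z i)%:C%C)); last first.
  by move=> i; rewrite -real_complexM mulrA.
rewrite dirMr dirMr.
rewrite (@dir_eq _ _ _ (fun i => (g' (s ^+ 2 * P z) * (s ^+ 2 * u' z i))%:C%C) (fun i => (g' (s ^+ 2 * P z) * s ^+ 2)%:C%C * (u' z i)%:C%C)); last first.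
  by move=> i; rewrite -real_complexM mulrA.
rewrite dirMr -/(euler E (fun z i => (u' z i)%:C%C) z) eu// -!(real_complexM, real_complexD).
congr (_%:C)%C; rewrite /X /dw /chi [P z / _]mulrC; ring.
Qed.

Let bnd_w s : bndf (fun xi => w s (xi - c)).
Proof.
exists 1 => xi; have /andP[a1 a2] := chi01 (xi - c); have /andP[b1 b2] := g01 (s2P0 s (xi - c)).
have -> : `|w s (xi - c)| = w s (xi - c) by rewrite ger0_norm// mulr_ge0.
exact: mulr_ile1.
Qed.

Let P_small z : chi z != 0 -> P z <= 2 * del ^+ 2.
Proof.
move=> h; rewrite -ler_pdivrMr// leNgt; apply: contra h => h; rewrite /chi kappa0//; exact: ltW.
Qed.

Let X_bound s z : `|X s z| <= 16 * g (s ^+ 2 * P z).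
Proof.
have /andP[b1 _] := g01 (s2P0 s z).
rewrite /X normrM [`|g _|]ger0_norm// ler_wpM2r// -(mulrA 2).
exact: kappa'_mul_bound (Pd0 z).
Qed.

Let bnd_X s : bndf (fun xi => X s (xi - c)).
Proof.
exists 16 => xi; set z := xi - c; have /andP[b1 b2] := g01 (s2P0 s z).
apply: le_trans (X_bound s z) _; lra.
Qed.

Let bnd_dw s : bndf (fun xi => dw s (xi - c)).
Proof.
have [K K0 HK] := Cg; exists (K * (2 * `|s| * (2 * del ^+ 2))) => xi; set z := xi - c.
have [cz|h] := eqVneq (chi z) 0.
  by rewrite /dw cz !mul0r normr0; do !apply: mulr_ge0 => //; exact: ltW.
have Pz := P_small h; have [_ g'K _] := HK _ (s2P0 s z).
have /andP[a1 a2] := chi01 z.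
rewrite /dw normrM [`|chi z * _|]normrM (ger0_norm a1) normrM [`|P z|]ger0_norm// normrM [`|2|]ger0_norm//.
have k0 := normr_ge0 (g' (s ^+ 2 * P z)).
apply: ler_pM; [exact: mulr_ge0|by rewrite !mulr_ge0| |by rewrite ler_wpM2l// mulr_ge0].
by rewrite -[leRHS]mul1r; exact: ler_pM.
Qed.

(* The divergence theorem for the field [E z] makes [s J' + mu J] equal to the nonnegative quantity [- mean X],
   which is [O(s^(- 2 p))]; integrating [s^mu J] therefore bounds [J] on both sides when [mu < 2 p]. *)
Let J_euler s : s * mean (fun xi => dw s (xi - c)) = - mu * J s - mean (fun xi => X s (xi - c)).
Proof.
have [w' Dw Ew] := D2_w s.
have := cmean_divergence E Dw _ cpi.
have sw z : (w s z)%:C%C != 0 :> C -> `|z| <= 1.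
  move=> h; apply: (@le_trans _ _ 2^-1); last by lra.
  by rewrite leNgt; apply: contra h => z2; have [h _] := chi_out z2; rewrite /w h mul0r.
move=> /(_ sw); rewrite (_ : (fun xi => _) = (fun xi => ((X s (xi - c) + s * dw s (xi - c)) + mu * w s (xi - c))%:C%C)); last first.
  by apply/funext => xi; rewrite Ew -real_complexM -real_complexD.
rewrite cmean_real => /(congr1 (@complex.Re R)) /=.
have b1 := bnd_w s; have b2 := bnd_X s; have b3 := bnd_dw s.
rewrite meanD; [|apply: bndf_D => //; exact: bndf_Z|exact: bndf_Z].
rewrite meanD//; last exact: bndf_Z.
by rewrite !meanZ// -/(J s); lra.
Qed.

Let X_le0 s : mean (fun xi => X s (xi - c)) <= 0.
Proof.
rewrite -oppr_ge0 -(meanN (bnd_X s)); apply: mean_ge0; last exact/bndf_N/bnd_X.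
move=> xi; have /andP[b1 b2] := g01 (s2P0 s (xi - c)).
by rewrite oppr_ge0 /X -mulrA mulr_le0_ge0 ?kappa'_le0// mulr_ge0// divr_ge0 ?(ltW d20)// mulr_ge0.
Qed.

Let mean1 : 0 <= mean (fun _ : Rd => 1 : R).
Proof. by apply: mean_ge0 => //; exact: bndf_cst. Qed.

(** On the support of [kappa'] the function P is at least del^2, so the profile is evaluated at s^2
    del^2 or beyond, where its decay gives s^(-2p). *)
Let X_small : exists2 KX : R, 0 <= KX & forall s, 1 <= s -> - KX * s `^ (- (2 * p)) <= mean (fun xi => X s (xi - c)).
Proof.
pose A := 16 * (Kp * (del ^+ 2) `^ (- p)).
have A0 : 0 <= A by rewrite !mulr_ge0// powR_ge0.
exists (A * mean (d := d) (fun=> 1)); first by rewrite mulr_ge0.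
move=> s s1; have s0 : 0 < s by lra.
rewrite mulNr mulrAC -meanZ; last exact: bndf_cst.
rewrite -meanN; last by apply: bndf_Z; exact: bndf_cst.
apply: mean_le; [|by apply/bndf_N/bndf_Z/bndf_cst|exact: bnd_X].
move=> xi; rewrite mulr1; set z := xi - c.
rewrite lerNl; apply: le_trans (ler_norm _) _; rewrite normrN.
have [h|h] := leP 2 (P z / del ^+ 2); first by rewrite /X kappa'_out// !mul0r normr0 mulr_ge0// powR_ge0.
have [h1|h1] := leP (P z / del ^+ 2) 1; first by rewrite /X kappa'_eq0// !mul0r normr0 mulr_ge0// powR_ge0.
have Pdel : del ^+ 2 <= P z by move: h1; rewrite ltr_pdivlMr// mul1r => /ltW.
have gs : g (s ^+ 2 * P z) <= Kp * (del ^+ 2) `^ (- p) * s `^ (- (2 * p)).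
  have sp : 0 < s ^+ 2 * P z by rewrite mulr_gt0 ?exprn_gt0//; exact: lt_le_trans Pdel.
  apply: le_trans (gdec sp) _; rewrite -mulrA ler_wpM2l//.
  apply: (@le_trans _ _ ((s ^+ 2 * del ^+ 2) `^ (- p))).
    apply: powR_neg_le; rewrite ?mulr_gt0 ?exprn_gt0//; last exact: ltW.
    by rewrite ler_wpM2l// sqr_ge0.
  rewrite powRM ?sqr_ge0// mulrC -(powR_mulrn 2 (ltW s0)) -powRrM.
  by rewrite mulrN lexx.

apply: le_trans (X_bound s z) _; rewrite /A -(mulrA 16) ler_wpM2l//.
Qed.

(** Differentiation under the mean. On the support of [chi] P is bounded by B, which makes the
    Taylor remainder uniform; the bound on h keeps the increment of s^2 P below 1/2, the radius
    allowed by [C11]. *)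
Let J_derive (s : R) : 1 <= s -> is_derive s 1 J (mean (fun xi => dw s (xi - c))).
Proof.
move=> s1; have s0 : 0 < s by lra.
have [K K0 HK] := Cg.
pose B := 2 * del ^+ 2; have B0 : 0 < B by rewrite mulr_gt0.
pose L := K * ((2 * s + 1) * B) ^+ 2 + B * K.
have L0 : 0 <= L by apply: addr_ge0; apply: mulr_ge0 => //; [exact: sqr_ge0|exact: ltW].
have sB : 0 < (2 * s + 1) * B by rewrite mulr_gt0//; lra.
have key h : `|h| <= Num.min 1 (2^-1 / ((2 * s + 1) * B)) ->
    `|J (s + h) - J s - h * mean (fun xi => dw s (xi - c))| <= L * h ^+ 2 * mean (d := d) (fun=> 1).
  rewrite le_min => /andP[h1 hs].
  have bw1 := bnd_w (s + h); have bw := bnd_w s; have bd := bnd_dw s.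
  rewrite /J -(meanZ h bd) -(meanN bw) -(meanD bw1 (bndf_N bw)) -(meanN (bndf_Z h bd)).
  rewrite -(meanD (bndf_D bw1 (bndf_N bw)) (bndf_N (bndf_Z h bd))) -(meanZ _ (@bndf_cst R d 1)).
  apply: mean_abs; last exact/bndf_Z/bndf_cst.
  move=> xi; set z := xi - c; rewrite mulr1.
  have [cz|cz] := eqVneq (chi z) 0.
    by rewrite /w /dw cz !mul0r mulr0 !subrr normr0 mulr_ge0// sqr_ge0.
  have Pz : P z <= B by exact: P_small.
  have /andP[a1 a2] := chi01 z.
  pose v := (2 * s * h + h ^+ 2) * P z.
  have Ev : (s + h) ^+ 2 * P z = s ^+ 2 * P z + v by rewrite /v; ring.
  have h2 : `|2 * s * h + h ^+ 2| <= (2 * s + 1) * `|h|.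
    rewrite (_ : _ + _ = (2 * s + h) * h); last by ring.
    rewrite normrM ler_wpM2r// (le_trans (ler_normD _ _))// lerD// ger0_norm//; lra.
  have vh : `|v| <= (2 * s + 1) * B * `|h|.
    by rewrite /v normrM [`|P z|]ger0_norm// [leRHS]mulrAC; apply: ler_pM.
  have v2 : `|v| <= 2^-1.
    by apply: le_trans vh _; rewrite mulrC -ler_pdivlMr.
  have [_ gK gT] := HK _ (s2P0 s z).
  rewrite /w /dw Ev.
  rewrite (_ : _ - _ = chi z * ((g (s ^+ 2 * P z + v) - g (s ^+ 2 * P z) - v * g' (s ^+ 2 * P z)) + h ^+ 2 * P z * g' (s ^+ 2 * P z))); last first.
    by rewrite /v; ring.
  rewrite normrM [`|chi z|]ger0_norm//; apply: (@le_trans _ _ (1 * (L * h ^+ 2))); last by rewrite mul1r.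
  apply: ler_pM => //; apply: le_trans (ler_normD _ _) _.
  rewrite /L mulrDl; apply: lerD.
    apply: le_trans (gT _ v2) _; rewrite -mulrA ler_wpM2l// -[v ^+ 2]real_normK ?num_real//.
    by rewrite -[h ^+ 2]real_normK ?num_real// -exprMn lerXn2r ?nnegrE// mulr_ge0// ltW.
  have hh : 0 <= h ^+ 2 by exact: sqr_ge0.
  rewrite normrM [`|h ^+ 2 * _|]ger0_norm; last exact: mulr_ge0.
  rewrite [leRHS]mulrC [leRHS]mulrA; apply: ler_pM => //.
  by rewrite ler_wpM2l.
apply/is_deriveP => e e0.
pose m := L * mean (d := d) (fun=> 1 : R) + 1.
have m0 : 0 < m by rewrite ltr_wpDl// mulr_ge0.
exists (Num.min (Num.min 1 (2^-1 / ((2 * s + 1) * B))) (e / m)).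
  by rewrite !lt_min ltr01 !divr_gt0.
move=> h; rewrite le_min => /andP[/key H hm]; apply: le_trans H _.
rewrite -[h ^+ 2]real_normK ?num_real// expr2 mulrA mulrAC ler_wpM2r//.
rewrite mulrAC; apply: (@le_trans _ _ (m * `|h|)); first by rewrite ler_wpM2r// lerDl.
by rewrite mulrC -ler_pdivlMr.
Qed.

Let jd (s : R) := s `^ (mu - 1) * - mean (fun xi => X s (xi - c)).

Let j_derive (s : R) : 1 <= s -> is_derive s 1 (fun s => s `^ mu * J s) (jd s).
Proof.
move=> s1; have s0 : 0 < s by lra.
have := is_deriveM (is_derive1_powR mu s0) (J_derive s1).
rewrite /GRing.scale /= (_ : _ + _ = jd s) //.
have E1 : s `^ mu = s * s `^ (mu - 1).
  by rewrite -{2}(powRr1 (ltW s0)) -powRD ?(gt_eqF s0) ?implybT// addrC subrK.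
by rewrite E1 /jd mulrAC (J_euler s); ring.
Qed.

(** The derivative of s^mu J is s^(mu - 1) times - mean X, which is nonnegative since [kappa]
    decreases. *)
Lemma volume_lower s : 1 <= s -> s `^ (- mu) * J 1 <= J s.
Proof.
move=> s1; have s0 : 0 < s by lra.
have := @nondecreasing_of_derive _ (fun s => s `^ mu * J s) jd 1 s s1.
move=> H; have {}H := H (fun x Hx => j_derive (andP Hx).1).
have : 1 `^ mu * J 1 <= s `^ mu * J s.
  by apply: H => x _; rewrite /jd mulr_ge0 ?powR_ge0// oppr_ge0.
rewrite powR1 mul1r powRN => H1; rewrite mulrC ler_pdivrMr ?powR_gt0//.
by rewrite mulrC.
Qed.

(** The derivative of s^mu J is at most KX s^(mu - 1 - 2p). With D = KX / (2p - mu), the corrected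
    function s^mu J + D s^(mu - 2p) is nonincreasing, hence bounded by its value at 1. *)
Lemma volume_upper : exists2 K : R, 0 <= K & forall s, 1 <= s -> J s <= K * s `^ (- mu).
Proof.
have [KX KX0 HX] := X_small.
have q0 : 0 < 2 * p - mu by rewrite subr_gt0.
pose D := KX / (2 * p - mu).
have D0 : 0 <= D by rewrite divr_ge0// ltW.
have J0 s : 0 <= J s.
  apply: mean_ge0 => [xi|]; last exact: bnd_w.
  rewrite /w mulr_ge0//.
    by have /andP[] := chi01 (xi - c).
  by have /andP[] := g01 (s2P0 s (xi - c)).
exists (J 1 + D); first by rewrite addr_ge0.
move=> s s1; have s0 : 0 < s by lra.
pose k x := - (x `^ mu * J x + D * x `^ (mu - 2 * p)).
pose dk x := - (jd x + D * ((mu - 2 * p) * x `^ (mu - 2 * p - 1))).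
have : k 1 <= k s.
  apply: (@nondecreasing_of_derive _ k dk) => // x /andP[x1 _]; have x0 : 0 < x by lra.
    apply: is_deriveN; apply: is_deriveD; first exact: j_derive.
    exact: (is_deriveZ D (is_derive1_powR _ x0)).
  rewrite /dk oppr_ge0 /jd.
  have E1 : x `^ (mu - 2 * p - 1) = x `^ (mu - 1) * x `^ (- (2 * p)).
    by rewrite -powRD ?(gt_eqF x0) ?implybT//; congr (_ `^ _); ring.
  rewrite E1 (_ : _ + _ = x `^ (mu - 1) * (- mean (fun xi => X x (xi - c)) - (D * (2 * p - mu)) * x `^ (- (2 * p)))); last by ring.
  rewrite mulr_ge0_le0 ?powR_ge0// /D divfK ?gt_eqF// subr_le0 lerNl.
  by have := HX x x1; rewrite mulNr.
rewrite /k lerN2 powR1 mul1r mulr1 => H.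
have : s `^ mu * J s <= J 1 + D by apply: le_trans H; rewrite lerDl mulr_ge0// powR_ge0.
by rewrite powRN ler_pdivlMr ?powR_gt0// mulrC.
Qed.

End Volume.

Lemma kappa_mul01 (R : realType) (u v : R) : 0 <= kappa u * kappa v <= 1.
Proof.
have := kappa_ge0 u; have := kappa_ge0 v; have := kappa_le1 u; have := kappa_le1 v.
move: (kappa u) (kappa v) => a b *; rewrite mulr_ge0//= mulr_ile1//.
Qed.

(** * Volume estimates for polynomials whose absolute value is homogeneous *)

Section HomogeneousVolume.
Variables (R : realType) (d : nat).
Notation Rd := 'rV[R]_d.
Notation C := R[i].
Variables (S : Rd -> R) (E : 'M[R]_d).
Hypotheses (pS : poly_nolin S) (hS : pos_homogeneous (fun z => `|S z|))
  (hE : homogeneous (fun z => `|S z|) E) (cE : contracting E).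

Lemma eulerZ (a : R) (A : 'M[R]_d) (f' : Rd -> 'I_d -> C) z :
  euler (a *: A) f' z = a%:C%C * euler A f' z.
Proof. by rewrite /euler linearZ /= -scalemxAr dirZl. Qed.

(** Squaring removes the sign, and doubling the weight under E amounts to halving the exponent
    matrix. The square is again a polynomial, so Euler's identity is available for it. *)
Lemma homogeneous_sqr : homogeneous (fun z => S z ^+ 2) (2^-1 *: E).
Proof.
move=> t z t0; have t2 : 0 < t `^ 2^-1 by rewrite powR_gt0.
have tt : (t `^ 2^-1) ^+ 2 = t.
  by rewrite -powR_mulrn ?powR_ge0// -powRrM mulVf ?powRr1// ltW.
have := act_powR E z t2 (k := 2); rewrite -powRrM mulVf// powRr1 ?(ltW t0)// => -> //.
by rewrite -real_normK ?num_real// hE// exprMn tt real_normK ?num_real.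
Qed.

Lemma abs_sublevel (r : R) : 0 < r -> exists2 tau, 0 < tau & forall z, `|S z| < tau -> `|z| <= r.
Proof.
move=> r0; have [_ _ S0 _ Sc] := hS.
exact: (sublevel_small hE cE _ S0 Sc r0).
Qed.

Lemma abs_continuous_small (e : R) : 0 < e ->
  exists2 r : R, 0 < r & forall z, `|z| <= r -> `|S z| <= e.
Proof.
move=> e0; have [cS _ _ _ _] := hS.
have [r r0 Hr] := continuous_real_ball 0 cS e0; exists r => // z zr.
by have := Hr z; rewrite subr0 (poly_nolin0 pS) normr0 subr0 normr_id; apply.
Qed.

Lemma sqr_D2 (b : R) : exists2 P', D2 [set z | `|z| <= 1] (fun z => (b * S z ^+ 2)%:C%C) P' &
  forall z, `|z| <= 1 -> euler E P' z = (2 * (b * S z ^+ 2))%:C%C.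
Proof.
have [P' DP] := isD2r_mulc b (isD2r_exp 2 (isD2_poly_nolin 1 pS)).
exists P' => // z z1; have hb : homogeneous (fun z => b * S z ^+ 2) (2^-1 *: E).
  by move=> t xi t0; rewrite homogeneous_sqr//; ring.
have := euler_homogeneous (z := z) DP z1 hb; rewrite eulerZ => H.
by rewrite real_complexM -H mulrA -real_complexM mulfV// mul1r.
Qed.

Lemma volume_bound (c : Rd) (p : R) : `|c| <= 4 * pi -> 0 < p -> \tr E < 2 * p ->
  exists r K : R, [/\ 0 < r, 0 <= K & forall s, 1 <= s ->
    mean (fun xi => (`|xi - c| <= r)%R%:R * (1 + s ^+ 2 * S (xi - c) ^+ 2) `^ (- p)) <= K * s `^ (- \tr E)].
Proof.
move=> c4 p0 pE; have [tau t0 Ht] := abs_sublevel (r := 2^-1) ltac:(by rewrite invr_gt0).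
have [P' DP eP] := sqr_D2 1.
pose del : R := tau / 2; have del0 : 0 < del by rewrite divr_gt0.
have [r r0 Hr] := abs_continuous_small del0.
pose g (u : R) := (1 + u) `^ (- p).
have sub z : 1 * S z ^+ 2 < 2 * del ^+ 2 -> `|z| <= 2^-1.
  move=> H; apply: Ht; have : `|S z| ^+ 2 < tau ^+ 2.
    rewrite real_normK ?num_real//; move: H; rewrite mul1r /del => H; apply: lt_le_trans H _; nra.
  by rewrite ltr_pXn2r// nnegrE ltW.
have P0 z : 0 <= 1 * S z ^+ 2 by rewrite mul1r sqr_ge0.
have g01 (u : R) : 0 <= u -> 0 <= g u <= 1.
  move=> u0; rewrite powR_ge0 /= /g; rewrite -[leRHS](_ : 1 `^ (- p) = 1); last by rewrite powR1.
  by apply: powR_neg_le; lra.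
have gdec (u : R) : 0 < u -> g u <= 1 * u `^ (- p).
  by move=> u0; rewrite mul1r /g; apply: powR_neg_le; lra.
have [K K0 HK] := volume_upper c4 del0 P0 DP eP sub (C11_powR p0) g01 p0 pE ler01 gdec.
exists r, K; split => // s s1; apply: le_trans (HK s s1); apply: mean_le.
- move=> xi; have gg := g01 (s ^+ 2 * (1 * S (xi - c) ^+ 2)) ltac:(by rewrite mulr_ge0 ?sqr_ge0).
  rewrite /g mul1r in gg *; have [xr|xr] := leP `|xi - c| r; last first.
    by rewrite mul0r mulr_ge0 ?kappa_ge0//; case/andP: gg.
  rewrite kappa1// ler_pdivrMr ?exprn_gt0// mul1r -real_normK ?num_real//.
  by rewrite lerXn2r ?nnegrE ?(ltW del0)//; exact: Hr.
- exists 1 => xi; have /andP[] := g01 (s ^+ 2 * S (xi - c) ^+ 2) ltac:(by rewrite mulr_ge0 ?sqr_ge0).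
  move=> a b; rewrite normrM ger0_norm// [X in _ * X]ger0_norm//.
  by case: (_ <= r); rewrite ?mul1r ?mul0r ?ler01.
- exists 1 => xi; have /andP[] := g01 (s ^+ 2 * (1 * S (xi - c) ^+ 2)) ltac:(by rewrite mulr_ge0 ?sqr_ge0).
  move=> a b; rewrite normrM ger0_norm ?kappa_ge0// [X in _ * X]ger0_norm//.
  by rewrite mulr_ile1 ?kappa_ge0 ?kappa_le1.
Qed.

Lemma volume_sublevel (b : R) : 0 < b ->
  exists2 K : R, 0 < K & forall s, 1 <= s ->
    K * s `^ (- \tr E) <= mean (fun xi : Rd => ((`|xi| <= 2^-1) && (`|S xi| <= b / s))%R%:R).
Proof.
move=> b0; have [tau t0 Ht] := abs_sublevel (r := 2^-1) ltac:(by rewrite invr_gt0).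
(* With this factor the profile [kappa] of s^2 B S^2 vanishes as soon as |S| >= b / s. *)
pose B : R := 2 / b ^+ 2; have B0 : 0 < B by rewrite divr_gt0// exprn_gt0.
have [P' DP eP] := sqr_D2 B.
pose del : R := tau / b; have del0 : 0 < del by rewrite divr_gt0.
have d20 : 0 < del ^+ 2 by rewrite exprn_gt0.
have sub z : B * S z ^+ 2 < 2 * del ^+ 2 -> `|z| <= 2^-1.
  move=> H; apply: Ht; have : `|S z| ^+ 2 < tau ^+ 2.
    rewrite real_normK ?num_real//; move: H; rewrite /B /del expr_div_n mulrAC -mulrA ltr_pM2l//.
    by rewrite ltr_pM2r// invr_gt0 exprn_gt0.
  by rewrite ltr_pXn2r// nnegrE ltW.
have P0 z : 0 <= B * S z ^+ 2 by rewrite mulr_ge0 ?sqr_ge0// ltW.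
have g01 (u : R) : 0 <= u -> 0 <= kappa u <= 1 by rewrite kappa_ge0 kappa_le1.
have c4 : `|0 : Rd| <= 4 * pi by rewrite normr0 mulr_ge0// pi_ge0.
have lo := volume_lower c4 del0 P0 DP eP sub (@C11_kappa R) g01.
pose J (s : R) := mean (fun xi : Rd => kappa (B * S (xi - 0) ^+ 2 / del ^+ 2) * kappa (s ^+ 2 * (B * S (xi - 0) ^+ 2))).
have bJ s : bndf (fun xi : Rd => kappa (B * S (xi - 0) ^+ 2 / del ^+ 2) * kappa (s ^+ 2 * (B * S (xi - 0) ^+ 2))).
  by exists 1 => xi; have /andP[? ?] := kappa_mul01 (B * S (xi - 0) ^+ 2 / del ^+ 2) (s ^+ 2 * (B * S (xi - 0) ^+ 2)); rewrite ger0_norm.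
exists (J 1).
  have [r r0 Hr] := abs_continuous_small (e := Num.min tau b / 2) ltac:(by rewrite divr_gt0// lt_min t0).
  apply: lt_le_trans (mean_ball_pos d r0) _; apply: mean_le => //; last first.
    by exists 1 => xi; case: (`|xi| <= r); rewrite ?normr1 ?normr0.
  move=> xi; have [xr|xr] := leP `|xi| r; last first.
    by case/andP: (kappa_mul01 (B * S (xi - 0) ^+ 2 / del ^+ 2) (1 ^+ 2 * (B * S (xi - 0) ^+ 2))).
  have := Hr _ xr; rewrite subr0 => H.
  have S2 : S xi ^+ 2 <= (Num.min tau b / 2) ^+ 2.
    by rewrite -real_normK ?num_real// lerXn2r ?nnegrE//; apply: le_trans H.
  have m0 : 0 <= Num.min tau b by rewrite le_min !ltW.
  have m1 : Num.min tau b <= tau by rewrite ge_min lexx.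
  have m2 : Num.min tau b <= b by rewrite ge_min lexx orbT.
  rewrite !kappa1 ?mul1r//.
    rewrite expr1n mul1r /B mulrAC ler_pdivrMr ?exprn_gt0//; nra.
  rewrite ler_pdivrMr// mul1r /B /del expr_div_n mulrAC ler_pM2r ?invr_gt0 ?exprn_gt0//; nra.
move=> s s1; have s0 : 0 < s by lra.
rewrite mulrC; apply: le_trans (lo s s1) _; apply: mean_le => //; last first.
  by exists 1 => xi; case: (_ && _); rewrite ?normr1 ?normr0.
move=> xi; rewrite subr0.
have [z1|z1] := leP `|xi| 2^-1; last first.
  rewrite kappa0 ?mul0r// leNgt ltr_pdivrMr//; apply/negP => /sub; lra.
have [z2|z2] := leP `|S xi| (b / s); last first.
  rewrite (@kappa0 _ (s ^+ 2 * _)) ?mulr0//.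
  have : 1 <= `|S xi| / (b / s) by rewrite ler_pdivlMr ?divr_gt0// mul1r ltW.
  move=> H; rewrite (_ : s ^+ 2 * _ = 2 * (`|S xi| / (b / s)) ^+ 2); last first.
    rewrite /B -[S xi ^+ 2]real_normK ?num_real//; field; rewrite !gt_eqF//.
  by rewrite ler_peMr// exprn_ege1.
by case/andP: (kappa_mul01 (B * S xi ^+ 2 / del ^+ 2) (s ^+ 2 * (B * S xi ^+ 2))).
Qed.

End HomogeneousVolume.

(** * Linear phases *)

Section DotProducts.
Variables (R : realType) (d : nat).
Notation Rd := 'rV[R]_d.
Notation C := R[i].

Lemma dotZRE (x : 'rV[int]_d) (z : Rd) : dotZR x z = dotR (zR R x) z.
Proof. by apply: eq_bigr => i _; rewrite mxE. Qed.
Lemma dotRDl (a b z : Rd) : dotR (a + b) z = dotR a z + dotR b z.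
Proof. by rewrite -big_split; apply: eq_bigr => i _; rewrite mxE mulrDl. Qed.
Lemma dotRZl (k : R) (a z : Rd) : dotR (k *: a) z = k * dotR a z.
Proof. by rewrite mulr_sumr; apply: eq_bigr => i _; rewrite mxE mulrA. Qed.
Lemma dotRZr (k : R) (a z : Rd) : dotR a (k *: z) = k * dotR a z.
Proof. by rewrite mulr_sumr; apply: eq_bigr => i _; rewrite mxE mulrCA. Qed.
Lemma dotR0 (a : Rd) : dotR a 0 = 0.
Proof. by apply: big1 => i _; rewrite mxE mulr0. Qed.
Lemma dotR_mulmx (a z : Rd) (A : 'M[R]_d) : dotR a (z *m A^T) = dotR (a *m A) z.
Proof.
have dotE (u v : Rd) : dotR u v = (u *m v^T) 0 0 by rewrite mxE; apply: eq_bigr => i _; rewrite mxE.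
by rewrite !dotE trmx_mul trmxK mulmxA.
Qed.
Lemma normr_dotR (a z : Rd) : `|dotR a z| <= d%:R * `|a| * `|z|.
Proof.
apply: le_trans (ler_norm_sum _ _ _) _.
rewrite -mulrA -[d in d%:R]card_ord mulr_natl -sumr_const; apply: ler_sum => l _.
by rewrite normrM ler_pM// normr_coord.
Qed.
Lemma normr_mulmx (z : Rd) (A : 'M[R]_d) : `|z *m A^T| <= d%:R * `|A| * `|z|.
Proof.
apply: normr_rV_le => [|j]; first by rewrite !mulr_ge0.
rewrite mxE; apply: le_trans (ler_norm_sum _ _ _) _.
rewrite -mulrA -[d in d%:R]card_ord mulr_natl -sumr_const; apply: ler_sum => l _.
by rewrite normrM mulrC ler_pM// ?normr_coord// mxE normr_entry.
Qed.
Lemma dir_dotR (a z : Rd) : dir z (fun i => (a 0 i)%:C%C) = (dotR a z)%:C%C.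
Proof.
by rewrite real_complex_sum; apply: eq_bigr => i _; rewrite real_complexM mulrC.
Qed.

Lemma D2_dotR (a : Rd) (r : R) :
  D2 [set z : Rd | `|z| <= r] (fun z => (dotR a z)%:C%C) (fun _ i => (a 0 i)%:C%C).
Proof.
have H := D2_sum (index_enum 'I_d) (F := fun i z => (a 0 i)%:C%C * (z 0 i)%:C%C : C)
  (fun i => D2_scale ((a 0 i)%:C%C) (@D2_coord R d [set z | `|z| <= r] i ltac:(by exists r))).
apply: D2_eq H => [z|z _ i] /=.
  by rewrite real_complex_sum; apply: eq_bigr => i _; rewrite real_complexM.
by rewrite (bigD1 i)//= eqxx mulr1 big1 ?addr0// => j /negbTE ->; rewrite mulr0.
Qed.

Lemma D2_expi B (u : Rd -> R) u' : D2 B (fun z => (u z)%:C%C) (fun z i => (u' z i)%:C%C) ->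
  D2 B (fun z => expi (u z)) (fun z i => 'i%C * (u' z i)%:C%C * expi (u z)).
Proof.
move=> Du.
have key (a v : R) : cabs (expi (a + v) - expi a - 'i%C * v%:C%C * expi a) <= 2 * v ^+ 2.
  rewrite expiD (_ : _ - _ - _ = expi a * (expi v - 1 - 'i%C * v%:C%C)); last by ring.
  by rewrite cabsM cabs_expi mul1r expi_taylor2.
have Dc : D2 B (fun z => (cos (u z))%:C%C) (fun z i => (- sin (u z) * u' z i)%:C%C).
  apply: (D2_comp (G := @cos R) (G' := fun t => - sin t) (K := 2) (e := 1) _ _ _ Du) => // z _; split.
  - by apply: le_trans (_ : 1 <= 2); [exact: cos_max|lra].
  - by rewrite normrN; apply: le_trans (_ : 1 <= 2); [exact: sin_max|lra].
  move=> v _; apply: le_trans (key (u z) v); apply: le_trans (Re_le_cabs _).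
  rewrite [X in _ <= `|X|](_ : _ = cos (u z + v) - cos (u z) - v * - sin (u z)) //.
  by rewrite !ReD !ReN !ReM !ImM /=; ring.
have Ds : D2 B (fun z => (sin (u z))%:C%C) (fun z i => (cos (u z) * u' z i)%:C%C).
  apply: (D2_comp (G := @sin R) (G' := @cos R) (K := 2) (e := 1) _ _ _ Du) => // z _; split.
  - by apply: le_trans (_ : 1 <= 2); [exact: sin_max|lra].
  - by apply: le_trans (_ : 1 <= 2); [exact: cos_max|lra].
  move=> v _; apply: le_trans (key (u z) v); apply: le_trans (Im_le_cabs _).
  rewrite [X in _ <= `|X|](_ : _ = sin (u z + v) - sin (u z) - v * cos (u z)) //.
  by rewrite !ImD !ImN !ImM !ReM /=; ring.
apply: D2_eq (D2_add Dc (D2_scale 'i%C Ds)) => [z|z _ i].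
  by apply: complexRI; rewrite ?ReD ?ImD ?ReM ?ImM /=; ring.
by apply: complexRI; rewrite ?ReD ?ImD ?ReM ?ImM /= ?ReM ?ImM /=; ring.
Qed.

(* Near the origin [K |z|] is small; elsewhere [n S z] dominates it for large [n]. *)
Lemma annulus (S : Rd -> R) (K r : R) : 0 <= K -> 0 <= r -> (forall z, 0 <= S z) ->
  (forall r : R, 0 < r -> exists2 tau, 0 < tau & forall z, S z < tau -> `|z| <= r) ->
  exists N : nat, forall n z, (N <= n)%N -> `|z| <= r -> K * `|z| <= (1 + n%:R * S z) / 8.
Proof.
move=> K0 r0 S0 H.
have K1 : 0 < 8 * (K + 1) by rewrite mulr_gt0// ltr_wpDl.
have [tau t0 Ht] := H (8 * (K + 1))^-1 ltac:(by rewrite invr_gt0).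
exists (Num.truncn (8 * K * r / tau)).+1 => n z nN zr; have Sz := S0 z.
have [Sz1|Sz1] := ltP (S z) tau.
  have z1 := Ht _ Sz1; have h0 : 0 <= n%:R * S z by rewrite mulr_ge0.
  have : (8 * (K + 1)) * `|z| <= 1.
    by apply: le_trans (ler_wpM2l (ltW K1) z1) _; rewrite mulfV ?gt_eqF.
  have := normr_ge0 z; nra.
have n1 : 8 * K * r / tau <= n%:R.
  by apply: le_trans (ltW (truncnS_gt _)) _; rewrite ler_nat.
move: n1; rewrite ler_pdivrMr// => n1.
have n2 : n%:R * tau <= n%:R * S z by rewrite ler_wpM2l.
have : K * `|z| <= K * r by rewrite ler_wpM2l.
lra.
Qed.

End DotProducts.

Lemma powR_sqr_half (R : realType) (q : R) : 0 <= q -> (q ^+ 2) `^ 2^-1 = q.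
Proof. by move=> q0; rewrite -powR_mulrn// -powRrM mulfV// powRr1. Qed.

Lemma powR_neg_le1 (R : realType) (u p : R) : 0 <= u -> 0 <= p -> (1 + u) `^ (- p) <= 1.
Proof.
move=> u0 p0; rewrite -[leRHS](_ : 1 `^ (- p) = 1); last by rewrite powR1.
by apply: powR_neg_le; lra.
Qed.

(** * The oscillatory estimate near a point of imaginary type *)

Section Oscillatory.
Variables (R : realType) (d : nat).
Notation Rd := 'rV[R]_d.
Notation C := R[i].
(** [F] will be the Fourier transform normalised at the point [c], [S] the polynomial Q, and [L] the
    logarithmic derivative of [F] along V. Thus Im L and V (Im L) are the first two V-derivatives of
    the phase of [F]; after removal of the drift both are close to - S. *)
Variables (E : 'M[R]_d) (c a : Rd) (F L : Rd -> C) (F' L' : Rd -> 'I_d -> C) (S : Rd -> R) (r0 CR : R).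
Hypotheses (c4 : `|c| <= 4 * pi) (r00 : 0 < r0) (r01 : r0 <= 1) (DF : D2 setT F F')
  (F1 : forall z, cabs (F z) <= 1) (DL : D2 [set z | `|z| <= r0] L L')
  (EF : forall z, `|z| <= r0 -> euler E F' z = F z * L z).
Hypotheses
  (phase : forall z, `|z| <= r0 -> `|complex.Im (L z) - dotR a (z *m E^T) + S z| <= `|S z| / 8)
  (phase' : forall z, `|z| <= r0 ->
     `|complex.Im (euler E L' z) - dotR a (z *m E^T *m E^T) + S z| <= `|S z| / 4)
  (damping : forall (n : nat) z, `|z| <= r0 -> n%:R * `|complex.Re (L z)| * cabs (F z) ^+ n <= CR).
Hypotheses
  (subS : forall r : R, 0 < r -> exists2 tau, 0 < tau & forall z, `|S z| < tau -> `|z| <= r)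
  (volS : exists r K : R, [/\ 0 < r, 0 <= K & forall s, 1 <= s ->
    mean (fun xi => (`|xi - c| <= r)%R%:R * (1 + s ^+ 2 * S (xi - c) ^+ 2) `^ (- 2^-1)) <= K * s `^ (- \tr E)]).

Lemma oscillatory_identity (f1 chi vchi w vw mu re : C) : 1 + 'i%C * w != 0 ->
  chi * (f1 * (1 + 'i%C * w)) =
   (vchi * f1 + chi * (f1 * (re + 'i%C * w - 'i%C * vw / (1 + 'i%C * w))) + mu * (chi * f1)) +
   (chi * (f1 * (1 - mu - re + 'i%C * vw / (1 + 'i%C * w))) - vchi * f1).
Proof. by move=> D0; field. Qed.

(* The weight [1 + i w] with [w] the derivative of the phase along the linear field turns the integrand into
   a divergence up to terms of size [1 / (1 + n |S|)]. *)
Lemma oscillatory_estimate : exists2 r : R, 0 < r & forall chi chi', D2 setT chi chi' ->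
  (forall z : Rd, chi z != 0 -> `|z| <= r) ->
  exists2 K : R, 0 <= K & forall M : R, exists N : nat, forall n x, (N <= n)%N ->
    `|zR R x - n%:R *: a| <= M ->
    cabs (cmean (fun xi => F (xi - c) ^+ n * expi (- dotZR x (xi - c)) * chi (xi - c))) <=
      K * n%:R `^ (- \tr E).
Proof.
have [rv [Kv [rv0 Kv0 HV]]] := volS.
pose r := Num.min rv (r0 / 2).
have r_0 : 0 < r by rewrite lt_min rv0 divr_gt0.
have r_v : r <= rv by rewrite ge_min lexx.
have r_r0 : r < r0.
  apply: (@le_lt_trans _ _ (r0 / 2)); first by rewrite /r ge_min lexx orbT.
  by rewrite ltr_pdivrMr// ltr_pMr// ltr1n.
exists r => // chi chi' Dchi schi.
have [K1 [K10 HK1]] := D2_bounded Dchi; have [K2 [K20 HK2]] := D2_bounded' Dchi.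
pose mu := \tr E.
pose KE : R := d%:R * K2 * (d%:R * `|E|).
have KE0 : 0 <= KE by rewrite !mulr_ge0.
have CR0 : 0 <= CR.
  by apply: le_trans (damping 0 (z := 0) _); rewrite ?normr0 ?(ltW r00)// !mulr_ge0 ?exprn_ge0 ?cabs_ge0.
(* With q = 1 + n |S|: 4 / q bounds |1 / D|, 8 bounds |V w / D|, [KE] bounds |V chi|, and [CR]
   controls the derivative of the modulus. *)
pose A : R := 4 * KE + K1 * (4 * (1 + `|mu| + 8) + 4 * CR).
have A0 : 0 <= A by rewrite addr_ge0 ?mulr_ge0 ?addr_ge0 ?mulr_ge0 ?addr_ge0.
exists (2 * (A * Kv)) => [|M]; first by rewrite !mulr_ge0.
(* The last factor makes one constant serve both y.(V z) and its second iterate y.(V V z). This is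
   the only place where [M] enters, and it affects only the threshold. *)
pose KM := d%:R * `|M| * (d%:R * `|E|) * (1 + d%:R * `|E|).
have KM0 : 0 <= KM by rewrite !mulr_ge0// addr_ge0// mulr_ge0.
have [N HN] := @annulus R d (fun z => `|S z|) KM r0 KM0 (ltW r00) (fun=> normr_ge0 _) subS.
exists N.+1 => n x nN yM.
have n1 : (1 : R) <= n%:R by rewrite ler1n; apply: leq_trans nN.
have n0 : (0 : R) <= n%:R by lra.
set y := zR R x - n%:R *: a in yM.
have Ex v : dotZR x v = dotR y v + n%:R * dotR a v.
  by rewrite dotZRE -dotRZl -dotRDl subrK.
have yE z : `|z| <= r0 -> `|dotR y (z *m E^T)| <= (1 + n%:R * `|S z|) / 8 /\
    `|dotR y (z *m E^T *m E^T)| <= (1 + n%:R * `|S z|) / 8.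
  move=> z0; have H := HN n z (ltnW nN) z0.
  have yM' : `|y| <= `|M| by rewrite (le_trans yM)// ler_norm.
  have dE : 0 <= d%:R * `|E| by rewrite mulr_ge0.
  have h1 : d%:R * `|y| <= d%:R * `|M| by rewrite ler_wpM2l.
  have h2 := normr_mulmx z E; have h3 := normr_mulmx (z *m E^T) E.
  have z_0 := normr_ge0 z; have e0 := normr_ge0 (z *m E^T).
  have dM : 0 <= d%:R * `|M| by rewrite mulr_ge0.
  split; apply: le_trans H; apply: le_trans (normr_dotR _ _) _.
    apply: (@le_trans _ _ (d%:R * `|M| * (d%:R * `|E| * `|z|))).
      by apply: ler_pM => //; rewrite mulr_ge0.
    rewrite /KM; set u := d%:R * `|E| in dE *; set v := d%:R * `|M| in dM *.
    rewrite (_ : v * u * _ * _ = v * (u * `|z|) + v * u * u * `|z|); last by ring.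
    by rewrite lerDl !mulr_ge0.
  apply: (@le_trans _ _ (d%:R * `|M| * (d%:R * `|E| * (d%:R * `|E| * `|z|)))).
    apply: ler_pM => //.
    by apply: le_trans h3 _; rewrite ler_wpM2l.
  rewrite /KM; set u := d%:R * `|E| in dE *; set v := d%:R * `|M| in dM *.
  rewrite (_ : v * u * _ * _ = v * (u * (u * `|z|)) + v * u * `|z|); last by ring.
  by rewrite lerDl !mulr_ge0.
(* The V-derivative of the phase of F^n exp(- i x.z). *)
pose w z := n%:R * complex.Im (L z) - dotZR x (z *m E^T).
pose b := zR R x *m E.
pose w' z i : R := n%:R * complex.Im (L' z i) - b 0 i.
have Dw : D2 [set z | `|z| <= r0] (fun z => (w z)%:C%C) (fun z i => (w' z i)%:C%C).
  apply: D2_eq (D2_add (D2_scale (n%:R : R)%:C%C (D2_Im DL)) (D2_opp (D2_dotR b r0))) => [z|z _ i].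
    by rewrite /w dotZRE dotR_mulmx real_complexD real_complexN real_complexM.
  by rewrite /w' real_complexD real_complexN real_complexM.
pose vw z := n%:R * complex.Im (euler E L' z) - dotZR x (z *m E^T *m E^T).
have Evw z : euler E (fun z i => (w' z i)%:C%C) z = (vw z)%:C%C.
  rewrite /euler (@dir_eq _ _ _ _ (fun i => (n%:R : R)%:C%C * (complex.Im (L' z i))%:C%C + - (b 0 i)%:C%C)); last first.
    by move=> i; rewrite /w' real_complexD real_complexN real_complexM.
  rewrite dirDr dirNr dirMr -Im_dir dir_dotR -dotR_mulmx -dotZRE.
  by rewrite /vw real_complexD real_complexN real_complexM.
pose D z : C := 1 + 'i%C * (w z)%:C%C.
have ReD1 z : complex.Re (D z) = 1 by rewrite /D ReD ReM /=; ring.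
have ImD1 z : complex.Im (D z) = w z by rewrite /D ImD ImM /=; ring.
have D1 z : 1 <= cabs (D z) by have := Re_le_cabs (D z); rewrite ReD1 normr1.
have Dw1 z : `|w z| <= cabs (D z) by have := Im_le_cabs (D z); rewrite ImD1.
have D0 z : D z != 0 by apply/eqP => h; have := D1 z; rewrite h cabs0; lra.
have DS z : `|z| <= r0 -> (1 + n%:R * `|S z|) / 4 <= cabs (D z).
  move=> z0; have [h1 _] := yE _ z0; have h2 := phase z0.
  have : n%:R * `|S z| - n%:R * (`|S z| / 8) - (1 + n%:R * `|S z|) / 8 <= `|w z|.
    rewrite (_ : w z = n%:R * (complex.Im (L z) - dotR a (z *m E^T) + S z) - dotR y (z *m E^T) - n%:R * S z); last first.
      by rewrite /w Ex; ring.
    rewrite distrC; apply: le_trans (lerB_dist _ _); rewrite normrM ger0_norm//.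
    have := ler_normB (n%:R * (complex.Im (L z) - dotR a (z *m E^T) + S z)) (dotR y (z *m E^T)).
    rewrite normrM (ger0_norm n0).
    have := ler_wpM2l n0 h2; lra.
  have := D1 z; have := Dw1 z; have : 0 <= n%:R * `|S z| by rewrite mulr_ge0.
  lra.
have vwS z : `|z| <= r0 -> `|vw z| <= 2 * (1 + n%:R * `|S z|).
  move=> z0; have [_ h1] := yE _ z0; have h2 := phase' z0.
  rewrite (_ : vw z = n%:R * (complex.Im (euler E L' z) - dotR a (z *m E^T *m E^T) + S z) - n%:R * S z - dotR y (z *m E^T *m E^T)); last first.
    by rewrite /vw Ex; ring.
  apply: le_trans (ler_normB _ _) _.
  have := ler_normB (n%:R * (complex.Im (euler E L' z) - dotR a (z *m E^T *m E^T) + S z)) (n%:R * S z).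
  rewrite !normrM (ger0_norm n0).
  have := ler_wpM2l n0 h2; have : 0 <= n%:R * `|S z| by rewrite mulr_ge0.
  lra.
pose bx : Rd := - zR R x.
have Ebx v : dotR bx v = - dotZR x v.
  by rewrite dotZRE /bx -scaleN1r dotRZl mulN1r.
have De := D2_expi (D2_dotR bx r0).
have Di : D2 [set z | `|z| <= r0] D (fun z i => 'i%C * (w' z i)%:C%C).
  apply: D2_eq (D2_add (D2_const _ 1) (D2_scale 'i%C Dw)) => // z _ i.
  by rewrite add0r.
have DD := D2_inv ltr01 (fun z _ => D1 z) Di.
have DFn := D2_sub (@subsetT _ [set z : Rd | `|z| <= r0]) (D2_exp n DF).
have Df1 := D2_mul (D2_mul DFn De) DD.
have Df := D2_cut r_r0 Dchi schi Df1.
set f1 := fun xi : Rd => _ * (D xi)^-1 in Df1 Df.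
set f1' := fun (xi : Rd) (i : 'I_d) => _ + _ * (- _ * _) in Df1 Df.
have Ef1 z : `|z| <= r0 -> euler E f1' z =
    f1 z * ((n%:R * complex.Re (L z))%:C%C + 'i%C * (w z)%:C%C - 'i%C * (vw z)%:C%C / D z).
  move=> z0; rewrite /euler (@dir_eq _ _ _ _ (fun i =>
     (n%:R * F z ^+ n.-1 * expi (dotR bx z) * (D z)^-1) * F' z i +
     ((F z ^+ n * 'i%C * expi (dotR bx z) * (D z)^-1) * (bx 0 i)%:C%C +
      (- (F z ^+ n * expi (dotR bx z) * 'i%C * (D z)^-1 ^+ 2)) * (w' z i)%:C%C))); last by move=> i; rewrite /f1'; ring.
  rewrite !dirDr !dirMr -/(euler E F' z) -/(euler E (fun z i => (w' z i)%:C%C) z) Evw dir_dotR !Ebx.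
  pose lr := complex.Re (L z); pose li := complex.Im (L z).
  have -> : euler E F' z = F z * (lr%:C%C + 'i%C * li%:C%C).
    by rewrite EF//; congr (_ * _); apply: complexRI; rewrite ?ReD ?ImD ?ReM ?ImM /=; ring.
  rewrite /f1 Ebx /w -/lr -/li real_complexD real_complexN !real_complexM.
  have EFn : n%:R * F z ^+ n.-1 * F z = n%:R * F z ^+ n.
    by case: (n) => [|k]; rewrite ?mul0r//= exprSr mulrA.
  have En : (n%:R : R)%:C%C = n%:R :> C by rewrite -(rmorph_nat (real_complex R)).
  rewrite En; move: EFn (D0 z); move: (F z ^+ n.-1) (F z ^+ n) => q1 q2; move: (F z) (D z) => q3 q4 EFn q40.
  rewrite (_ : n%:R * q1 * _ / q4 * (q3 * _) = (n%:R * q1 * q3) * (expi (- dotZR x z) / q4 * (lr%:C%C + 'i%C * li%:C%C))); last by ring.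
  by rewrite EFn; field.
(* Needed so that the error term vanishes, and not merely its part containing [chi], outside the
   small ball. *)
have chi'0 z i : r < `|z| -> chi' z i = 0.
  move=> zr; apply: (@D2_grad0 R d setT chi chi' ((`|z| - r) / 2)) => //; first by lra.
  move=> h hh; apply/eqP; apply: contraTT isT => /schi.
  have := ler_normB (z + h) h; rewrite addrK; lra.
pose Err z : C := chi z * (f1 z * (1 - mu%:C%C - (n%:R * complex.Re (L z))%:C%C + 'i%C * (vw z)%:C%C / D z)) - euler E chi' z * f1 z.
pose f' := fun z i => chi' z i * f1 z + chi z * f1' z i.
(* The integrand is a divergence, whose mean vanishes, plus [Err]. *)
have key z : F z ^+ n * expi (- dotZR x z) * chi z =
    (euler E f' z + mu%:C%C * (chi z * f1 z)) + Err z.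
  have -> : F z ^+ n * expi (- dotZR x z) * chi z = chi z * (f1 z * D z).
    by rewrite /f1 Ebx divfK// mulrC.
  rewrite /f' /euler dirDr dirMl dirMr -!/(euler _ _ z).
  have [z0|z0] := leP `|z| r0.
    by rewrite Ef1// /Err /D; apply: oscillatory_identity; exact: D0.
  have chi0 : chi z = 0.
    by apply/eqP; apply: contraTT isT => /schi; lra.
  by rewrite /Err chi0; ring.
have ErrS z : cabs (Err z) <= A * ((`|z| <= rv)%R%:R * (1 + n%:R ^+ 2 * S z ^+ 2) `^ (- 2^-1)).
  have [z_r|z_r] := leP `|z| r; last first.
    have chi0 : chi z = 0 by apply/eqP; apply: contraTT isT => /schi; lra.
    rewrite /Err chi0 /euler /dir big1; last by move=> i _; rewrite chi'0// mulr0.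
    by rewrite !mul0r subrr cabs0 mulr_ge0// mulr_ge0// powR_ge0.
  have z0 : `|z| <= r0 by lra.
  have zv : `|z| <= rv by lra.
  rewrite zv mul1r.
  set q := 1 + n%:R * `|S z|.
  have q1 : 1 <= q by rewrite /q lerDl mulr_ge0.
  have f1q : cabs (f1 z) <= 4 * q^-1 * cabs (F z) ^+ n.
    rewrite /f1 !cabsM cabs_expi mulr1 cabsX cabsV mulrC ler_wpM2r ?exprn_ge0 ?cabs_ge0//.
    have := DS _ z0; rewrite -/q => h.
    rewrite -[4]invrK -invfM lef_pV2 ?posrE ?mulr_gt0//; [|lra..].
    by rewrite mulrC.
  have Fn1 : cabs (F z) ^+ n <= 1 by rewrite exprn_ile1 ?cabs_ge0.
  have Fn0 : 0 <= cabs (F z) ^+ n by rewrite exprn_ge0 ?cabs_ge0.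
  have qi : 0 < q^-1 by rewrite invr_gt0; lra.
  have f1q' : cabs (f1 z) <= 4 * q^-1.
    by apply: le_trans f1q _; rewrite ler_piMr// mulr_ge0// ltW.
  have re1 : cabs (f1 z) * `|n%:R * complex.Re (L z)| <= 4 * q^-1 * CR.
    apply: (@le_trans _ _ (4 * q^-1 * cabs (F z) ^+ n * `|n%:R * complex.Re (L z)|)).
      by rewrite ler_wpM2r.
    rewrite normrM (ger0_norm n0) -!mulrA ler_wpM2l// ler_wpM2l ?(ltW qi)// mulrC.
    exact: damping.
  have vwq : cabs ('i%C * (vw z)%:C%C / D z) <= 8.
    rewrite !cabsM cabsi mul1r cabs_real cabsV ler_pdivrMr; last by have := D1 z; lra.
    have := vwS _ z0; have := DS _ z0; rewrite -/q; lra.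
  have Vchi : cabs (euler E chi' z) <= KE.
    apply: le_trans (@cabs_dir _ _ _ _ K2 _) _; first by move=> i; exact: HK2.
    rewrite /KE ler_wpM2l ?mulr_ge0//; apply: le_trans (normr_mulmx _ _) _.
    have z1' : `|z| <= 1 by exact: le_trans z0 r01.
    by apply: ler_piMr => //; rewrite mulr_ge0.
  apply: (@le_trans _ _ (A * q^-1)).
    rewrite /Err; apply: le_trans (cabsB _ _) _.
    rewrite [cabs (chi z * _)]cabsM [cabs (f1 z * _)]cabsM [cabs (euler _ _ _ * _)]cabsM.
    have p0 := cabs_ge0 (f1 z); have c1 := HK1 z I; have c0 := cabs_ge0 (chi z).
    have p1 : cabs (f1 z) * cabs (1 - mu%:C%C - (n%:R * complex.Re (L z))%:C%C + 'i%C * (vw z)%:C%C / D z) <=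
       4 * q^-1 * (1 + `|mu| + 8) + 4 * q^-1 * CR.
      apply: (@le_trans _ _ (cabs (f1 z) * (1 + `|mu| + 8) + cabs (f1 z) * `|n%:R * complex.Re (L z)|)); last first.
        by apply: lerD => //; rewrite ler_wpM2r// !addr_ge0.
      rewrite -mulrDr ler_wpM2l//; apply: le_trans (cabsD _ _) _.
      have := cabsB (1 - mu%:C%C) (n%:R * complex.Re (L z))%:C%C.
      have := cabsB 1 mu%:C%C; rewrite cabs1 !cabs_real; lra.
    have p2 : cabs (euler E chi' z) * cabs (f1 z) <= KE * (4 * q^-1) by apply: ler_pM; rewrite ?cabs_ge0.
    have p3 : cabs (chi z) * (cabs (f1 z) * cabs (1 - mu%:C%C - (n%:R * complex.Re (L z))%:C%C + 'i%C * (vw z)%:C%C / D z)) <= K1 * (4 * q^-1 * (1 + `|mu| + 8) + 4 * q^-1 * CR).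
      by apply: ler_pM => //; rewrite mulr_ge0 ?cabs_ge0.
    apply: le_trans (lerD p3 p2) _; rewrite le_eqVlt; apply/orP; left; apply/eqP.
    by rewrite /A; ring.
  (* Since (1 + n^2 S^2)^(1/2) <= 1 + n |S|, the volume hypothesis with exponent 1/2 and s = n takes
     over. *)
  rewrite ler_wpM2l// powRN lef_pV2 ?posrE ?powR_gt0//; last first.
  - by rewrite ltr_wpDr// mulr_ge0 ?sqr_ge0.
  - by lra.
  rewrite -(powR_sqr_half (le_trans ler01 q1)).
  apply: ge0_ler_powR; rewrite ?nnegrE ?sqr_ge0//.
    by apply: addr_ge0 => //; apply: mulr_ge0; exact: sqr_ge0.
  rewrite /q -[S z ^+ 2]real_normK ?num_real//.
  have : 0 <= n%:R * `|S z| by rewrite mulr_ge0.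
  nra.
have bE : bndf (fun xi => (`|xi - c| <= rv)%R%:R * (1 + n%:R ^+ 2 * S (xi - c) ^+ 2) `^ (- 2^-1)).
  exists 1 => xi; have e0 : 0 <= n%:R ^+ 2 * S (xi - c) ^+ 2 by rewrite mulr_ge0 ?sqr_ge0.
  rewrite normrM [X in _ * X]ger0_norm ?powR_ge0// normr_nat.
  have -> : (1 : R) = 1 * 1 by rewrite mulr1.
  apply: ler_pM; rewrite ?powR_ge0 ?ler0n// ?mulr1; first by case: (_ <= rv); rewrite ?lexx ?ler01.
  by apply: powR_neg_le1.
have bErr : bndc (fun xi => Err (xi - c)).
  by apply: bndc_le (bndf_Z A bE) => xi; exact: ErrS.
rewrite (_ : (fun xi => _) = (fun xi => (euler E f' (xi - c) + mu%:C%C * (chi (xi - c) * f1 (xi - c))) + Err (xi - c))); last first.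
  by apply/funext => xi; rewrite key.
have z1 z : chi z * f1 z != 0 -> `|z| <= 1.
  rewrite mulf_eq0 negb_or => /andP[/schi h _].
  exact: le_trans h (le_trans (ltW r_r0) r01).
have b1 : bndc (fun xi => euler E f' (xi - c) + mu%:C%C * (chi (xi - c) * f1 (xi - c))).
  rewrite (_ : (fun xi => _) = (fun xi => F (xi - c) ^+ n * expi (- dotZR x (xi - c)) * chi (xi - c) - Err (xi - c))); last first.
    by apply/funext => xi; rewrite key addrK.
  have [KA HA] := bErr; exists (K1 + KA) => xi; apply: le_trans (cabsB _ _) _; apply: lerD => //.
  rewrite !cabsM cabs_expi mulr1 -[leRHS]mul1r; apply: ler_pM; rewrite ?cabs_ge0//; last exact: HK1.
  by rewrite cabsX exprn_ile1 ?cabs_ge0.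
have dv : cmean (fun xi => euler E f' (xi - c) + mu%:C%C * (chi (xi - c) * f1 (xi - c))) = 0.
  exact: (cmean_divergence E (f := fun z => chi z * f1 z) (f' := f') Df z1 c4).
rewrite (cmeanD b1 bErr) dv add0r.
apply: le_trans (cmean_le _ (bndf_Z A bE)) _; first by move=> xi; exact: ErrS.
rewrite (meanZ A bE) -!mulrA ler_wpM2l// ler_wpM2l//.
exact: HV.
Qed.

End Oscillatory.

(** * Derivatives of modulus and phase along orbits *)

Section Phase.
Variables (R : realType) (d : nat).
Notation Rd := 'rV[R]_d.
Notation C := R[i].

Lemma is_deriveMr (f g : R -> R) (t a b : R) : is_derive t 1 f a -> is_derive t 1 g b ->
  is_derive t 1 (fun s => f s * g s) (a * g t + f t * b).
Proof.
move=> df dg; have := is_deriveM df dg.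
by rewrite /GRing.scale /= addrC [g t * a]mulrC.
Qed.
Lemma is_deriveDr (f g : R -> R) (t a b : R) : is_derive t 1 f a -> is_derive t 1 g b ->
  is_derive t 1 (fun s => f s + g s) (a + b).
Proof. by move=> df dg; exact: is_deriveD. Qed.
Lemma is_deriveZr (k : R) (f : R -> R) (t a : R) : is_derive t 1 f a ->
  is_derive t 1 (fun s => k * f s) (k * a).
Proof. by move=> df; exact: is_deriveZ. Qed.
Lemma is_deriveVr (f : R -> R) (t a : R) : f t != 0 -> is_derive t 1 f a ->
  is_derive t 1 (fun s => (f s)^-1) (- (a / f t ^+ 2)).
Proof.
move=> f0 df; apply: (is_derive_eq (is_deriveV f0 df)).
by rewrite /GRing.scale /= mulNr mulrC.
Qed.

Lemma near_act (A : 'M[R]_d) (eta : Rd) (t r : R) : 0 < t -> `|act t A eta| < r ->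
  \forall s \near t, 0 < s /\ `|act s A eta| < r.
Proof.
move=> t0 tr; pose e := (r - `|act t A eta|) / 2.
have e0 : 0 < e by rewrite divr_gt0// subr_gt0.
have Hj j : \forall s \near t, `|act t A eta 0 j - act s A eta 0 j| <= e.
  have := is_derive_cont (is_derive_act A eta j t0).
  by move=> /(@cvgrPdist_le _ _ _ _ (nbhs_filter t) _ _)/(_ e e0).
have H1 : \forall s \near t, forall j, `|act t A eta 0 j - act s A eta 0 j| <= e.
  exact: (@filter_forall R 'I_d (fun j s => `|act t A eta 0 j - act s A eta 0 j| <= e) (nbhs t) (nbhs_filter t) Hj).
have H2 : \forall s \near t, 0 < s by exact: lt_nbhsr.
near=> s; split; first by near: s.
have Hs : forall j, `|act t A eta 0 j - act s A eta 0 j| <= e by near: s.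
have h : `|act s A eta - act t A eta| <= e.
  rewrite distrC; apply: normr_rV_le => [|j]; first exact: ltW.
  by move: (Hs j); move: (act t A eta) (act s A eta) => u v; rewrite !mxE.
rewrite -(subrK (act t A eta) (act s A eta)); apply: le_lt_trans (ler_normD _ _) _.
apply: (@le_lt_trans _ _ (e + `|act t A eta|)); first by rewrite lerD2r.
by rewrite /e; lra.
Unshelve. all: by end_near.
Qed.

(* Both functions are recovered from the curve [Hr + i Hi] by [ln] and [atan], so they are differentiable
   although no regularity of [rho] and [Phi] is assumed. *)
Lemma is_derive_polar (Hr Hi : R -> R) (t lr li : R) (rho Phi : R -> R) :
  is_derive t 1 Hr (Hr t * lr - Hi t * li) -> is_derive t 1 Hi (Hr t * li + Hi t * lr) ->
  (\forall s \near t, [/\ Hr s = expR (- rho s) * cos (Phi s), Hi s = expR (- rho s) * sin (Phi s) & `|Phi s| <= 2^-1]) ->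
  is_derive t 1 rho (- lr) /\ is_derive t 1 Phi li.
Proof.
move=> dr di Hn.
have dom s : `|Phi s| <= 2^-1 -> - (pi / 2) < Phi s < pi / 2.
  by rewrite ler_norml => /andP[h1 h2]; have := pihalf_ge1 R; lra.
have cos0 s : `|Phi s| <= 2^-1 -> 0 < cos (Phi s) by move=> /dom; exact: cos_gt0_pihalf.
have [Er Ei Phit] := nbhs_singleton Hn.
have Hr0 : 0 < Hr t by rewrite Er mulr_gt0 ?expR_gt0 ?cos0.
have N0 : 0 < Hr t * Hr t + Hi t * Hi t.
  by rewrite ltr_pwDl ?mulr_gt0// -expr2 sqr_ge0.
have dN : is_derive t 1 (fun s => Hr s * Hr s + Hi s * Hi s) (2 * lr * (Hr t * Hr t + Hi t * Hi t)).
  by apply: is_derive_eq (is_deriveDr (is_deriveMr dr dr) (is_deriveMr di di)) _; ring.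
split.
  have d1 : is_derive t 1 (fun s => - 2^-1 * ln (Hr s * Hr s + Hi s * Hi s)) (- lr).
    apply: is_derive_eq (is_deriveZr (- 2^-1) (is_derive1_comp (f := @ln R) (g := fun s => Hr s * Hr s + Hi s * Hi s) (is_derive1_ln N0) dN)) _.
    by field; rewrite gt_eqF.
  apply: near_eq_is_derive d1; apply: filterS Hn => s [-> -> _].
  rewrite (_ : _ + _ = expR (- rho s) ^+ 2 * (cos (Phi s) ^+ 2 + sin (Phi s) ^+ 2)); last by ring.
  by rewrite cos2Dsin2 mulr1 lnXn ?expR_gt0// expRK; field.
have d2 : is_derive t 1 (fun s => Hi s * (Hr s)^-1) (li * (1 + (Hi t * (Hr t)^-1) ^+ 2)).
  apply: is_derive_eq (is_deriveMr di (is_deriveVr (lt0r_neq0 Hr0) dr)) _.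
  by field; rewrite gt_eqF.
have d3 : is_derive t 1 (fun s => atan (Hi s * (Hr s)^-1)) li.
  apply: is_derive_eq (is_derive1_comp (f := @atan R) (is_derive1_atan _) d2) _.
  by rewrite mulrCA mulVf ?mulr1// gt_eqF// ltr_wpDr// sqr_ge0.
apply: near_eq_is_derive d3; apply: filterS Hn => s [-> -> Ps].
rewrite (_ : _ * _ = tan (Phi s)); first by rewrite tanK// in_itv /= dom.
by rewrite /tan; field; rewrite !gt_eqF ?expR_gt0 ?cos0.
Qed.

Variables (A : 'M[R]_d) (F : Rd -> C) (F' : Rd -> 'I_d -> C) (rho Phi : Rd -> R) (r : R).
Hypotheses (DF : D2 setT F F')
  (EF : forall z, `|z| < r -> F z = (expR (- rho z))%:C%C * expi (Phi z))
  (Phi_small : forall z, `|z| < r -> `|Phi z| <= 2^-1).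

(** Along an orbit [F] is a plane curve whose phase stays within 1/2, so no branch of the argument
    is crossed and the real and imaginary parts of V F / F are the derivatives of - rho and Phi, up
    to the factor 1/t. *)
Lemma is_derive_log (eta : Rd) (t : R) (l : C) : 0 < t -> `|act t A eta| < r ->
  euler A F' (act t A eta) = F (act t A eta) * l ->
  is_derive t 1 (fun s => rho (act s A eta)) (- (t^-1 * complex.Re l)) /\
  is_derive t 1 (fun s => Phi (act s A eta)) (t^-1 * complex.Im l).
Proof.
move=> t0 tr El; have [d1 d2] := is_derive_act_D2 (E := A) (eta := eta) t0 DF I.
apply: (is_derive_polar (Hr := fun s => complex.Re (F (act s A eta))) (Hi := fun s => complex.Im (F (act s A eta)))).
- by move: d1; rewrite El ReM; congr (is_derive _ _ _ _); ring.
- by move: d2; rewrite El ImM; congr (is_derive _ _ _ _); ring.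
apply: filterS (near_act t0 tr) => s [s0 sr]; rewrite EF// ReM ImM /=; split; [ring|ring|exact: Phi_small].
Qed.

End Phase.

(** * Euler derivatives in place of iterated ordinary ones *)

Section StrongSubhomogeneity.
Variable R : realType.

Lemma derive1n_first (q : R -> R) (t v : R) : is_derive t 1 q v -> derive1n 1 q t = v.
Proof. by move=> H; rewrite /derive1n /= derive1E derive_val. Qed.

(** With V = t d/dt one has t^2 d^2/dt^2 = V V - V; here m = V q and v = V m. *)
Lemma derive1n_second (q m : R -> R) (t v : R) : 0 < t ->
  (\forall s \near t, is_derive (s : R) 1 q (s^-1 * m s)) -> is_derive t 1 m (t^-1 * v) ->
  t ^+ 2 * derive1n 2 q t = v - m t.
Proof.
move=> t0 dq dm; rewrite /derive1n /= derive1E.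
have d1 : is_derive t 1 (fun s => s^-1 * m s) (t^-1 * (t^-1 * v) + m t * - t ^- 2).
  apply: is_derive_eq (is_deriveMr (is_deriveVr (lt0r_neq0 t0) (is_derive_id t 1)) dm) _.
  by field; rewrite gt_eqF.
have d2 : is_derive t 1 (derive1 q) (t^-1 * (t^-1 * v) + m t * - t ^- 2).
  apply: near_eq_is_derive d1; apply: filterS dq => s ds.
  by rewrite derive1E derive_val.
by rewrite derive_val; field; rewrite gt_eqF.
Qed.

End StrongSubhomogeneity.

Lemma expR_half_bound (R : realType) (x : R) : x * expR (- (x / 2)) <= 2.
Proof.
have h : x / 2 <= expR (x / 2) by have := expR_ge1Dx (x / 2); lra.
rewrite expRN ler_pdivrMr ?expR_gt0//; lra.
Qed.

(** * Points of imaginary type: phase and damping bounds, and coherence *)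

Section ImaginaryType.
Variables (R : realType) (d : nat).
Notation Rd := 'rV[R]_d.
Notation C := R[i].
Variables (E : 'M[R]_d) (a : Rd) (F : Rd -> C) (F' : Rd -> 'I_d -> C) (Q Qt Rr Rt : Rd -> R) (k r1 : R).
Hypotheses (DF : D2 setT F F') (DF' : forall i, isD2 setT (fun z => F' z i)).
Hypotheses (r10 : 0 < r1) (EF : forall z, `|z| <= r1 ->
  F z = (expR (- (Rr z + Rt z)))%:C%C * expi (dotR a z - (Q z + Qt z))).
Hypotheses (Qt0 : Qt 0 = 0) (Rt0 : Rt 0 = 0) (pQ : poly_nolin Q) (pR : poly_nolin Rr)
  (hQ : pos_homogeneous (fun z => `|Q z|)) (hR : pos_homogeneous Rr)
  (QE : homogeneous (fun z => `|Q z|) E) (k1 : 1 < k) (RE : homogeneous Rr (k^-1 *: E))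
  (sQ : strongly_subhomogeneous Qt E 2) (sR : strongly_subhomogeneous Rt (k^-1 *: E) 1).

Let k0 : 0 < k. Proof. exact: lt_trans ltr01 k1. Qed.
Let Rr0 z : 0 <= Rr z. Proof. by have [_ h _ _ _] := hR. Qed.
Let hR' : pos_homogeneous (fun z => `|Rr z|).
Proof. by rewrite (_ : (fun z => _) = Rr)//; apply/funext => z; rewrite ger0_norm. Qed.

(* Only [|Q|] is assumed homogeneous, so Euler's identity is obtained from [Q ^ 2]. *)
Lemma euler_imag Q' z : D2 [set z | `|z| <= 1] (fun z => (Q z)%:C%C) Q' -> `|z| <= 1 -> Q z != 0 ->
  euler E Q' z = (Q z)%:C%C.
Proof.
move=> DQ z1 Qz; have DQ2 : D2 [set z | `|z| <= 1] (fun z => (Q z ^+ 2)%:C%C) (fun z i => Q' z i * (Q z)%:C%C + (Q z)%:C%C * Q' z i).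
  by apply: D2_eq (D2_mul DQ DQ) => // xi; rewrite -real_complexM -expr2.
have := euler_homogeneous DQ2 z1 (homogeneous_sqr QE).
rewrite eulerZ /euler dirDr dirMl dirMr -/(euler E Q' z) expr2 real_complexM => H.
have Qz' : (Q z)%:C%C != 0 :> C by apply: contra Qz => /eqP/(congr1 (@complex.Re R)) /= ->.
apply: (mulfI Qz'); rewrite -H.
have -> : (2^-1 : R)%:C%C = 2^-1 :> C by rewrite fmorphV /= rmorph_nat.
by field.
Qed.

(** Orbits of E / k are parametrised by the value of [Rr]: strong subhomogeneity at time Rr z over
    the compact set Rr = 1 gives smallness relative to Rr z. The factor k appears because [Rr] has
    weight k under E. *)
Let subR (e : R) : 0 < e -> exists2 r : R, 0 < r & forall z, `|z| <= r ->
  (`|Rt z| <= e * Rr z) /\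
  (forall (r : R) (l : C), `|z| < r -> r <= r1 -> (forall w, `|w| < r -> `|dotR a w - (Q w + Qt w)| <= 2^-1) ->
     euler E F' z = F z * l -> `|complex.Re l + k * Rr z| <= k * e * Rr z).
Proof.
move=> e0; have [_ _ _ _ cR] := hR; have [_ /(_ e e0 _ cR)[tau t0 Ht]] := sR.
have [r r0 Hr] := abs_continuous_small pR hR' (e := tau / 2) ltac:(by rewrite divr_gt0).
exists r => // z zr; have := Hr z zr; rewrite ger0_norm// => Rz.
have [z0|Rz0] := eqVneq (Rr z) 0.
  have -> : z = 0 by have [_ _ h _ _] := hR; exact: h.
  rewrite Rt0 (poly_nolin0 pR) normr0 !mulr0; split => // r' l _ _ _; rewrite addr0.
  rewrite /euler mul0mx dir0l EF ?normr0 ?(ltW r10)// dotR0 Qt0 Rt0 !(poly_nolin0 pQ) (poly_nolin0 pR).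
  by rewrite !addr0 subr0 oppr0 expR0 expi0 !mul1r => <-; rewrite normr0.
have Rzp : 0 < Rr z by rewrite lt0r Rz0 Rr0.
have [eta Re Ez] := normal_form RE Rzp.
have tt : 0 < Rr z < tau by rewrite Rzp; lra.
have H0 := Ht 0%N _ _ isT tt Re; have H1 := Ht 1%N _ _ isT tt Re.
rewrite expr0 mul1r /derive1n /= -Ez in H0; split => // r' l zr1 r'r1 Phi1 El.
have El' : euler (k^-1 *: E) F' (act (Rr z) (k^-1 *: E) eta) = F (act (Rr z) (k^-1 *: E) eta) * ((k^-1)%:C%C * l).
  by rewrite -Ez eulerZ El; ring.
have EF1 w : `|w| < r' -> F w = (expR (- (Rr w + Rt w)))%:C%C * expi (dotR a w - (Q w + Qt w)).
  by move=> h; apply: EF; apply: le_trans (ltW h) r'r1.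
have zr1' : `|act (Rr z) (k^-1 *: E) eta| < r' by rewrite -Ez.
have [d1 _] := is_derive_log (A := k^-1 *: E) (rho := fun w => Rr w + Rt w) (Phi := fun w => dotR a w - (Q w + Qt w)) DF EF1 Phi1 Rzp zr1' El'.
(* On this orbit [Rr] equals the time s, so subtracting 1 from the derivative of Rr + Rt isolates
   that of [Rt]. *)
have d2 : is_derive (Rr z) 1 (fun s => Rt (act s (k^-1 *: E) eta)) (- ((Rr z)^-1 * (k^-1 * complex.Re l)) - 1).
  have dm : is_derive (Rr z) 1 (fun s : R => - 1 * s) (- 1 * 1) by exact: is_deriveZr.
  have := is_deriveDr d1 dm; rewrite Re_realM mulr1 => d3.
  apply: near_eq_is_derive d3; near=> s.
  rewrite RE ?Re; last by near: s; exact: lt_nbhsr.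
  ring.
rewrite (derive1n_first d2) expr1 in H1.
rewrite (_ : complex.Re l + k * Rr z = - (k * (Rr z * (- ((Rr z)^-1 * (k^-1 * complex.Re l)) - 1)))); last first.
  by field; rewrite !gt_eqF.
by rewrite normrN normrM gtr0_norm// -mulrA ler_wpM2l// ltW.
Unshelve. all: by end_near.
Qed.

(** The same device with time |Q z| over the set |Q| = 1. Orders 0, 1 and 2 bound Qt, V Qt and V V
    Qt, the last two being expressed through Im L. *)
Let subQ (e : R) (L : Rd -> C) (L' : Rd -> 'I_d -> C) : 0 < e -> exists2 r : R, 0 < r & forall z, `|z| <= r ->
  (`|Qt z| <= e * `|Q z|) /\
  (forall r : R, `|z| < r -> r <= r1 -> r <= 1 -> (forall w, `|w| < r -> `|dotR a w - (Q w + Qt w)| <= 2^-1) ->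
     D2 [set w | `|w| <= r] L L' -> (forall w, `|w| <= r -> euler E F' w = F w * L w) ->
     `|complex.Im (L z) - dotR a (z *m E^T) + Q z| <= e * `|Q z| /\
     `|complex.Im (euler E L' z) - dotR a (z *m E^T *m E^T) + Q z| <= 2 * e * `|Q z|).
Proof.
move=> e0; have [_ _ _ _ cQ] := hQ; have [_ /(_ e e0 _ cQ)[tau t0 Ht]] := sQ.
have [r r0 Hr] := abs_continuous_small pQ hQ (e := tau / 2) ltac:(by rewrite divr_gt0).
exists r => // z zr; have Qz := Hr z zr.
have [z0|Qz0] := eqVneq (`|Q z|) 0.
  have -> : z = 0 by have [_ _ h _ _] := hQ; exact: h.
  rewrite Qt0 (poly_nolin0 pQ) normr0 !mulr0; split => // r' zr' r'1 _ _ _ EL; rewrite !addr0.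
  have := EL 0; rewrite normr0 => /(_ (le_trans (normr_ge0 _) (ltW zr'))).
  rewrite /euler !mul0mx !dir0l EF ?normr0 ?(ltW r10)// dotR0 Qt0 Rt0 !(poly_nolin0 pQ) (poly_nolin0 pR).
  by rewrite !addr0 !subr0 oppr0 expR0 expi0 !mul1r => <-; rewrite normr0.
have Qzp : 0 < `|Q z| by rewrite lt0r Qz0 normr_ge0.
have [eta Re Ez] := normal_form QE Qzp.
have tt : 0 < `|Q z| < tau by rewrite Qzp; lra.
have H0 := Ht 0%N _ _ isT tt Re; have H1 := Ht 1%N _ _ isT tt Re; have H2 := Ht 2%N _ _ isT tt Re.
rewrite expr0 mul1r /derive1n /= -Ez in H0; split => // r' zr' r'r1 r'1 Phi1 DL EL.
set t := `|Q z| in Qzp Ez tt H1 H2 *.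
have EF1 w : `|w| < r' -> F w = (expR (- (Rr w + Rt w)))%:C%C * expi (dotR a w - (Q w + Qt w)).
  by move=> h; apply: EF; apply: le_trans (ltW h) r'r1.
have [Q' DQ] := isD2_poly_nolin 1 pQ.
have Qact s : 0 < s -> `|Q (act s E eta)| = s by move=> s0; rewrite QE// Re mulr1.
have dQ (s : R) : 0 < s -> `|act s E eta| < r' ->
    is_derive s 1 (fun u => Q (act u E eta)) (s^-1 * Q (act s E eta)).
  move=> s0 sr; have s1 : `|act s E eta| <= 1 by apply: le_trans (ltW sr) r'1.
  have [+ _] := is_derive_act_D2 (E := E) (eta := eta) s0 DQ s1.
  by rewrite (euler_imag DQ s1) // -normr_gt0 Qact.
have dlin (b : Rd) (s : R) : 0 < s -> is_derive s 1 (fun u => dotR b (act u E eta)) (s^-1 * dotR b (act s E eta *m E^T)).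
  move=> s0; rewrite /dotR mulr_sumr; apply: is_derive_bigsum => i.
  by apply: is_derive_eq (is_deriveZr (b 0 i) (is_derive_act E eta i s0)) _; ring.
(* This is V Qt, obtained by solving Im L = V (a.z - Q - Qt) for the remainder. *)
pose m w := dotR a (w *m E^T) - Q w - complex.Im (L w).
have dq (s : R) : 0 < s -> `|act s E eta| < r' -> is_derive s 1 (fun u => Qt (act u E eta)) (s^-1 * m (act s E eta)).
  move=> s0 sr.
  have [_ d1] := is_derive_log (A := E) (rho := fun w => Rr w + Rt w) (Phi := fun w => dotR a w - (Q w + Qt w)) DF EF1 Phi1 s0 sr (EL _ (ltW sr)).
  have d2 := is_deriveDr (dlin a s s0) (is_deriveZr (-1) (is_deriveDr (dQ s s0 sr) d1)).
  rewrite (_ : (fun u => Qt (act u E eta)) = (fun u => dotR a (act u E eta) + -1 *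
       (Q (act u E eta) + (dotR a (act u E eta) - (Q (act u E eta) + Qt (act u E eta)))))); last by apply/funext => u; ring.
  by apply: is_derive_eq d2 _; rewrite /m; ring.
have tr' : `|act t E eta| < r' by rewrite -Ez.
have dm : is_derive t 1 (fun s => m (act s E eta)) (t^-1 * (dotR a (z *m E^T *m E^T) - Q z - complex.Im (euler E L' z))).
  have [_ d1] := is_derive_act_D2 (E := E) (eta := eta) Qzp DL (ltW tr').
  have d2 := dlin (a *m E) t Qzp.
  have d3 := is_deriveDr d2 (is_deriveZr (-1) (is_deriveDr (dQ t Qzp tr') d1)).
  rewrite (_ : (fun u => m (act u E eta)) = (fun u => dotR (a *m E) (act u E eta) + -1 *
       (Q (act u E eta) + complex.Im (L (act u E eta))))); last by apply/funext => u; rewrite /m dotR_mulmx; ring.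
  by apply: is_derive_eq d3 _; rewrite -dotR_mulmx -Ez; ring.
have H1' : `|m z| <= e * t.
  move: H1; rewrite (derive1n_first (dq t Qzp tr')) expr1 -Ez mulrA mulfV ?mul1r// gt_eqF//.
have H2' : `|dotR a (z *m E^T *m E^T) - Q z - complex.Im (euler E L' z) - m z| <= e * t.
  have dqn : \forall s \near t, is_derive (s : R) 1 (fun u => Qt (act u E eta)) (s^-1 * m (act s E eta)).
    by apply: filterS (near_act Qzp tr') => s [s0 sr]; exact: dq.
  by move: H2; rewrite (derive1n_second Qzp dqn dm) -Ez.
split.
  rewrite (_ : complex.Im (L z) - dotR a (z *m E^T) + Q z = - m z) ?normrN//.
  by rewrite /m; ring.
(* Order 2 controls V V Qt - V Qt; adding back V Qt accounts for the factor 2. *)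
rewrite (_ : complex.Im (euler E L' z) - dotR a (z *m E^T *m E^T) + Q z =
  - ((dotR a (z *m E^T *m E^T) - Q z - complex.Im (euler E L' z) - m z) + m z)); last by ring.
rewrite normrN; apply: le_trans (ler_normD _ _) _.
by rewrite (_ : 2 * e * t = e * t + e * t) ?lerD//; ring.
Qed.

Lemma isD2_sum (I : Type) (s : seq I) B (f : I -> Rd -> C) : (forall i, isD2 B (f i)) ->
  isD2 B (fun z => \sum_(i <- s) f i z).
Proof.
move=> H; have [f' Hf] := choice H; exists (fun z j => \sum_(i <- s) f' i z j).
exact: D2_sum.
Qed.

(** V F must itself be differentiable, since the oscillatory estimate differentiates [L] once
    more. *)
Lemma isD2_euler (A : 'M[R]_d) (r : R) : isD2 [set z | `|z| <= r] (fun z => euler A F' z).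
Proof.
apply: isD2_sum => i; apply: isD2_mul; last exact: isD2_sub (@subsetT _ _) (DF' i).
apply: (@isD2_eq _ _ _ (fun z => (dotR (row i A) z)%:C%C)).
  by move=> z; congr (_%:C)%C; rewrite mxE; apply: eq_bigr => j _; rewrite !mxE mulrC.
by exists (fun _ j => (row i A 0 j)%:C%C); exact: D2_dotR.
Qed.

Let small_ball : exists r : R, [/\ 0 < r, r <= 1, r <= r1 & forall z, `|z| <= r ->
  [/\ `|Rt z| <= 2^-1 * Rr z, `|Qt z| <= 8^-1 * `|Q z|, `|dotR a z - (Q z + Qt z)| <= 2^-1 & Rr z <= 4^-1]].
Proof.
have [r2 r20 H2] := subR (e := 2^-1) ltac:(by rewrite invr_gt0).
(* [L] is a dummy here: only the bound on [Qt] is extracted. *)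
have [r3 r30 H3] := subQ (e := 8^-1) (fun=> 0) (fun _ _ => 0) ltac:(by rewrite invr_gt0).
have [r4 r40 H4] := abs_continuous_small pQ hQ (e := 8^-1) ltac:(by rewrite invr_gt0).
have [r5 r50 H5] := abs_continuous_small pR hR' (e := 4^-1) ltac:(by rewrite invr_gt0).
have da : 0 < 8 * (d%:R * `|a| + 1) by rewrite mulr_gt0// ltr_wpDl// mulr_ge0.
pose r6 := (8 * (d%:R * `|a| + 1))^-1.
have r60 : 0 < r6 by rewrite invr_gt0.
exists (Num.min 1 (Num.min r1 (Num.min r2 (Num.min r3 (Num.min r4 (Num.min r5 r6)))))).
split.
- by rewrite !lt_min ltr01 r10 r20 r30 r40 r50 r60.
- by rewrite ge_min lexx.
- by rewrite !ge_min lexx orbT.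
move=> z; rewrite !le_min => /and5P[z1 z2 z3 z4 /and3P[z5 z6 z7]].
have [h2 _] := H2 z z3; have [h3 _] := H3 z z4; have h4 := H4 z z5; have := H5 z z6.
rewrite ger0_norm// => h5; split => //.
have h6 : `|dotR a z| <= 8^-1.
  apply: le_trans (normr_dotR _ _) _.
  apply: (@le_trans _ _ ((d%:R * `|a| + 1) * r6)); last first.
    by rewrite /r6 invfM mulrCA mulfV ?mulr1// gt_eqF// ltr_wpDl// mulr_ge0.
  by apply: ler_pM; rewrite ?mulr_ge0// lerDl.
apply: le_trans (ler_normB _ _) _; apply: le_trans (lerD h6 (ler_normD _ _)) _.
lra.
Qed.

Lemma imag_estimate (c : Rd) : `|c| <= 4 * pi -> \tr E < 1 -> (forall z, cabs (F z) <= 1) ->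
  exists2 r : R, 0 < r & forall chi chi', D2 setT chi chi' ->
  (forall z : Rd, chi z != 0 -> `|z| <= r) ->
  exists2 K : R, 0 <= K & forall M : R, exists N : nat, forall n x, (N <= n)%N ->
    `|zR R x - n%:R *: a| <= M ->
    cabs (cmean (fun xi => F (xi - c) ^+ n * expi (- dotZR x (xi - c)) * chi (xi - c))) <=
      K * n%:R `^ (- \tr E).
Proof.
move=> c4 trE F1; have [r2 [r20 r21 r2r1 H2]] := small_ball.
have EF2 z : `|z| <= r2 -> F z = (expR (- (Rr z + Rt z)))%:C%C * expi (dotR a z - (Q z + Qt z)).
  by move=> h; apply: EF; apply: le_trans h r2r1.
have cF z : `|z| <= r2 -> cabs (F z) = expR (- (Rr z + Rt z)).
  by move=> h; rewrite EF2// cabsM cabs_expi mulr1 cabs_real ger0_norm ?expR_ge0.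
have Fhalf z : `|z| <= r2 -> 2^-1 <= cabs (F z).
  move=> h; rewrite cF//; apply: le_trans (expR_ge1Dx _).
  have [h1 _ _ h2] := H2 z h; move: h1; rewrite ler_norml => /andP[_ h1]; have := Rr0 z; lra.
(* On this ball |F| >= 1/2, so the quotient is as regular as V F. *)
pose L z := euler E F' z * (F z)^-1.
have [L' DL] : isD2 [set z | `|z| <= r2] L.
  apply: isD2_mul; first exact: isD2_euler.
  exists (fun xi i => - (F' xi i) * (F xi)^-1 ^+ 2).
  by apply: (@D2_inv _ _ _ _ _ 2^-1) => //; exact: D2_sub (@subsetT _ _) DF.
have EL z : `|z| <= r2 -> euler E F' z = F z * L z.
  move=> h; rewrite /L mulrCA mulfV ?mulr1//; apply/eqP => F0.
  by have := Fhalf z h; rewrite F0 cabs0; lra.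
have Phi2 z : `|z| <= r2 -> `|dotR a z - (Q z + Qt z)| <= 2^-1 by move=> h; have [] := H2 z h.
have [r3 r30 H3] := subR (e := 2^-1) ltac:(by rewrite invr_gt0).
have [r4 r40 H4] := subQ (e := 8^-1) L L' ltac:(by rewrite invr_gt0).
pose r0 := Num.min (r2 / 2) (Num.min r3 r4).
have r00 : 0 < r0 by rewrite !lt_min r30 r40 divr_gt0.
have r0r2 : r0 < r2.
  apply: (@le_lt_trans _ _ (r2 / 2)); first by rewrite /r0 ge_min lexx.
  by rewrite ltr_pdivrMr// ltr_pMr// ltr1n.
have r03 : r0 <= r3 by rewrite /r0 !ge_min lexx orbT.
have r04 : r0 <= r4 by rewrite /r0 !ge_min lexx !orbT.
have cE : contracting E by case: sQ.
have ph z : `|z| <= r0 -> `|complex.Im (L z) - dotR a (z *m E^T) + Q z| <= 8^-1 * `|Q z| /\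
     `|complex.Im (euler E L' z) - dotR a (z *m E^T *m E^T) + Q z| <= 2 * 8^-1 * `|Q z|.
  move=> h; have [_ H] := H4 z (le_trans h r04); apply: (H r2) => //.
    exact: le_lt_trans h r0r2.
  by move=> w /ltW; exact: Phi2.
apply: (@oscillatory_estimate _ _ E c a F L F' L' Q r0 (4 * k) c4 r00 _ DF F1 _ _ _ _ _ (abs_sublevel hQ QE cE)
   (volume_bound pQ hQ QE cE c4 _ _)).
- exact: le_trans (ltW r0r2) r21.
- by apply: D2_sub DL => z /= h; apply: le_trans h (ltW r0r2).
- by move=> z h; apply: EL; apply: le_trans h (ltW r0r2).
- by move=> z /ph[h _]; lra.
- by move=> z /ph[_ h]; lra.
(* |Re L| <= 2 k Rr and |F|^n <= exp(- n Rr / 2); since x exp(- x / 2) <= 2, the product with n is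
   at most 4 k. *)
- move=> n z h; have z2 : `|z| <= r2 by apply: le_trans h (ltW r0r2).
  have [_ H] := H3 z (le_trans h r03).
  have {}H := H r2 (L z) (le_lt_trans h r0r2) r2r1 (fun w hw => Phi2 w (ltW hw)) (EL z z2).
  have [h1 _ _ _] := H2 z z2; have Rz := Rr0 z.
  have ReL : `|complex.Re (L z)| <= 2 * k * Rr z.
    rewrite -[complex.Re (L z)](addrK (k * Rr z)); apply: le_trans (ler_normB _ _) _.
    rewrite [`|k * _|]ger0_norm; last by rewrite mulr_ge0// ltW.
    have : 0 <= k * Rr z by rewrite mulr_ge0// ltW.
    lra.
  have Fn : cabs (F z) ^+ n <= expR (- (n%:R * Rr z / 2)).
    rewrite cF// -expRM_natl ler_expR mulrN lerN2 -mulrA ler_wpM2l//.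
    move: h1; rewrite ler_norml => /andP[h1 _]; lra.
  apply: (@le_trans _ _ (n%:R * (2 * k * Rr z) * expR (- (n%:R * Rr z / 2)))).
    by apply: ler_pM; rewrite ?mulr_ge0 ?exprn_ge0 ?cabs_ge0// ler_wpM2l.
  have := expR_half_bound (n%:R * Rr z) => h2.
  rewrite (_ : _ * _ = 2 * k * (n%:R * Rr z * expR (- (n%:R * Rr z / 2)))); last by ring.
  rewrite (_ : 4 * k = 2 * k * 2); last by ring.
  by rewrite ler_wpM2l// mulr_ge0// ltW.
- by rewrite invr_gt0.
(* The hypothesis tr E < 1 is the condition tr E < 2 p for the exponent p = 1/2. *)
- by rewrite mulfV.
Qed.

(* The scaling [z = act (1/n) E z'] brings the set [|Q| <= b/n] to unit size, uniformly in [n]. *)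
Lemma imag_coherent : exists2 b : R, 0 < b & forall n : nat, (0 < n)%N -> forall zeta eta,
  `|Q zeta| <= b / n%:R -> `|Q eta| <= b / n%:R ->
  2^-1 <= complex.Re (F (zeta - eta) ^+ n * expi (- (n%:R * dotR a (zeta - eta)))).
Proof.
have [r2 [r20 r21 r2r1 H2]] := small_ball.
have cE : contracting E by case: sQ.
have [tau t0 Ht] := abs_sublevel hQ QE cE r20.
(* The value 1/8 makes n |Q + Qt| and n (Rr + Rt) at most 1/4, so cosine and exponential are each at
   least 3/4, and 9/16 exceeds 1/2. *)
pose e := Num.min (tau / 2) 8^-1.
have e0 : 0 < e by rewrite /e lt_min; apply/andP; split; rewrite ?divr_gt0 ?invr_gt0.
have et : e < tau.
  apply: (@le_lt_trans _ _ (tau / 2)); first by rewrite /e ge_min lexx.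
  by rewrite ltr_pdivrMr// ltr_pMr// ltr1n.
have e8 : e <= 8^-1 by rewrite /e ge_min lexx orbT.
have [r4 r40 H4] := abs_continuous_small pQ hQ e0.
have [r5 r50 H5] := abs_continuous_small pR hR' e0.
pose r6 := Num.min r4 r5; have r60 : 0 < r6 by rewrite lt_min r40.
have [tau' t'0 Ht'] := abs_sublevel hQ QE cE (r := r6 / 2) ltac:(by rewrite divr_gt0).
exists (tau' / 2) => [|n n0 zeta eta Hz He]; first by rewrite divr_gt0.
have n0' : (0 : R) < n%:R by rewrite ltr0n.
have n1 : (1 : R) <= n%:R by rewrite ler1n.
set z := zeta - eta; set z' := act n%:R E zeta - act n%:R E eta.
have Ez : z = act n%:R^-1 E z' by rewrite /z' -actB actVK.
have small w : `|Q w| <= tau' / 2 / n%:R -> `|act n%:R E w| <= r6 / 2.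
  move=> h; apply: Ht'; rewrite QE//; apply: (@le_lt_trans _ _ (tau' / 2)).
    by rewrite mulrC -ler_pdivlMr.
  by rewrite ltr_pdivrMr// ltr_pMr// ltr1n.
have z'6 : `|z'| <= r6.
  by apply: le_trans (ler_normB _ _) _; have := small _ Hz; have := small _ He; lra.
have Qz' : `|Q z'| <= e by apply: H4; apply: le_trans z'6 _; rewrite /r6 ge_min lexx.
have Rz' : Rr z' <= e.
  by rewrite -[Rr z']ger0_norm//; apply: H5; apply: le_trans z'6 _; rewrite /r6 ge_min lexx orbT.
have nQ : n%:R * `|Q z| = `|Q z'| by rewrite Ez QE ?invr_gt0// mulrA mulfV ?mul1r// gt_eqF.
(* Rr z equals n^(-k) Rr z' with k > 1, so the damping is even weaker than the scaling of Q
   requires. *)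
have nR : n%:R * Rr z <= Rr z'.
  have ER : Rr z = (n%:R^-1 `^ k) * Rr z'.
    rewrite Ez -(act_powR (k := k)) ?invr_gt0 ?gt_eqF// RE// powR_gt0// invr_gt0//.
  rewrite ER mulrA ler_piMl//.
  apply: (@le_trans _ _ (n%:R * n%:R^-1 `^ 1)); last by rewrite powRr1 ?invr_ge0// mulfV// gt_eqF.
  rewrite ler_wpM2l// ger_powR// ?(ltW k1)//.
  by rewrite invr_gt0 n0' invf_le1.
have z2 : `|z| <= r2.
  apply: Ht; apply: le_lt_trans et; apply: le_trans Qz'.
  by rewrite -nQ ler_peMl.
have [h1 h2 _ _] := H2 z z2; rewrite EF; last exact: le_trans z2 r2r1.
set rho := Rr z + Rt z; set q := Q z + Qt z.
rewrite exprMn expiX -(rmorphXn (real_complex R)) -mulrA -expiD -expRM_natl.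
rewrite (_ : _ + _ = - (n%:R * q)); last by rewrite /q; ring.
rewrite Re_realM [complex.Re _]/= cosN.
have R0 := Rr0 z; have nR0 : 0 <= n%:R * Rr z by rewrite mulr_ge0.
have rho1 : n%:R * rho <= 4^-1.
  apply: (@le_trans _ _ (n%:R * (2 * Rr z))); last by lra.
  rewrite ler_wpM2l// /rho; move: h1; rewrite ler_norml => /andP[_ h1]; lra.
have q1 : `|n%:R * q| <= 4^-1.
  rewrite normrM ger0_norm//; apply: (@le_trans _ _ (n%:R * (2 * `|Q z|))); last by lra.
  rewrite ler_wpM2l// /q; apply: le_trans (ler_normD _ _) _; have := normr_ge0 (Q z); lra.
have c1 : 3 / 4 <= cos (n%:R * q).
  have := cosB1_le (n%:R * q); rewrite ler_norml => /andP[h _]; lra.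
have c2 : 3 / 4 <= expR (n%:R * - rho) by have := expR_ge1Dx (n%:R * - rho); rewrite mulrN; lra.
nra.
Qed.

End ImaginaryType.

(** * Points of positive type and geometric decay *)

Section Subhomogeneity.
Variables (R : realType) (d : nat).
Notation Rd := 'rV[R]_d.
Notation C := R[i].

Lemma homogeneous0 (S : Rd -> R) E : homogeneous S E -> S 0 = 0.
Proof. by move=> h; have := h 2 0 ltac:(by rewrite ltr0n); rewrite act0; lra. Qed.

Lemma strongly_subhomogeneous_sub (P : Rd -> R) E l : strongly_subhomogeneous P E l -> subhomogeneous P E.
Proof.
move=> [cE H]; split => // eps e0 K cK; have [tau t0 Ht] := H eps e0 K cK.
exists tau => // t xi tt Kxi; have := Ht 0%N t xi isT tt Kxi.
by rewrite expr0 mul1r.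
Qed.

(** In polar coordinates for S, subhomogeneity at time S z over the compact set S = 1 is a bound
    relative to S z. *)
Lemma subhomogeneous_small (S P : Rd -> R) E (e : R) : pos_homogeneous S -> homogeneous S E ->
  subhomogeneous P E -> P 0 = 0 -> 0 < e ->
  exists2 r : R, 0 < r & forall z, `|z| <= r -> `|P z| <= e * S z.
Proof.
move=> [cS S0 Sd _ Sc] hS [cE H] P0 e0; have [tau t0 Ht] := H e e0 _ Sc.
have [r r0 Hr] := continuous_real_ball 0 cS (e := tau / 2) ltac:(by rewrite divr_gt0).
exists r => // z zr; have := Hr z; rewrite subr0 (homogeneous0 hS) subr0 ger0_norm// => /(_ zr) Sz.
have [z0|Sz0] := eqVneq (S z) 0.
  by rewrite z0 (Sd _ z0) P0 normr0 mulr0.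
have Szp : 0 < S z by rewrite lt0r Sz0 S0.
have [eta Se Ez] := normal_form hS Szp; rewrite {1}Ez; apply: Ht => //.
by rewrite Szp; lra.
Qed.

(** Trading the exponential for an arbitrarily high negative power brings the positive type under
    the same volume bound as the imaginary type. *)
Lemma expR_powR_bound (q : nat) : (0 < q)%N ->
  exists2 K : R, 0 <= K & forall t : R, 0 <= t -> expR (- (t / 2)) <= K * (1 + t ^+ 2) `^ (- q%:R).
Proof.
move=> q0; have q1 : (0 : R) < q%:R by rewrite ltr0n.
exists ((4 * q%:R) ^+ (2 * q) * expR (1 / 2)) => [|t t0]; first by rewrite mulr_ge0 ?exprn_ge0 ?expR_ge0// mulr_ge0.
have t2 : 0 <= t ^+ 2 by exact: sqr_ge0.
have q4 : 0 < 4 * q%:R :> R by rewrite mulr_gt0.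
rewrite powRN ler_pdivlMr ?powR_gt0 ?powR_mulrn; [|lra..].
have h1 : (1 + t ^+ 2) ^+ q <= (1 + t) ^+ (2 * q).
  rewrite exprM lerXn2r ?nnegrE//; [lra|by rewrite sqr_ge0|].
  nra.
have h2 : (1 + t) ^+ (2 * q) <= (4 * q%:R) ^+ (2 * q) * expR ((1 + t) / 2).
  have -> : expR ((1 + t) / 2) = expR ((1 + t) / (4 * q%:R)) ^+ (2 * q).
    by rewrite -expRM_natl natrM; congr expR; field; rewrite gt_eqF.
  rewrite -exprMn lerXn2r ?nnegrE ?mulr_ge0 ?expR_ge0 ?(ltW q4)//; first by lra.
  rewrite -ler_pdivrMl// mulrC; apply: le_trans (expR_ge1Dx _); lra.
rewrite mulrC; apply: (@le_trans _ _ ((4 * q%:R) ^+ (2 * q) * expR ((1 + t) / 2) * expR (- (t / 2)))).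
  by rewrite ler_wpM2r ?expR_ge0// (le_trans h1).
by rewrite -mulrA -expRD (_ : (1 + t) / 2 + - (t / 2) = 1 / 2)//; field.
Qed.

Lemma pos_type_estimate (c : Rd) (F : Rd -> C) (Rr Rt : Rd -> R) E (r1 : R) : `|c| <= 4 * pi ->
  (forall z, cabs (F z) <= 1) -> 0 < r1 ->
  (forall z, `|z| <= r1 -> cabs (F z) = expR (- (Rr z + Rt z))) ->
  poly_nolin Rr -> pos_homogeneous Rr -> homogeneous Rr E -> subhomogeneous Rt E -> Rt 0 = 0 ->
  exists r K : R, [/\ 0 < r, 0 <= K & forall n : nat, (0 < n)%N ->
    mean (fun xi => (`|xi - c| <= r)%R%:R * cabs (F (xi - c)) ^+ n) <= K * n%:R `^ (- \tr E)].
Proof.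
move=> c4 F1 r10 EF pR hR RE sR Rt0; have [_ R0 _ _ _] := hR.
have [r2 r20 H2] := subhomogeneous_small (e := 2^-1) hR RE sR Rt0 ltac:(by rewrite invr_gt0).
(* Any integer above (tr E) / 2 works; the exponential decay leaves this choice free. *)
pose q := (Num.truncn (\tr E)).+1.
have trq : \tr E < 2 * q%:R.
  have : \tr E < q%:R by exact: truncnS_gt.
  have : (0 : R) <= q%:R by rewrite ler0n.
  lra.
have aR : (fun z => `|Rr z|) = Rr by apply/funext => z; rewrite ger0_norm.
have [cE _] := sR.
have [rv [Kv [rv0 Kv0 Hv]]] := volume_bound (S := Rr) (E := E) pR ltac:(by rewrite aR) ltac:(by rewrite aR) cE c4 (p := q%:R) ltac:(by rewrite ltr0n) trq.
have [Kq Kq0 HKq] := expR_powR_bound (q := q) isT.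
exists (Num.min rv (Num.min r1 r2)), (Kq * Kv).
split; [by rewrite !lt_min rv0 r10 r20|exact: mulr_ge0|].
move=> n n0; have n1 : (1 : R) <= n%:R by rewrite ler1n.
rewrite -mulrA; apply: le_trans (ler_wpM2l Kq0 (Hv n%:R n1)).
have bv : bndf (fun xi => (`|xi - c| <= rv)%R%:R * (1 + n%:R ^+ 2 * Rr (xi - c) ^+ 2) `^ (- q%:R)).
  exists 1 => xi; rewrite normrM normr_nat ger0_norm ?powR_ge0//.
  rewrite -[leRHS]mul1r; apply: ler_pM; rewrite ?ler0n ?powR_ge0//.
    by rewrite -[X in _ <= X]/(1%:R) ler_nat leq_b1.
  by apply: powR_neg_le1; rewrite ?ler0n// mulr_ge0 ?sqr_ge0.
rewrite -(meanZ Kq bv); apply: mean_le; last exact: bndf_Z.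
- move=> xi; set z := xi - c; have [zr|zr] := leP `|z| (Num.min rv (Num.min r1 r2)); last first.
    by rewrite mul0r; apply: mulr_ge0 => //; apply: mulr_ge0; rewrite ?powR_ge0.
  move: zr; rewrite !le_min => /and3P[-> z1 z2]; rewrite !mul1r.
  rewrite EF// -expRM_natl -exprMn; apply: le_trans (HKq _ _); last by rewrite mulr_ge0.
  rewrite ler_expR mulrN lerN2 -mulrA ler_wpM2l ?ler0n//.
  have := H2 z z2; rewrite ler_norml => /andP[h _]; lra.
- exists 1 => xi; rewrite normrM normr_nat ger0_norm ?exprn_ge0 ?cabs_ge0//.
  rewrite -[leRHS]mul1r; apply: ler_pM; rewrite ?ler0n ?exprn_ge0 ?cabs_ge0//.
    by rewrite -[X in _ <= X]/(1%:R) ler_nat leq_b1.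
  by rewrite exprn_ile1 ?cabs_ge0.
Qed.

(** By induction q^n (1 + n (1 - q)) <= 1. *)
Lemma geometric_decay (q : R) (n : nat) : 0 <= q < 1 -> n%:R * q ^+ n <= (1 - q)^-1.
Proof.
move=> /andP[q0 q1].
have H : q ^+ n * (1 + n%:R * (1 - q)) <= 1.
  elim: n => [|n IH]; first by rewrite expr0 mul0r addr0 mul1r.
  apply: le_trans IH; rewrite exprSr -mulrA ler_wpM2l ?exprn_ge0//.
  rewrite -natr1; have : 0 <= n%:R * (1 - q) by rewrite mulr_ge0//; lra.
  move: (n%:R * (1 - q)) (mulrDl n%:R 1 (1 - q)) => w -> w0; nra.
rewrite -[leRHS]mul1r ler_pdivlMr; last by lra.
apply: le_trans H; rewrite mulrAC mulrC ler_wpM2l ?exprn_ge0//; lra.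
Qed.

End Subhomogeneity.

(** * The drift is determined by the Fourier transform *)

Section DriftUniqueness.
Variables (R : realType) (d : nat).
Notation Rd := 'rV[R]_d.
Notation C := R[i].
Variable phi : 'rV[int]_d -> C.

Lemma nbhs0_ball (U : set Rd) : nbhs (0 : Rd) U -> exists2 r : R, 0 < r & forall z, `|z| <= r -> U z.
Proof.
move=> /nbhs_ballP[r /= r0 Hr]; exists (r / 2); first by rewrite divr_gt0.
move=> z zr; apply: Hr; rewrite -ball_normE /= sub0r normrN.
by apply: le_lt_trans zr _; rewrite ltr_pdivrMr// ltr_pMr// ltr1n.
Qed.

Lemma imag_type_phase xi m a : cabs (fourier phi xi) = 1 -> imag_type phi xi m a ->
  exists r K : R, exists rho q : Rd -> R, [/\ 0 < r, 0 <= K, forall z, `|z| <= r -> `|q z| <= K * `|z| ^+ 2 &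
   forall z, `|z| <= r -> fourier phi (z + xi) = fourier phi xi * ((expR (rho z))%:C%C * expi (dotR a z - q z))].
Proof.
move=> u1 [Q [Qt [Rr [Rt [E [k [[Qt0 [Rt0 [U U0 [_ _ HU]]]] pQ _ hQ [_ QE _ _ [sQ _ _]]]]]]]]].
have [r1 r10 H1] := nbhs0_ball U0.
have [r2 r20 H2] := subhomogeneous_small (e := 1) hQ QE (strongly_subhomogeneous_sub sQ) Qt0 ltr01.
have [K K0 HK] := poly_nolin_bound pQ.
exists (Num.min 1 (Num.min r1 r2)), (2 * K), (fun z => - (Rr z + Rt z)), (fun z => Q z + Qt z).
split; [by rewrite !lt_min ltr01 r10 r20|by rewrite mulr_ge0| |].
  move=> z; rewrite !le_min => /and3P[z1 z2 z3].
  have := HK z z1; have := H2 z z3 => h1 h2.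
  apply: le_trans (ler_normD _ _) _; lra.
by move=> z; rewrite !le_min => /and3P[z1 z2 z3]; apply: HU; exact: H1.
Qed.

(** [mu_xi] and [drift] are chosen independently, so the decomposition realising the order comes
    with a drift of its own; this lemma identifies the two. Two expansions of the same function have
    phases equal modulo 2 pi, hence equal near 0, so b.z = O(|z|^2) for the difference b of the
    drifts. *)
Lemma imag_type_drift_unique xi m m' a a' : cabs (fourier phi xi) = 1 ->
  imag_type phi xi m a -> imag_type phi xi m' a' -> a = a'.
Proof.
move=> u1 /(imag_type_phase u1)[r [K [rho [q [r0 K0 Hq HF]]]]] /(imag_type_phase u1)[r' [K' [rho' [q' [r'0 K'0 Hq' HF']]]]].
have uN0 : fourier phi xi != 0 by apply/eqP => h; move: u1; rewrite h cabs0; lra.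
pose b := a - a'.
have Eb z : dotR a z - dotR a' z = dotR b z by rewrite /b dotRDl -[- a']scaleN1r dotRZl mulN1r.
pose L : R := d%:R * `|b| + K + K' + 1.
have L1 : 1 <= L by rewrite /L lerDr !addr_ge0// mulr_ge0.
have L0 : 0 < L by lra.
have lin z : `|z| <= r -> `|z| <= r' -> `|z| <= L^-1 -> `|dotR b z| <= (K + K') * `|z| ^+ 2.
  move=> zr zr' zL; have z0 := normr_ge0 z.
  have z1 : `|z| <= 1 by apply: le_trans zL _; rewrite invf_le1.
  have q1 := Hq z zr; have q2 := Hq' z zr'.
  have E1 : (expR (rho z))%:C%C * expi (dotR a z - q z) = (expR (rho' z))%:C%C * expi (dotR a' z - q' z).
    by apply: (mulfI uN0); rewrite -HF// -HF'.
  have E2 : expR (rho z) = expR (rho' z).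
    move: (congr1 (@cabs R) E1); rewrite !cabsM !cabs_expi !mulr1 !cabs_real.
    by rewrite !ger0_norm ?expR_ge0.
  have E3 : expi (dotR a z - q z) = expi (dotR a' z - q' z).
    have e0 : (expR (rho' z))%:C%C != 0 :> C.
      by apply/eqP => /(congr1 (@complex.Re R)) /= h; have := expR_gt0 (rho' z); rewrite h ltxx.
    by apply: (mulfI e0); rewrite -E1 E2.
  pose t := dotR b z - (q z - q' z).
  have Et : expi t = 1.
    rewrite (_ : t = (dotR a z - q z) + - (dotR a' z - q' z)); last by rewrite /t -Eb; ring.
    by rewrite expiD E3 mulrC expiNM.
  have z2 : `|z| ^+ 2 <= `|z| by rewrite expr2 ler_piMl.
  have qq : `|q z - q' z| <= (K + K') * `|z| ^+ 2.
    by apply: le_trans (ler_normB _ _) _; rewrite mulrDl; exact: lerD.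
  have tL : `|t| <= 1.
    apply: le_trans (ler_normB _ _) _.
    have h1 := normr_dotR b z.
    have h2 : (K + K') * `|z| ^+ 2 <= (K + K') * `|z| by rewrite ler_wpM2l// addr_ge0.
    have h3 : L * `|z| <= 1 by apply: le_trans (ler_wpM2l (ltW L0) zL) _; rewrite mulfV// gt_eqF.
    apply: le_trans (lerD h1 (le_trans qq h2)) _; move: h3; rewrite /L !mulrDl; lra.
  have t0 : t = 0.
    apply/eqP; apply: contraPT Et => t0; apply/eqP; apply: expi_neq1.
    rewrite normr_gt0 t0 /=; have := pi_ge2 R; lra.
  by rewrite (_ : dotR b z = q z - q' z)//; move: t0; rewrite /t; lra.
have bb0 : dotR b b = 0.
  apply/eqP; rewrite -normr_le0 leNgt; apply/negP => bb.
  have b0 : 0 < `|b|.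
    by rewrite normr_gt0; apply: contraTneq bb => ->; rewrite dotR0 normr0 ltxx.
  have KK : 0 < (K + K' + 1) * `|b| ^+ 2 by rewrite mulr_gt0 ?exprn_gt0// ltr_wpDl// addr_ge0.
  (* Testing at z = s b: the first three bounds keep z in the admissible ball, the last one makes
     the quadratic bound contradict b.b > 0. *)
  pose s := Num.min (Num.min (r / `|b|) (r' / `|b|)) (Num.min (L^-1 / `|b|) (`|dotR b b| / (2 * ((K + K' + 1) * `|b| ^+ 2)))).
  have s0 : 0 < s by rewrite !lt_min !divr_gt0 ?invr_gt0// mulr_gt0.
  have : s <= s by []; rewrite {2}/s !le_min => /andP[/andP[s1 s2] /andP[s3 s4]].
  have nb : `|s *: b| = s * `|b| by rewrite normrZ gtr0_norm.
  have := lin (s *: b); rewrite nb dotRZr -!ler_pdivlMr// => /(_ s1 s2 s3).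
  rewrite normrM gtr0_norm// exprMn; move: s4; rewrite ler_pdivlMr; last by rewrite mulr_gt0.
  have : 0 <= `|b| ^+ 2 by rewrite exprn_ge0.
  move=> b2 s4 s5.
  have : `|dotR b b| <= (K + K') * (s * `|b| ^+ 2).
    rewrite -(ler_pM2l s0); apply: le_trans s5 _; rewrite le_eqVlt; apply/orP; left; apply/eqP; ring.
  have : 0 <= s * `|b| ^+ 2 by rewrite mulr_ge0// ltW.
  move: s4; rewrite (_ : s * (2 * _) = 2 * ((K + K') * (s * `|b| ^+ 2) + s * `|b| ^+ 2)); last by ring.
  lra.
apply/eqP; rewrite -subr_eq0 -/b; apply/eqP/rowP => i.
have := bb0; rewrite /dotR => /eqP; rewrite psumr_eq0; last by move=> j _; rewrite -expr2 sqr_ge0.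
move=> /allP/(_ i (mem_index_enum _)) /=; rewrite -expr2 sqrf_eq0 => /eqP ->.
by rewrite mxE.
Qed.

End DriftUniqueness.

(** * Upper bounds localised near each frequency *)

Section LocalBounds.
Variables (R : realType) (d : nat).
Notation Rd := 'rV[R]_d.
Notation Zd := 'rV[int]_d.
Notation C := R[i].
Variables (phi : Zd -> C) (alpha : Rd) (mu : R).
Hypotheses (Sphi : in_Sd phi) (F1 : forall xi, cabs (fourier phi xi) <= 1) (mu1 : mu <= 1).

(** [K] is chosen before [M], and only the threshold [N] depends on [M]: a single constant then
    serves all bounded ranges of x - n alpha. *)
Definition local_bound (c : Rd) := exists2 r : R, 0 < r & forall chi chi', D2 setT chi chi' ->
  (forall z : Rd, chi z != 0 -> `|z| <= r) ->
  exists2 K : R, 0 <= K & forall M : R, exists N : nat, forall n x, (N <= n)%N ->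
    `|zR R x - n%:R *: alpha| <= M ->
    cabs (cmean (fun xi => fourier phi xi ^+ n * (character x xi)^*%C * chi (xi - c))) <= K * n%:R `^ (- mu).

Lemma local_bound_mean (c : Rd) (r K : R) : 0 < r -> 0 <= K ->
  (forall n : nat, (0 < n)%N ->
    mean (fun xi => (`|xi - c| <= r)%R%:R * cabs (fourier phi xi) ^+ n) <= K * n%:R `^ (- mu)) ->
  local_bound c.
Proof.
move=> r0 K0 H; exists r => // chi chi' Dchi schi.
have [K1 [K10 HK1]] := D2_bounded Dchi.
exists (2 * (K1 * K)) => [|M]; first by rewrite !mulr_ge0.
exists 1%N => n x n0 _.
have bF : bndf (fun xi => (`|xi - c| <= r)%R%:R * cabs (fourier phi xi) ^+ n).
  exists 1 => xi; rewrite normrM normr_nat ger0_norm ?exprn_ge0 ?cabs_ge0//.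
  rewrite -[leRHS]mul1r; apply: ler_pM; rewrite ?ler0n ?exprn_ge0 ?cabs_ge0//.
    by rewrite -[X in _ <= X]/(1%:R) ler_nat leq_b1.
  by rewrite exprn_ile1 ?cabs_ge0.
apply: le_trans (cmean_le _ (bndf_Z K1 bF)) _.
  move=> xi; rewrite !cabsM cabs_conj cabs_character mulr1 cabsX.
  have [zr|zr] := leP `|xi - c| r.
    by rewrite mul1r mulrC; apply: ler_pM; rewrite ?exprn_ge0 ?cabs_ge0//; exact: HK1.
  have -> : chi (xi - c) = 0 by apply/eqP; apply: contraTT zr => /schi; rewrite -leNgt.
  by rewrite cabs0 mulr0 mul0r mulr0.
by rewrite (meanZ _ bF) -!mulrA ler_wpM2l// ler_wpM2l//; exact: H.
Qed.

Lemma powR_mu_le (n : nat) (nu : R) : (0 < n)%N -> mu <= nu -> n%:R `^ (- nu) <= n%:R `^ (- mu) :> R.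
Proof. by move=> n0 h; apply: ler_powR; rewrite ?ler1n// lerN2. Qed.

(** By continuity the modulus stays below the midpoint q of its value at [c] and 1. The geometric
    decay is only used as O(1/n), which suffices since mu <= 1. *)
Lemma local_bound_lt1 (c : Rd) : cabs (fourier phi c) < 1 -> local_bound c.
Proof.
move=> c1; pose q := (1 + cabs (fourier phi c)) / 2.
have q01 : 0 <= q < 1 by rewrite /q; have := cabs_ge0 (fourier phi c); lra.
have [K [e [K0 e0 HD]]] := D2_fourier [set: Rd] Sphi.
pose K2 := K * (d%:R + e) + 1.
have K20 : 0 < K2 by rewrite /K2 ltr_wpDl// mulr_ge0// addr_ge0// ltW.
pose r := Num.min e ((q - cabs (fourier phi c)) / K2).
have r0 : 0 < r by rewrite lt_min e0 divr_gt0// /q; lra.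
have q0 : 0 <= (1 - q)^-1 * mean (fun _ : Rd => 1 : R).
  by rewrite mulr_ge0 ?invr_ge0; [|lra|apply: mean_ge0 => //; exact: bndf_cst].
apply: (local_bound_mean r0 q0) => n n0.
apply: (@le_trans _ _ ((1 - q)^-1 * n%:R^-1 * mean (fun _ : Rd => 1 : R))); last first.
  rewrite mulrAC ler_wpM2l//; apply: le_trans (powR_mu_le n0 mu1).
  by rewrite powRN powRr1.
have n0' : (0 : R) < n%:R by rewrite ltr0n.
rewrite -(meanZ _ (@bndf_cst R d 1)); apply: mean_le; [|exists 1|exact/bndf_Z/bndf_cst] => xi; last first.
  rewrite normrM normr_nat ger0_norm ?exprn_ge0 ?cabs_ge0//.
  rewrite -[leRHS]mul1r; apply: ler_pM; rewrite ?ler0n ?exprn_ge0 ?cabs_ge0//.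
    by rewrite -[X in _ <= X]/(1%:R) ler_nat leq_b1.
  by rewrite exprn_ile1 ?cabs_ge0.
rewrite mulr1; have [zr|zr] := leP `|xi - c| r; last by rewrite mul0r mulr_ge0 ?invr_ge0//; lra.
rewrite mul1r; apply: (@le_trans _ _ (q ^+ n)); last first.
  by rewrite ler_pdivlMr// mulrC; exact: geometric_decay.
rewrite lerXn2r ?nnegrE ?cabs_ge0//; first by lra.
move: zr; rewrite le_min => /andP[ze zq].
have := D2at_lip K0 HD (I : [set: Rd] c) ze; rewrite (addrC c) subrK => h.
rewrite -[fourier phi xi](subrK (fourier phi c)); apply: le_trans (cabsD _ _) _.
have : K2 * `|xi - c| <= q - cabs (fourier phi c) by rewrite mulrC -ler_pdivlMr.
move: h; rewrite /K2 mulrDl; have := normr_ge0 (xi - c); lra.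
Qed.

Lemma fourier_shift (c v : Rd) : (forall x : Zd, character x v = 1) -> fourier phi (c + v) = fourier phi c.
Proof.
by move=> H; rewrite !fourierE; congr zsum; apply/funext => x; rewrite characterD H mulr1.
Qed.

Lemma reduce_mod_2pi (c : Rd) : exists2 xi0 : Rd, (forall i, - pi < xi0 0 i <= pi) &
  forall z, fourier phi (z + c) = fourier phi (z + xi0).
Proof.
have p0 := pi_gt0 R; have p2 : 0 < 2 * pi :> R by rewrite mulr_gt0.
(* The ceiling puts c_i - 2 pi k_i in the interval open at - pi and closed at pi. *)
pose k i : int := Num.ceil ((c 0 i - pi) / (2 * pi)).
pose v : Rd := \row_i ((k i)%:~R * (2 * pi)).
exists (c - v) => [i|z].
  rewrite !mxE; have := ceil_itv ((c 0 i - pi) / (2 * pi)); rewrite -/(k i) => /andP[].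
  rewrite ltr_pdivlMr// ler_pdivrMr// intrD => h1 h2; lra.
rewrite -{1}(subrK v c) addrA; apply: fourier_shift => x.
rewrite /character (_ : dotZR x v = (\sum_i x 0 i * k i)%:~R * (2 * pi)); first exact: expi_2pi_int.
rewrite rmorph_sum mulr_suml; apply: eq_bigr => i _.
by rewrite !mxE rmorphM /= mulrA.
Qed.

Lemma character_conj (x : Zd) (z : Rd) : (character x z)^*%C = expi (- dotZR x z).
Proof. by rewrite /character expiN. Qed.

(** Recentred at [c] with value 1 at the origin, so that its logarithm near 0 is the function
    expanded in [gamma_decomp]. *)
Definition normalized (c z : Rd) : C := fourier phi (z + c) * (fourier phi c)^-1.
Definition normalized' (c z : Rd) (i : 'I_d) : C :=
  (fourier phi c)^-1 * fourier (fun x => 'i%C * ((x 0 i)%:~R : R)%:C%C * phi x) (z + c).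

Lemma D2_normalized c : D2 setT (normalized c) (normalized' c).
Proof.
have H := D2_scale (fourier phi c)^-1 (D2_shift (- c) (D2_fourier [set: Rd] Sphi)).
apply: D2_eq (D2_sub (@subsetT _ _) H) => [z|z _ i]; last by rewrite /normalized' opprK.
by rewrite opprK mulrC.
Qed.

Lemma isD2_normalized' c i : isD2 setT (fun z => normalized' c z i).
Proof.
have H := D2_scale (fourier phi c)^-1 (D2_shift (- c) (D2_fourier [set: Rd] (in_Sd_coord i Sphi))).
eexists; apply: D2_eq (D2_sub (@subsetT _ _) H) => [z|z _ j]; last by [].
by rewrite /= opprK.
Qed.

Lemma cabs_normalized c z : cabs (fourier phi c) = 1 -> cabs (normalized c z) = cabs (fourier phi (z + c)).
Proof. by move=> u1; rewrite cabsM cabsV u1 invr1 mulr1. Qed.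

Lemma cmean_normalized c chi n (x : Zd) : cabs (fourier phi c) = 1 -> bndc chi ->
  cabs (cmean (fun xi => fourier phi xi ^+ n * (character x xi)^*%C * chi (xi - c))) =
  cabs (cmean (fun xi => normalized c (xi - c) ^+ n * expi (- dotZR x (xi - c)) * chi (xi - c))).
Proof.
move=> u1 [K HK]; have uN0 : fourier phi c != 0 by apply/eqP => h; move: u1; rewrite h cabs0; lra.
rewrite (_ : (fun xi => fourier phi xi ^+ n * _ * _) = (fun xi => (fourier phi c ^+ n * (character x c)^*%C) *
  (normalized c (xi - c) ^+ n * expi (- dotZR x (xi - c)) * chi (xi - c)))); last first.
  apply/funext => xi; rewrite -character_conj /normalized subrK exprMn exprVn.
  have -> : (character x xi)^*%C = (character x c)^*%C * (character x (xi - c))^*%C.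
    by rewrite -conjcM -characterD addrC subrK.
  by field; rewrite expf_neq0.
rewrite cmeanZ; last first.
  exists K => xi; rewrite !cabsM cabs_expi mulr1 cabsX cabs_normalized// -[leRHS]mul1r.
  by apply: ler_pM; rewrite ?exprn_ge0 ?cabs_ge0// exprn_ile1 ?cabs_ge0.
by rewrite !cabsM cabs_conj cabs_character cabsX u1 expr1n !mul1r.
Qed.

Lemma gamma_normalized c xi0 a Q Qt Rr Rt : (forall z, fourier phi (z + c) = fourier phi (z + xi0)) ->
  cabs (fourier phi xi0) = 1 -> gamma_decomp phi xi0 a Q Qt Rr Rt ->
  exists2 r1 : R, 0 < r1 & forall z, `|z| <= r1 ->
    normalized c z = (expR (- (Rr z + Rt z)))%:C%C * expi (dotR a z - (Q z + Qt z)).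
Proof.
move=> Hc u1 [_ [_ [U U0 [_ _ HU]]]]; have [r1 r10 H1] := nbhs0_ball U0.
have uN0 : fourier phi xi0 != 0 by apply/eqP => h; move: u1; rewrite h cabs0; lra.
exists r1 => // z zr; rewrite /normalized Hc (HU z (H1 z zr)).
have -> : fourier phi c = fourier phi xi0 by have := Hc 0; rewrite !add0r.
by rewrite mulrAC mulfV// mul1r.
Qed.

Lemma local_bound_imag (c xi0 : Rd) (m : R) : `|c| <= 4 * pi ->
  (forall z, fourier phi (z + c) = fourier phi (z + xi0)) -> cabs (fourier phi xi0) = 1 ->
  imag_type phi xi0 m alpha -> mu <= m -> m < 1 -> local_bound c.
Proof.
move=> c4 Hc u1 [Q [Qt [Rr [Rt [E [k [gd pQ pR hQ [hR QE k1 RE [sQ sR mE]]]]]]]]] mum m1.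
have [r1 r10 EF] := gamma_normalized Hc u1 gd; have [Qt0 [Rt0 _]] := gd.
have uc : cabs (fourier phi c) = 1 by have := Hc 0; rewrite !add0r => ->.
rewrite mE in mum m1.
have [|r r0 H] := @imag_estimate _ _ E alpha (normalized c) (normalized' c) Q Qt Rr Rt k r1
   (D2_normalized c) (isD2_normalized' c) r10 EF Qt0 Rt0 pQ pR hQ hR QE k1 RE sQ sR c c4 m1.
  by move=> z; rewrite cabs_normalized.
exists r => // chi chi' Dchi schi; have [K K0 HK] := H chi chi' Dchi schi.
exists K => // M; have [N HN] := HK M; exists N.+1 => n x nN xM.
rewrite (cmean_normalized _ _ uc (D2_bndc Dchi)); apply: le_trans (HN n x (ltnW nN) xM) _.
by rewrite ler_wpM2l// powR_mu_le//; exact: leq_trans nN.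
Qed.

Lemma local_bound_pos (c xi0 a : Rd) (m : R) : `|c| <= 4 * pi ->
  (forall z, fourier phi (z + c) = fourier phi (z + xi0)) -> cabs (fourier phi xi0) = 1 ->
  pos_type phi xi0 m a -> mu <= m -> local_bound c.
Proof.
move=> c4 Hc u1 [Q [Qt [Rr [Rt [E [gd pQ pR hR [RE _ _ sR mE]]]]]]] mum.
have [r1 r10 EF] := gamma_normalized Hc u1 gd; have [_ [Rt0 _]] := gd.
have uc : cabs (fourier phi c) = 1 by have := Hc 0; rewrite !add0r => ->.
have [||r [K [r0 K0 H]]] := @pos_type_estimate _ _ c (normalized c) Rr Rt E r1 c4 _ r10 _ pR hR RE sR Rt0.
- by move=> z; rewrite cabs_normalized.
- by move=> z zr; rewrite EF// cabsM cabs_expi mulr1 cabs_real ger0_norm ?expR_ge0.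
apply: (local_bound_mean r0 K0) => n n0.
have := H n n0; rewrite (_ : (fun xi => _) = (fun xi => (`|xi - c| <= r)%R%:R * cabs (fourier phi xi) ^+ n)); last first.
  by apply/funext => xi; rewrite cabs_normalized// subrK.
move=> h; apply: le_trans h _; rewrite ler_wpM2l// powR_mu_le//.
by rewrite -mE.
Qed.

End LocalBounds.

(** * From local bounds to the whole support of [theta] *)

Section Globalization.
Variables (R : realType) (d : nat).
Notation Rd := 'rV[R]_d.
Notation Zd := 'rV[int]_d.
Notation C := R[i].

(** Squaring the coordinates gives a smooth argument for [kappa] in place of the absolute value. *)
Definition bump (c : Rd) (r : R) (xi : Rd) : R := \prod_i kappa (r^-1 ^+ 2 * (xi 0 i - c 0 i) ^+ 2).

Lemma bump1 c (r : R) xi : 0 < r -> `|xi - c| <= r -> bump c r xi = 1.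
Proof.
move=> r0 h; apply: big1 => i _; rewrite kappa1// -exprMn -[leRHS](expr1n _ 2) -real_normK ?num_real//.
rewrite lerXn2r ?nnegrE// normrM gtr0_norm ?invr_gt0// mulrC ler_pdivrMr// mul1r.
by apply: le_trans h; have := normr_coord (xi - c) i; rewrite !mxE.
Qed.

Lemma bump_supp c (r : R) xi : 0 < r -> bump c r xi != 0 -> `|xi - c| <= 2 * r.
Proof.
move=> r0 h; apply: normr_rV_le => [|i]; first by rewrite mulr_ge0// ltW.
rewrite !mxE leNgt; apply: contra h => h; rewrite /bump (bigD1 i)//= kappa0 ?mul0r//.
rewrite -exprMn -real_normK ?num_real// normrM gtr0_norm ?invr_gt0//.
have : 2 <= r^-1 * `|xi 0 i - c 0 i| by rewrite mulrC ler_pdivlMr// ltW.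
move: (r^-1 * _) => q q2; nra.
Qed.

Lemma isD2_bump c (r : R) : 0 < r -> isD2 setT (fun xi => (bump c r xi)%:C%C).
Proof.
move=> r0; apply: (@isD2_extend R d (`|c| + 2 * r + 1) (`|c| + 2 * r)); first by rewrite ltrDl.
  move=> xi h; have {}h : bump c r xi != 0 by apply: contra h => /eqP ->.
  have := bump_supp r0 h; have := ler_normD (xi - c) c; rewrite subrK; lra.
apply: isD2r_prod => i; apply: isD2_kappa; apply: isD2r_mulc; apply: isD2r_exp.
by apply: isD2r_addc; exact: isD2_coord.
Qed.

Lemma compact_rV_ball (r : R) : compact [set xi : Rd | `|xi| <= r].
Proof.
have [r0|r0] := leP 0 r; last first.
  rewrite (_ : [set _ | _] = set0); first exact: compact0.
  by apply/seteqP; split => // xi /= h; have := normr_ge0 xi; lra.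
rewrite (_ : [set _ | _] = [set xi : Rd | forall i, `[- r, r]%classic (xi ord0 i)]).
  exact: (@rV_compact R d (fun=> `[- r, r]%classic) (fun=> @segment_compact R (- r) r)).
apply/seteqP; split => xi /= h.
  by move=> i; rewrite /= in_itv /= -ler_norml; apply: le_trans h; exact: normr_coord.
by apply: normr_rV_le => // i; have := h i; rewrite /= in_itv /= -ler_norml.
Qed.

Variables (phi : Zd -> C) (alpha : Rd) (mu : R).
Hypotheses (Sphi : in_Sd phi) (F1 : forall xi, cabs (fourier phi xi) <= 1).

Definition global_bound (f : Rd -> C) :=
  exists2 K : R, 0 <= K & forall M : R, exists N : nat, forall n x, (N <= n)%N ->
    `|zR R x - n%:R *: alpha| <= M ->
    cabs (cmean (fun xi => fourier phi xi ^+ n * (character x xi)^*%C * f xi)) <= K * n%:R `^ (- mu).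

Lemma global_boundD f g : bndc f -> bndc g -> global_bound f -> global_bound g ->
  global_bound (fun xi => f xi + g xi).
Proof.
move=> bf bg [K K0 HK] [L L0 HL]; exists (K + L) => [|M]; first exact: addr_ge0.
have [N1 H1] := HK M; have [N2 H2] := HL M; exists (maxn N1 N2) => n x.
rewrite geq_max => /andP[n1 n2] xM.
have bq : bndc (fun xi => fourier phi xi ^+ n * (character x xi)^*%C).
  apply: bndc_M; first exact: bndc_X (fourier_bndc Sphi).
  exact: (bndc_conj (f := character x) (@bndc_character R d x)).
rewrite (_ : (fun xi => _) = (fun xi => fourier phi xi ^+ n * (character x xi)^*%C * f xi + fourier phi xi ^+ n * (character x xi)^*%C * g xi)); last first.
  by apply/funext => xi; rewrite mulrDr.
rewrite cmeanD; [|exact: bndc_M..].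
apply: le_trans (cabsD _ _) _; rewrite mulrDl; apply: lerD; [exact: H1|exact: H2].
Qed.

Lemma isD2_bndc (f : Rd -> C) : isD2 setT f -> bndc f.
Proof. by move=> [f' Df]; exact: D2_bndc Df. Qed.

Lemma global_bound_local c : local_bound phi alpha mu c ->
  exists2 r : R, 0 < r & forall G : Rd -> C, isD2 setT G -> global_bound (fun xi => G xi * (bump c r xi)%:C%C).
Proof.
move=> [r r0 H]; exists (r / 2); first by rewrite divr_gt0.
move=> G DG; have r2 : 0 < r / 2 by rewrite divr_gt0.
have [chi' Dchi] := isD2_mul DG (isD2_bump c r2).
have Ds := D2_sub (@subsetT _ _) (D2_shift (- c) Dchi).
have [|K K0 HK] := H _ _ (Ds setT).
  move=> z; rewrite opprK mulf_eq0 negb_or => /andP[_ h].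
  have {}h : bump c (r / 2) (z + c) != 0 by apply: contra h => /eqP ->.
  by have := bump_supp r2 h; rewrite addrK mulrC divfK.
exists K; first exact: K0.
move=> M; have [N HN] := HK M; exists N => n x nN xM.
rewrite (_ : (fun xi => _) = (fun xi => fourier phi xi ^+ n * (character x xi)^*%C *
  (G (xi - c - - c) * (bump c (r / 2) (xi - c - - c))%:C%C))); first exact: HN.
by apply/funext => xi; rewrite opprK subrK.
Qed.

(** Finitely many balls on which the bump equals one cover the support of [G]. Writing G = G b + G
    (1 - b) for one bump after another avoids normalising them to a partition of unity. *)
Lemma global_bound_all (G : Rd -> C) : (forall c : Rd, `|c| <= 4 * pi -> local_bound phi alpha mu c) ->
  isD2 setT G -> (forall xi, G xi != 0 -> `|xi| <= 2 * pi) -> global_bound G.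
Proof.
move=> H DG sG.
(* Beyond 4 pi the radius 1 is a default that lets [choice] return a total function. *)
have Hr (c : Rd) : exists r : R, 0 < r /\ (`|c| <= 4 * pi -> forall G : Rd -> C, isD2 setT G -> global_bound (fun xi => G xi * (bump c r xi)%:C%C)).
  have [c4|c4] := leP `|c| (4 * pi); last by exists 1.
  by have [r r0 Hr] := global_bound_local (H c c4); exists r.
have [rad Hrad] := choice Hr.
have cov : [set xi : Rd | `|xi| <= 2 * pi] `<=` cover [set c : Rd | `|c| <= 2 * pi] (fun c => ball c (rad c)).
  by move=> xi h; exists xi => //; have [r0 _] := Hrad xi; exact: ballxx.
have := @compact_rV_ball (2 * pi); rewrite compact_cover => /(_ _ _ _ _ cov).
move=> /(_ (fun c _ => ball_open c (rad c))) [D' sD' cD'].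
have p0 := pi_gt0 R.
have key (s : seq Rd) : (forall c, c \in s -> `|c| <= 4 * pi) -> forall G : Rd -> C, isD2 setT G ->
    global_bound (fun xi => G xi * \prod_(c <- s) (1 - (bump c (rad c) xi)%:C%C)) -> global_bound G.
  elim: s => [|c s IH] hs {DG sG}G DG HG.
    by move: HG; congr global_bound; apply/funext => xi; rewrite big_nil mulr1.
  have [r0 Hc] := Hrad c.
  have Db := isD2_bump c r0.
  have D1b : isD2 setT (fun xi => G xi * (1 - (bump c (rad c) xi)%:C%C)).
    apply: isD2_mul => //; apply: isD2_add; first exact: isD2_cst.
    by apply: isD2_eq (isD2_mul (isD2_cst _ (-1)) Db) => xi; rewrite mulN1r.
  rewrite (_ : G = (fun xi => G xi * (bump c (rad c) xi)%:C%C + G xi * (1 - (bump c (rad c) xi)%:C%C))); last first.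
    by apply/funext => xi; ring.
  apply: global_boundD; [exact/isD2_bndc/isD2_mul|exact: isD2_bndc| |].
    by apply: Hc => //; apply: hs; rewrite mem_head.
  apply: IH => // [c' c's|]; first by apply: hs; rewrite in_cons c's orbT.
  by move: HG; congr global_bound; apply/funext => xi; rewrite big_cons mulrA.
apply: (key (finmap.enum_fset D') _ G DG).
  move=> c cD; have : c \in [set c : Rd | `|c| <= 2 * pi] by apply: sD'.
  rewrite inE /= => h; lra.
(* After all bumps are removed, the product of the factors 1 - b vanishes wherever [G] does not, so
   the remaining integrand is zero. *)
exists 0; first exact: lexx.
move=> M; exists 0%N => n x _ _; rewrite mul0r.
rewrite (_ : (fun xi => _) = (fun=> 0)); first by rewrite cmean0 cabs0.
apply/funext => xi; have [->|Gx] := eqVneq (G xi) 0; first by rewrite mul0r mulr0.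
have [c cS cx] := cD' xi (sG xi Gx).
rewrite (big_rem c)//= bump1 ?subrr ?mul0r ?mulr0//; first by have [] := Hrad c.
by move: cx; rewrite -ball_normE /= distrC => /ltW.
Qed.

End Globalization.

(** * Assembly of the two bounds *)

Section MainTheorem.
Variables (R : realType) (d : nat).
Notation Rd := 'rV[R]_d.
Notation Zd := 'rV[int]_d.
Notation C := R[i].
Variables (phi : Zd -> C) (alpha : Rd) (mu : R).
Hypotheses (Sphi : in_Sd phi) (F1 : forall xi, cabs (fourier phi xi) <= 1).

Lemma mu_xi_imag xi : is_imag_type phi xi -> exists a, imag_type phi xi (mu_xi phi xi) a.
Proof.
move=> H; rewrite /mu_xi (asboolT H); apply: (xgetPex 0 (P := [set m | exists a, imag_type phi xi m a])).
exact: H.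
Qed.

Lemma mu_xi_pos xi : ~ is_imag_type phi xi -> is_pos_type phi xi -> exists a, pos_type phi xi (mu_xi phi xi) a.
Proof.
move=> H1 H2; rewrite /mu_xi (asboolF H1); apply: (xgetPex 0 (P := [set m | exists a, pos_type phi xi m a])).
exact: H2.
Qed.

Lemma drift_imag xi : is_imag_type phi xi -> exists m, imag_type phi xi m (drift phi xi).
Proof.
move=> [m [a H]]; apply: (xgetPex 0 (P := [set a | exists m, imag_type phi xi m a])).
by exists a, m.
Qed.

Lemma convpow_le2 n x : cabs (convpow phi n.+1 x) <= 2.
Proof.
rewrite convpow_coef// -[X in _ <= X]mulr1; apply: coef_le => xi.
by rewrite cabsX exprn_ile1 ?cabs_ge0.
Qed.

(** The support of [theta] exceeds the fundamental cell, so [c] is first reduced modulo 2 pi to a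
    point at which the hypotheses on [Omega] apply. *)
Lemma local_bound_everywhere (c : Rd) : mu <= 1 ->
  (forall xi, Omega phi xi -> is_pos_type phi xi \/ is_imag_type phi xi) ->
  (forall xi, Omega phi xi -> mu <= mu_xi phi xi) ->
  (forall xi, Omega_i phi xi -> mu_xi phi xi < 1) ->
  (forall xi, Omega_i phi xi -> drift phi xi = alpha) ->
  `|c| <= 4 * pi -> local_bound phi alpha mu c.
Proof.
move=> mu1 Ht Hmu Hi Hdr c4.
have [c1|c1] := ltP (cabs (fourier phi c)) 1; first exact: local_bound_lt1.
have [xi0 Hpi Hc] := reduce_mod_2pi phi c.
have u1 : cabs (fourier phi xi0) = 1.
  by have := Hc 0; rewrite !add0r => <-; apply/eqP; rewrite eq_le F1 c1.
have Om : Omega phi xi0 by split.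
have [Him|Him] := pselect (is_imag_type phi xi0).
  have [a Ha] := mu_xi_imag Him; have [m Hm] := drift_imag Him.
  have aE := imag_type_drift_unique u1 Ha Hm.
  rewrite aE Hdr in Ha; last by split.
  by apply: (local_bound_imag Sphi F1 c4 Hc u1 Ha); [exact: Hmu|apply: Hi].
have Hp : is_pos_type phi xi0 by case: (Ht _ Om).
have [a Ha] := mu_xi_pos Him Hp.
by apply: (local_bound_pos alpha F1 c4 Hc u1 Ha); exact: Hmu.
Qed.

(** The sets [Kn] are balls whose radius grows with n as slowly as the thresholds of [global_bound]
    demand. *)
Lemma upper_bound : global_bound phi alpha mu (fun xi => (theta xi)%:C%C) ->
  forall K : set Rd, compact K -> exists2 C', 0 < C' &
    exists Kn : nat -> set Rd,
      [/\ (forall n, compact (Kn n)), (forall n, K `<=` Kn n), (forall n, Kn n `<=` Kn n.+1),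
          \bigcup_n Kn n = [set: Rd] &
          forall (n : nat) (x : Zd), (0 < n)%N -> Kn n (zR R x - n%:R *: alpha) ->
            cabs (convpow phi n x) <= C' * n%:R `^ (- mu)].
Proof.
move=> [L L0 HL] K cK; have [k k0 Hk] := compact_norm_bound cK.
have [Nf HN] := choice (fun m : nat => HL (m%:R : R)).
pose k1 := (Num.truncn k).+1.
(* [rho n] is the largest radius at most [n], and at least [k1], whose threshold [Nf] has been reached at [n];
   the finitely many [n] below [Nf k1] are absorbed in the constant through the trivial bound [2]. *)
pose rho n := maxn k1 (\max_(m < n.+1 | (Nf m <= n)%N) m).
have rhoP n : (rho n <= k1)%N || (Nf (rho n) <= n)%N.
  rewrite /rho; have [h|h] := leqP (\max_(m < n.+1 | (Nf m <= n)%N) m) k1; first by rewrite leqnn.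
  apply/orP; right.
  (* An empty maximum is 0, which need not satisfy the threshold condition; the value 0 is excluded
     since the maximum exceeds [k1]. *)
  have : (\max_(m < n.+1 | (Nf m <= n)%N) m == 0)%N || (Nf (\max_(m < n.+1 | (Nf m <= n)%N) m) <= n)%N.
    apply: (big_ind (fun v => (v == 0)%N || (Nf v <= n)%N)) => // [u v hu hv|m hm].
      by rewrite /maxn; case: ifP.
    by rewrite hm orbT.
  by case/orP => // /eqP h0; rewrite h0 in h.
have n0 : (forall m : nat, (0 : R) <= m%:R) by [].
pose N0 := Nf k1.
pose S := \sum_(j < N0.+1) (j%:R : R) `^ mu.
have S0 : 0 <= S by apply: sumr_ge0 => j _; exact: powR_ge0.
(* For n below [N0] the number n^mu is one of the terms of [S], so the trivial bound 2 is at most 2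
   S n^(- mu). *)
exists (L + 2 * S + 1); first by rewrite ltr_wpDl// addr_ge0// mulr_ge0.
exists (fun n => [set z : Rd | `|z| <= (rho n)%:R]); split.
- by move=> n; exact: compact_rV_ball.
- move=> n z /Hk h; apply: (le_trans h); apply: (@le_trans _ _ k1%:R); first exact: ltW (truncnS_gt _).
  by rewrite ler_nat leq_maxl.
- move=> n z /= h; apply: (le_trans h); rewrite ler_nat /rho geq_max leq_maxl /=.
  apply: leq_trans (leq_maxr _ _); apply/bigmax_leqP => m hm.
  apply: (leq_trans _ (@leq_bigmax_cond _ _ (fun m : 'I_n.+2 => m : nat) (widen_ord (leqnSn _) m) _)) => //.
  exact: leq_trans hm _.
- apply/seteqP; split => // z _; pose m := (Num.truncn `|z|).+1.
  exists (maxn m (Nf m)) => //=; apply: (@le_trans _ _ m%:R); first exact: ltW (truncnS_gt _).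
  rewrite ler_nat /rho; apply: leq_trans (leq_maxr _ _).
  have mm : (m < (maxn m (Nf m)).+1)%N by rewrite ltnS leq_maxl.
  by apply: (leq_trans _ (@leq_bigmax_cond _ _ (fun m : 'I__ => m : nat) (Ordinal mm) _)) => //=; rewrite leq_maxr.
move=> [//|n] x _ /= xK.
have E : convpow phi n.+1 x = cmean (fun xi => fourier phi xi ^+ n.+1 * (character x xi)^*%C * (theta xi)%:C%C).
  rewrite convpow_coef// /coef; congr cmean; apply/funext => xi; ring.
have np : (0 : R) < n.+1%:R `^ mu by rewrite powR_gt0// ltr0n.
have big (m : nat) : (Nf m <= n.+1)%N -> `|zR R x - n.+1%:R *: alpha| <= m%:R ->
   cabs (convpow phi n.+1 x) <= (L + 2 * S + 1) * n.+1%:R `^ (- mu).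
  move=> h1 h2; rewrite E; apply: le_trans (HN m n.+1 x h1 h2) _.
  rewrite ler_wpM2r ?powR_ge0//; lra.
have [h|h] := leqP (Nf (rho n.+1)) n.+1; first exact: (big (rho n.+1)).
have := rhoP n.+1; rewrite [(Nf _ <= _)%N]leqNgt h orbF => hk.
have [h1|h1] := leqP N0 n.+1.
  apply: (big k1) => //; apply: le_trans xK _; by rewrite ler_nat.
apply: le_trans (convpow_le2 n x) _.
rewrite powRN ler_pdivlMr//.
have : (n.+1%:R : R) `^ mu <= S.
  have nN : (n.+1 < N0.+1)%N by rewrite ltnS ltnW.
  rewrite /S (bigD1 (Ordinal nN))//= lerDl; apply: sumr_ge0 => j _; exact: powR_ge0.
lra.
Qed.

(** The test set lies at the origin and not at [xi0], because only differences of its points, added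
    to [xi0], enter the quadratic form. The restriction |xi| <= 1/2 puts it where [theta] is at
    least 2^(-d), whence that factor in the constant. *)
Lemma lower_bound xi0 : Omega phi xi0 -> is_imag_type phi xi0 -> mu_xi phi xi0 = mu ->
  exists2 C, 0 < C & forall n : nat, (0 < n)%N ->
    C * n%:R `^ (- mu) <= sup (range (fun x => cabs (convpow phi n x))).
Proof.
move=> [_ u1] /mu_xi_imag[a]; move=> Ha muE; rewrite muE in Ha.
have [Q [Qt [Rr [Rt [E [k [gd pQ pR hQ [hR QE k1 RE [sQ sR mE]]]]]]]]] := Ha.
have [r1 r10 EF] := gamma_normalized (c := xi0) (fun z => erefl) u1 gd; have [Qt0 [Rt0 _]] := gd.
have [b b0 Hb] := imag_coherent (D2_normalized Sphi xi0) r10 EF Qt0 Rt0 pQ pR hQ hR QE k1 RE sQ sR.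
have cE : contracting E by case: sQ.
have [K K0 HK] := volume_sublevel pQ hQ QE cE b0.
have uN0 : fourier phi xi0 != 0 by apply/eqP => h; move: u1; rewrite h cabs0; lra.
have p2 := pi_ge2 R.
exists (2^-1 * (2^-1 ^+ d * K)); first by rewrite !mulr_gt0// exprn_gt0.
move=> [//|n] _; set M := sup _.
(* The trivial bound 2 ensures that the set of values is bounded, so that [sup] dominates each of
   them. *)
have ubM x : cabs (convpow phi n.+1 x) <= M.
  apply: ub_le_sup; last by exists x.
  by exists 2 => _ [y _ <-]; exact: convpow_le2.
pose S := [pred xi : Rd | (`|xi| <= 2^-1) && (`|Q xi| <= b / n.+1%:R)].
have n1 : (1 : R) <= n.+1%:R by rewrite ler1n.
have bS : bndf (fun xi : Rd => (S xi)%:R).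
  by exists 1 => xi; rewrite normr_nat -[X in _ <= X]/(1%:R) ler_nat leq_b1.
have vol : 2^-1 ^+ d * K * n.+1%:R `^ (- mu) <= mean (fun xi => theta xi * (S xi)%:R).
  rewrite -mulrA; have d0 : (0 : R) <= 2^-1 ^+ d by rewrite exprn_ge0.
  rewrite mE; apply: le_trans (ler_wpM2l d0 (HK n.+1%:R n1)) _.
  rewrite -(meanZ _ bS); apply: mean_le; [|exact: bndf_Z|apply: bndf_M => //; exact: bndf_theta].
  move=> xi /=; case: (boolP ((`|xi| <= 2^-1) && _)) => [/andP[h _]|_]; last by rewrite !mulr0.
  rewrite !mulr1; apply: theta_near0; apply: le_trans h _; lra.
have pos : 0 < mean (fun xi => theta xi * (S xi)%:R).
  by apply: lt_le_trans vol; rewrite !mulr_gt0 ?exprn_gt0 ?powR_gt0 ?ltr0n.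
rewrite -mulrA; apply: le_trans (ler_wpM2l _ vol) _; first by rewrite invr_ge0.
apply: (convpow_sup_ge Sphi (n := n) (xi0 := xi0) (a := n.+1%:R *: a) (u := (fourier phi xi0 ^+ n.+1)^-1) ubM) => //.
  by rewrite cabsV cabsX u1 expr1n invr1.
move=> zeta eta /andP[_ Hz] /andP[_ He].
have := Hb n.+1 isT zeta eta Hz He; rewrite /normalized dotRZl exprMn exprVn.
by rewrite (addrC _ xi0) [_ / _]mulrC.
Qed.

End MainTheorem.

Theorem mainTheorem14 (R : realType) (d : nat) (phi : 'rV[int]_d -> R[i])
    (alpha : 'rV[R]_d) (mu_phi : R) :
  in_Sd phi ->
  sup (range (fun xi => cabs (fourier phi xi))) = 1 ->
  (forall xi, Omega phi xi -> is_pos_type phi xi \/ is_imag_type phi xi) ->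
  (* mu_phi = min_{xi in Omega(phi)} mu_xi *)
  (forall xi, Omega phi xi -> mu_phi <= mu_xi phi xi) ->
  (exists2 xi, Omega phi xi & mu_xi phi xi = mu_phi) ->
  (* (i) *)
  (forall xi, Omega_i phi xi -> mu_xi phi xi < 1) ->
  (* (ii) *)
  (exists2 xi, Omega_i phi xi & mu_xi phi xi = mu_phi) ->
  (* (iii) common drift alpha *)
  (forall xi, Omega_i phi xi -> drift phi xi = alpha) ->
  Omega_i phi !=set0 ->
  (forall K : set 'rV[R]_d, compact K ->
     exists2 C', 0 < C' &
       exists Kn : nat -> set 'rV[R]_d,
         [/\ (forall n, compact (Kn n)),
             (forall n, K `<=` Kn n),
             (forall n, Kn n `<=` Kn n.+1),
             \bigcup_n Kn n = [set: 'rV[R]_d] &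
             forall (n : nat) (x : 'rV[int]_d), (0 < n)%N ->
               Kn n (zR R x - n%:R *: alpha) ->
               cabs (convpow phi n x) <= C' * n%:R `^ (- mu_phi)]) /\
  (exists2 C, 0 < C &
     forall n : nat, (0 < n)%N ->
       C * n%:R `^ (- mu_phi) <= sup (range (fun x => cabs (convpow phi n x)))).
Proof.
move=> Sphi sup1 Ht Hmu _ Hi [xi0 [Om0 im0] mu0] Hdr _.
have F1 xi : cabs (fourier phi xi) <= 1.
  (* A real [sup] dominates the values only of a bounded set; boundedness follows from the
     summability of [phi]. *)
  rewrite -sup1; apply: ub_le_sup; last by exists xi.
  by have [K HK] := fourier_bndc Sphi; exists K => _ [y _ <-].
have mu1 : mu_phi <= 1 by rewrite -mu0; apply/ltW/Hi.
split; last exact: lower_bound Om0 im0 mu0.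
apply: upper_bound => //; apply: global_bound_all => // [c|| xi].
- exact: local_bound_everywhere.
- exact: isD2_theta.
by move=> h; apply: theta_supp; apply: contra h => /eqP ->.
Qed.
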